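(* The isomorphism problem for UHF algebras is $\Pi^0_2$ complete. That is, the set of all pairs $(e_0,e_1)\in\mathbb{N}^2$ such that $e_0$ and $e_1$ index computable (or c.e.) presentations of $*$-isomorphic UHF algebras is $\Pi^0_2$ complete.
   Context: A UHF (uniformly hyperfinite) algebra is a unital C*-algebra that is an inductive limit of a sequence of full matrix algebras $M_{n_s}(\mathbb{C})$ with unital bonding $*$-homomorphisms. A presentation $\mathbf{A}^\#$ of a C*-algebra $\mathbf{A}$ is a sequence $(a_0,a_1,\dots)$ in $\mathbf{A}$ (special points) generating a dense $*$-subalgebra; generated points are the values $p(a_0,\dots,a_n)$ of $*$-polynomials with coefficients in $\mathbb{Q}(i)$, effectively listed. $\mathbf{A}^\#$ is computable if there is an algorithm that, given a generated point $q$ and $k\in\mathbb{N}$, outputs a rational within $2^{-k}$ of $\|q\|$; it is c.e. if there is an algorithm that, given a generated point $q$, enumerates a decreasing sequence of rationals converging to $\|q\|$. An index of the computable (resp. c.e.) presentation is a natural number coding such an algorithm. The isomorphism problem for a class of structures is the problem of determining whether two natural numbers index presentations of isomorphic structures in the class. A set is $\Pi^0_2$ if it is definable in the form $\forall y\,\exists z\,R(x,y,z)$ with $R$ computable; it is $\Pi^0_2$ complete if in addition every $\Pi^0_2$ set is many-one reducible to it. *)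

(* Defs.v *)
From HB Require Import structures.
From Stdlib Require Cantor.
From mathcomp Require Import all_boot all_order all_algebra.
From mathcomp Require Import all_classical all_reals all_analysis.
From mathcomp Require Import complex.

Set Implicit Arguments.
Unset Strict Implicit.
Unset Printing Implicit Defensive.

Import Order.TTheory GRing.Theory Num.Theory.
Import numFieldNormedType.Exports.

Local Open Scope classical_set_scope.
Local Open Scope ring_scope.

(* Partial recursive functions nat -> nat; several arguments are passed through
   the Cantor pairing bijection. *)

Definition npair (x y : nat) : nat := Cantor.to_nat (x, y).
Definition nfst (n : nat) : nat := (Cantor.of_nat n).1.
Definition nsnd (n : nat) : nat := (Cantor.of_nat n).2.

Inductive code : Type :=
  | CZero
  | CSucc
  | CFst
  | CSnd
  | CPair (c d : code)
  | CComp (c d : code)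
  | CRec (c d : code)
  | CMin (c : code).

(* [evals c x y]: the computation of [c] on input [x] halts with output [y].
   [CRec c d] is primitive recursion on the second component of the input,
   [CMin c] is unbounded minimisation. *)
Fixpoint evals (c : code) (x y : nat) {struct c} : Prop :=
  match c with
  | CZero => y = 0%N
  | CSucc => y = x.+1
  | CFst => y = nfst x
  | CSnd => y = nsnd x
  | CPair c d =>
      exists u v, [/\ evals c x u, evals d x v & y = npair u v]
  | CComp c d => exists2 u, evals d x u & evals c u y
  | CRec c d =>
      (fix rec (k z : nat) {struct k} : Prop :=
         match k with
         | 0 => evals c (nfst x) z
         | k'.+1 => exists2 u, rec k' u &
                      evals d (npair (nfst x) (npair k' u)) z
         end) (nsnd x) y
  | CMin c =>
      evals c (npair x y) 0%N /\
      (forall m, (m < y)%N -> exists u, evals c (npair x m) u.+1)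
  end.

(* Goedel numbering; a bijection between [code] and [nat]. *)
Fixpoint encode_code (c : code) : nat :=
  match c with
  | CZero => 0
  | CSucc => 1
  | CFst => 2
  | CSnd => 3
  | CPair c d => 4 * npair (encode_code c) (encode_code d) + 4
  | CComp c d => 4 * npair (encode_code c) (encode_code d) + 5
  | CRec c d => 4 * npair (encode_code c) (encode_code d) + 6
  | CMin c => 4 * encode_code c + 7
  end%N.

(* The e-th partial recursive function maps x to y. *)
Definition phi_eval (e x y : nat) : Prop :=
  exists2 c, encode_code c = e & evals c x y.

Definition computable_fun (f : nat -> nat) : Prop :=
  exists e, forall x, phi_eval e x (f x).

Definition computable_rel3 (r : nat -> nat -> nat -> bool) : Prop :=
  computable_fun (fun n => nat_of_bool (r (nfst n) (nfst (nsnd n)) (nsnd (nsnd n)))).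

Definition Pi02 (S : set nat) : Prop :=
  exists2 r : nat -> nat -> nat -> bool, computable_rel3 r &
    forall x, S x <-> forall y, exists z, r x y z.

Definition many_one_reducible (T S : set nat) : Prop :=
  exists2 f : nat -> nat, computable_fun f & forall x, T x <-> S (f x).

Definition Pi02_complete (S : set nat) : Prop :=
  Pi02 S /\ forall T : set nat, Pi02 T -> many_one_reducible T S.

(* Sets of pairs are regarded as sets of natural numbers via Cantor pairing. *)
Definition Pi02_complete2 (S : set (nat * nat)) : Prop :=
  Pi02_complete [set Cantor.to_nat p | p in S].

(* An effective surjective listing of the rational numbers. *)
Definition rat_of_code (n : nat) : rat :=
  ((nfst (nfst n))%:R - (nsnd (nfst n))%:R) / (nsnd n).+1%:R.

HB.mixin Record Algebra_isStarAlgebra (K : numClosedFieldType) A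
    of GRing.Algebra K A := {
  star : A -> A;
  starK : involutive star;
  starD : forall x y : A, star (x + y) = star x + star y;
  starZ : forall (a : K) (x : A), star (a *: x) = a^* *: star x;
  starM : forall x y : A, star (x * y) = star y * star x
}.

#[short(type="starAlgType")]
HB.structure Definition StarAlgebra (K : numClosedFieldType) :=
  {A of GRing.Algebra K A & Algebra_isStarAlgebra K A}.

(* Unital (and non-zero) C*-algebras. The multiplication is part of the mixin
   because MathComp has no common superstructure of [pzSemiRingType] and
   [semiNormedZmodType], so that the join of [algType] with [normedModType]
   cannot be declared; the algebra structure is put on the alias [calg A]. *)
HB.mixin Record CompleteNormedModule_isCStar (R : realType) A
    of CompleteNormedModule R[i] A := {
  cone : A;
  cmul : A -> A -> A;
  cstar : A -> A;
  cmulA : associative cmul;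
  cmul1x : left_id cone cmul;
  cmulx1 : right_id cone cmul;
  cmulDl : left_distributive cmul +%R;
  cmulDr : right_distributive cmul +%R;
  cone_neq0 : cone != 0;
  cscaleAl : forall (a : R[i]) (x y : A), a *: cmul x y = cmul (a *: x) y;
  cscaleAr : forall (a : R[i]) (x y : A), a *: cmul x y = cmul x (a *: y);
  cstarK : involutive cstar;
  cstarD : forall x y : A, cstar (x + y) = cstar x + cstar y;
  cstarZ : forall (a : R[i]) (x : A), cstar (a *: x) = a^* *: cstar x;
  cstarM : forall x y : A, cstar (cmul x y) = cmul (cstar y) (cstar x);
  cnormM : forall x y : A, `|cmul x y| <= `|x| * `|y|;
  cnorm_star : forall x : A, `|cmul (cstar x) x| = `|x| ^+ 2
}.

#[short(type="cstarType")]
HB.structure Definition CStar (R : realType) :=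
  {A of CompleteNormedModule R[i] A & CompleteNormedModule_isCStar R A}.

Definition calg (R : realType) (A : cstarType R) : Type := A.

Section CStarAlgebraStructure.
Variables (R : realType) (A : cstarType R).
HB.instance Definition _ := GRing.Lmodule.copy (calg A) A.
HB.instance Definition _ := GRing.Zmodule_isNzRing.Build (calg A)
  (@cmulA R A) (@cmul1x R A) (@cmulx1 R A) (@cmulDl R A) (@cmulDr R A)
  (@cone_neq0 R A).
HB.instance Definition _ :=
  GRing.Lmodule_isLalgebra.Build R[i] (calg A) (@cscaleAl R A).
HB.instance Definition _ :=
  GRing.Lalgebra_isAlgebra.Build R[i] (calg A) (@cscaleAr R A).
HB.instance Definition _ := Algebra_isStarAlgebra.Build R[i] (calg A)
  (@cstarK R A) (@cstarD R A) (@cstarZ R A) (@cstarM R A).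
End CStarAlgebraStructure.

(* The norm of a [normedModType R[i]] is a real number typed in [R[i]]. *)
Definition rnorm (R : realType) (A : cstarType R) (x : A) : R :=
  complex.Re `|x|.

Section MatrixStar.
Variables (K : numClosedFieldType) (n : nat).
Implicit Types A B : 'M[K]_n.+1.

Definition mxstar A : 'M[K]_n.+1 := map_mx Num.conj A^T.

Fact mxstarK : involutive mxstar.
Proof. by move=> A; apply/matrixP=> i j; rewrite !mxE conjCK. Qed.
Fact mxstarD A B : mxstar (A + B) = mxstar A + mxstar B.
Proof. by apply/matrixP=> i j; rewrite !mxE rmorphD. Qed.
Fact mxstarZ (a : K) A : mxstar (a *: A) = a^* *: mxstar A.
Proof. by apply/matrixP=> i j; rewrite !mxE rmorphM. Qed.
Fact mxstarM A B : mxstar (A * B) = mxstar B * mxstar A.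
Proof. by rewrite /mxstar -!mulmxE trmx_mul map_mxM. Qed.

HB.instance Definition _ := Algebra_isStarAlgebra.Build K 'M[K]_n.+1
  mxstarK mxstarD mxstarZ mxstarM.
End MatrixStar.

(* Unital *-homomorphisms are the [{lrmorphism A -> B}] preserving [star]. *)
Definition star_preserving (K : numClosedFieldType) (A B : starAlgType K)
  (f : A -> B) : Prop := forall x, f (star x) = star (f x).

Definition star_isomorphic (R : realType) (A B : cstarType R) : Prop :=
  exists2 f : {lrmorphism calg A -> calg B}, star_preserving f & bijective f.

(* Cocones and colimits of a sequence of unital *-algebras in the category of
   unital C*-algebras; automatic continuity makes the norms of the [M s]
   irrelevant. *)
Definition cocone (R : realType) (M : nat -> starAlgType R[i])
    (phi : forall s, {lrmorphism M s -> M s.+1}) (B : cstarType R)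
    (mu : forall s, {lrmorphism M s -> calg B}) : Prop :=
  (forall s, star_preserving (mu s)) /\
  (forall s x, mu s.+1 (phi s x) = mu s x).

Definition is_inductive_limit (R : realType) (M : nat -> starAlgType R[i])
    (phi : forall s, {lrmorphism M s -> M s.+1}) (A : cstarType R) : Prop :=
  exists2 mu : forall s, {lrmorphism M s -> calg A}, cocone phi mu &
    forall (B : cstarType R) (nu : forall s, {lrmorphism M s -> calg B}),
      cocone phi nu ->
      (exists h : {lrmorphism calg A -> calg B},
         star_preserving h /\ forall s x, h (mu s x) = nu s x) /\
      (forall h h' : {lrmorphism calg A -> calg B},
         star_preserving h -> (forall s x, h (mu s x) = nu s x) ->
         star_preserving h' -> (forall s x, h' (mu s x) = nu s x) ->
         h =1 h').

Definition is_UHF (R : realType) (A : cstarType R) : Prop :=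
  exists (n : nat -> nat)
    (phi : forall s, {lrmorphism 'M[R[i]]_((n s).+1) -> 'M[R[i]]_((n s.+1).+1)}),
    (forall s, star_preserving (phi s)) /\
    is_inductive_limit (M := fun s => 'M[R[i]]_((n s).+1)) phi A.

Definition star_subalgebra (K : numClosedFieldType) (A : starAlgType K)
    (S : set A) : Prop :=
  [/\ S 1,
      forall x y, S x -> S y -> S (x + y),
      forall (a : K) x, S x -> S (a *: x),
      forall x y, S x -> S y -> S (x * y) &
      forall x, S x -> S (star x)].

(* The sequence [a] of special points makes [A] a presented C*-algebra. *)
Definition is_presentation (R : realType) (A : cstarType R) (a : nat -> A)
  : Prop := dense (smallest (@star_subalgebra _ (calg A)) (range a) : set A).

(* Expressions for *-polynomials with coefficients in Q(i), constant terms
   allowed. [PConst m n] is the coefficient p + q i, where p and q are the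
   rationals coded by m and n. *)
Inductive starpoly : Type :=
  | PConst (m n : nat)
  | PVar (n : nat)
  | PStar (p : starpoly)
  | PAdd (p q : starpoly)
  | PMul (p q : starpoly).

(* The effective listing of *-polynomials; a bijection onto [nat]. *)
Fixpoint encode_poly (p : starpoly) : nat :=
  match p with
  | PConst m n => 5 * npair m n
  | PVar n => 5 * n + 1
  | PStar p => 5 * encode_poly p + 2
  | PAdd p q => 5 * npair (encode_poly p) (encode_poly q) + 3
  | PMul p q => 5 * npair (encode_poly p) (encode_poly q) + 4
  end%N.

(* The generated point [p(a 0, a 1, ...)]. *)
Fixpoint peval (R : realType) (A : cstarType R) (a : nat -> A)
    (p : starpoly) : calg A :=
  match p with
  | PConst m n =>
      (ratr (rat_of_code m) + 'i * ratr (rat_of_code n) : R[i])%:A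
  | PVar n => a n
  | PStar p => star (peval a p)
  | PAdd p q => peval a p + peval a q
  | PMul p q => peval a p * peval a q
  end.

Definition computable_index (R : realType) (e : nat) (A : cstarType R)
    (a : nat -> A) : Prop :=
  is_presentation a /\
  forall (p : starpoly) (k : nat), exists2 n,
    phi_eval e (npair (encode_poly p) k) n &
    `| ratr (rat_of_code n) - rnorm (peval a p) | < 2 ^- k.

Definition ce_index (R : realType) (e : nat) (A : cstarType R)
    (a : nat -> A) : Prop :=
  is_presentation a /\
  forall p : starpoly, exists u : nat -> nat,
    [/\ forall j, phi_eval e (npair (encode_poly p) j) (u j),
        {homo (fun j => rat_of_code (u j)) : i j / (i <= j)%N >-> j <= i} &
        (fun j => ratr (rat_of_code (u j)) : R) @ \oo --> rnorm (peval a p)].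

Definition UHF_isomorphism_problem (R : realType)
    (index : nat -> forall A : cstarType R, (nat -> A) -> Prop)
  : set (nat * nat) :=
  [set e | exists (A B : cstarType R) (a : nat -> A) (b : nat -> B),
     [/\ is_UHF A, is_UHF B, index e.1 A a, index e.2 B b &
         star_isomorphic A B]].

(* Main.v *)
(* Upper bound. An index e determines upper cuts of the numbers ||p(a)||, uniformly Sigma^0_1 in the
   *-polynomial p, and it is a Pi^0_2 condition that these numbers form a C*-seminorm on the
   *-polynomials; the completion of the *-polynomials is then a C*-algebra presented by e. Two such
   algebras are isomorphic UHF algebras if and only if all pairs of sufficiently precise systems of
   n x n approximate matrix units can be refined, by the same factor m in both algebras, to arbitrarily
   precise systems whose span approximates a given generated point: this is again Pi^0_2. If the
   condition holds, iterating it yields in both algebras dense unions of exact matrix algebras of the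
   same sizes. Conversely, in a UHF algebra approximate matrix units are close to approximate matrix
   units of one of the matrix algebras M_N of the inductive system, and there they are close to exact
   units that can be refined to a full system of matrix units of M_N; the isomorphism makes it
   possible to use the same M_N on both sides, and hence the same m.

   Hardness. Whether a number is an index at all is already Pi^0_2 hard, because the index must be
   total; a single presented UHF algebra, the complex numbers, suffices. *)

From HB Require Import structures.
Require Import Defs.
From mathcomp Require Import all_boot all_order all_algebra.
From mathcomp Require Import all_classical all_reals all_analysis.
From mathcomp Require Import complex zify ring lra.

Set Implicit Arguments.
Unset Strict Implicit.
Unset Printing Implicit Defensive.

Import Order.TTheory GRing.Theory Num.Theory.
Import numFieldNormedType.Exports Normc.

Local Open Scope classical_set_scope.

Local Open Scope nat_scope.

(** * Recursive functions and the arithmetical hierarchy *)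

(** A c.e. index gives no lower bounds on norms, so conditions have to be phrased through upper
    cuts. This works because an inequality such as s(p + q) <= s(p) + s(q) amounts to implications
    between upper cuts, from Sigma^0_1 to Sigma^0_1, which are Pi^0_2 when universally quantified.
    With the cuts abstracted as [U], the same formulas serve both kinds of index.

    Precision is the delicate point. The coefficients that approximate a generated point may be
    huge, and they multiply the error of the matrix units. Hence the coefficients are found from
    exact units, then [T'] is chosen above them, and only then are the exact units replaced by
    generated points, with the precision [kap] belonging to [T'].

    Inductive limits are given by a universal property in the category of unital *-homomorphisms, so
    the density of the union and the continuity of homomorphisms have to be derived. Spectral theory
    is used for matrices only; a general C*-algebra contributes just the square root of 1 - z^2 for
    a small self-adjoint z, obtained by iteration. *)

Lemma nfst_npair a b : nfst (npair a b) = a.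
Proof. by rewrite /nfst /npair Cantor.cancel_of_to. Qed.

Lemma nsnd_npair a b : nsnd (npair a b) = b.
Proof. by rewrite /nsnd /npair Cantor.cancel_of_to. Qed.

Lemma npairK n : npair (nfst n) (nsnd n) = n.
Proof. by rewrite /npair /nfst /nsnd -surjective_pairing Cantor.cancel_to_of. Qed.

Definition npE := (nfst_npair, nsnd_npair).

Lemma leq_npair a b : a + b <= npair a b.
Proof. by apply/ssrnat.leP; have := Cantor.to_nat_non_decreasing a b; rewrite /npair; lia. Qed.

Lemma nfst_le n : nfst n <= n.
Proof. by have := leq_npair (nfst n) (nsnd n); rewrite npairK; lia. Qed.

Lemma nsnd_le n : nsnd n <= n.
Proof. by have := leq_npair (nfst n) (nsnd n); rewrite npairK; lia. Qed.

Lemma npair_inj a b c d : npair a b = npair c d -> a = c /\ b = d.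
Proof.
move=> e; split; first by rewrite -[a](nfst_npair a b) e nfst_npair.
by rewrite -[b](nsnd_npair a b) e nsnd_npair.
Qed.

Lemma evals_CRec0 c d a z : evals (CRec c d) (npair a 0) z <-> evals c a z.
Proof. by rewrite /= !npE. Qed.

Lemma evals_CRecS c d a k z : evals (CRec c d) (npair a k.+1) z <->
  exists2 u, evals (CRec c d) (npair a k) u & evals d (npair a (npair k u)) z.
Proof. by rewrite /= !npE. Qed.

Lemma evals_fun c x y y' : evals c x y -> evals c x y' -> y = y'.
Proof.
elim: c x y y' => [||||c IHc d IHd|c IHc d IHd|c IHc d IHd|c IHc] x y y'.
- by move=> /= -> ->.
- by move=> /= -> ->.
- by move=> /= -> ->.
- by move=> /= -> ->.
- move=> /= [u [v [cu dv ->]]] [u' [v' [cu' dv' ->]]].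
  by rewrite (IHc _ _ _ cu cu') (IHd _ _ _ dv dv').
- by move=> /= [u du cy] [u' du' cy']; rewrite (IHd _ _ _ du du') in cy; apply: IHc cy cy'.
- rewrite -(npairK x); move: (nfst x) (nsnd x) => a k; elim: k y y' => [|k IHk] y y'.
    by rewrite !evals_CRec0; apply: IHc.
  rewrite !evals_CRecS => -[u cu du] [u' cu' du'].
  by rewrite (IHk _ _ cu cu') in du; apply: IHd du du'.
- move=> /= [cy ly] [cy' ly'].
  case: (ltngtP y y') => // lt.
    by have [u cu] := ly' _ lt; have := IHc _ _ _ cy cu.
  by have [u cu] := ly _ lt; have := IHc _ _ _ cy' cu.
Qed.

Lemma encode_code_inj c d : encode_code c = encode_code d -> c = d.
Proof.
elim: c d => [||||c IHc c' IHc'|c IHc c' IHc'|c IHc c' IHc'|c IHc]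
  [||||d d'|d d'|d d'|d] //=; try lia.
- move=> e; have /npair_inj[e1 e2] : npair (encode_code c) (encode_code c') =
    npair (encode_code d) (encode_code d') by lia.
  by rewrite (IHc _ e1) (IHc' _ e2).
- move=> e; have /npair_inj[e1 e2] : npair (encode_code c) (encode_code c') =
    npair (encode_code d) (encode_code d') by lia.
  by rewrite (IHc _ e1) (IHc' _ e2).
- move=> e; have /npair_inj[e1 e2] : npair (encode_code c) (encode_code c') =
    npair (encode_code d) (encode_code d') by lia.
  by rewrite (IHc _ e1) (IHc' _ e2).
- by move=> e; rewrite (IHc d) //; lia.
Qed.

Lemma encode_code_surj n : exists c, encode_code c = n.
Proof.
have [m] := ubnP n; elim: m n => // m IH n lt.
case: (ltnP n 4) => [|le4].
  case: n {lt} => [|[|[|[|//]]]] _; [by exists CZero | by exists CSucc | by exists CFst | by exists CSnd].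
have [q [r [nE ltr]]] : exists q r, n = 4 * q + 4 + r /\ r < 4.
  by exists ((n - 4) %/ 4), ((n - 4) %% 4); have := divn_eq (n - 4) 4; have := ltn_mod (n - 4) 4; lia.
have [c cE] : exists c, encode_code c = nfst q by apply: IH; have := nfst_le q; lia.
have [d dE] : exists c, encode_code c = nsnd q by apply: IH; have := nsnd_le q; lia.
have [e eE] : exists c, encode_code c = q by apply: IH; lia.
case: r nE ltr => [|[|[|[|//]]]] nE _.
- by exists (CPair c d) => /=; rewrite cE dE npairK; lia.
- by exists (CComp c d) => /=; rewrite cE dE npairK; lia.
- by exists (CRec c d) => /=; rewrite cE dE npairK; lia.
- by exists (CMin e) => /=; rewrite eE; lia.
Qed.

Lemma phi_evalE c x y : phi_eval (encode_code c) x y <-> evals c x y.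
Proof. by split=> [[d /encode_code_inj -> //]|cy]; exists c. Qed.

Lemma phi_eval_fun e x y y' : phi_eval e x y -> phi_eval e x y' -> y = y'.
Proof.
by have [c <-] := encode_code_surj e; rewrite !phi_evalE; apply: evals_fun.
Qed.

Definition comp (f : nat -> nat) := exists c, forall x, evals c x (f x).

Lemma comp_computable f : comp f -> computable_fun f.
Proof. by move=> [c cf]; exists (encode_code c) => x; apply/phi_evalE. Qed.

Lemma computable_comp f : computable_fun f -> comp f.
Proof.
move=> [e ef]; have [c ce] := encode_code_surj e.
by exists c => x; apply/phi_evalE; rewrite ce.
Qed.

Lemma comp_ext f g : f =1 g -> comp f -> comp g.
Proof. by move=> fg [c cf]; exists c => x; rewrite -fg. Qed.

Lemma comp_app f g : comp f -> comp g -> comp (fun x => f (g x)).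
Proof. by move=> [c cf] [d dg]; exists (CComp c d) => x; exists (g x). Qed.

Lemma comp_pair f g : comp f -> comp g -> comp (fun x => npair (f x) (g x)).
Proof. by move=> [c cf] [d dg]; exists (CPair c d) => x; exists (f x), (g x). Qed.

Lemma comp_fst f : comp f -> comp (fun x => nfst (f x)).
Proof. by move=> hf; apply: (@comp_app nfst f) => //; exists CFst. Qed.

Lemma comp_snd f : comp f -> comp (fun x => nsnd (f x)).
Proof. by move=> hf; apply: (@comp_app nsnd f) => //; exists CSnd. Qed.

Lemma comp_nfst : comp nfst. Proof. by exists CFst. Qed.

Lemma comp_nsnd : comp nsnd. Proof. by exists CSnd. Qed.

Lemma comp_id : comp (fun x => x).
Proof. by exists (CPair CFst CSnd) => x; exists (nfst x), (nsnd x); split => //; rewrite npairK. Qed.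

Lemma comp_succ f : comp f -> comp (fun x => (f x).+1).
Proof. by move=> hf; apply: (@comp_app succn f) => //; exists CSucc. Qed.

Lemma comp_const n : comp (fun=> n).
Proof. by elim: n => [|n IH]; [exists CZero | apply: comp_succ]. Qed.

Definition prec (b : nat) (s : nat -> nat -> nat) (n : nat) : nat :=
  nat_rect (fun=> nat) b s n.

Lemma comp_prec b s h : comp b ->
  comp (fun y => s (nfst y) (nfst (nsnd y)) (nsnd (nsnd y))) ->
  comp h -> comp (fun x => prec (b x) (s x) (h x)).
Proof.
move=> [c cb] [d ds] hh.
have hr : comp (fun y => prec (b (nfst y)) (s (nfst y)) (nsnd y)).
  exists (CRec c d) => y; rewrite -{1}(npairK y).
  elim: (nsnd y) => [|k IH]; first by apply/evals_CRec0; exact: cb.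
  apply/evals_CRecS; exists (prec (b (nfst y)) (s (nfst y)) k) => //.
  by have := ds (npair (nfst y) (npair k (prec (b (nfst y)) (s (nfst y)) k))); rewrite !npE.
apply: comp_ext (comp_app hr (comp_pair comp_id hh)) => x.
by rewrite !npE.
Qed.

Lemma comp_add f g : comp f -> comp g -> comp (fun x => f x + g x).
Proof.
move=> hf hg; apply: (@comp_ext (fun x => prec (f x) (fun _ u => u.+1) (g x))).
  by move=> x; elim: (g x) => [|k /= ->]; rewrite ?addn0 ?addnS.
by apply: comp_prec => //; apply/comp_succ/comp_snd/comp_snd/comp_id.
Qed.

Lemma comp_mul f g : comp f -> comp g -> comp (fun x => f x * g x).
Proof.
move=> hf hg; apply: (@comp_ext (fun x => prec 0 (fun _ u => u + f x) (g x))).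
  by move=> x; elim: (g x) => [|k /= ->]; rewrite ?muln0 ?mulnS ?[f x + _]addnC.
apply: comp_prec => //; first exact: comp_const.
apply: comp_add; first exact/comp_snd/comp_snd/comp_id.
by apply: (comp_app hf); apply/comp_fst/comp_id.
Qed.

Lemma comp_exp f g : comp f -> comp g -> comp (fun x => f x ^ g x).
Proof.
move=> hf hg; apply: (@comp_ext (fun x => prec 1 (fun _ u => f x * u) (g x))).
  by move=> x; elim: (g x) => [|k /= ->]; rewrite ?expn0 ?expnS.
apply: comp_prec => //; first exact: comp_const.
apply: comp_mul; last exact/comp_snd/comp_snd/comp_id.
by apply: (comp_app hf); apply/comp_fst/comp_id.
Qed.

Lemma comp_pred f : comp f -> comp (fun x => (f x).-1).
Proof.
move=> hf; apply: (@comp_ext (fun x => prec 0 (fun k _ => k) (f x))).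
  by move=> x; case: (f x).
by apply: comp_prec => //; [exact: comp_const | apply/comp_fst/comp_snd/comp_id].
Qed.

Lemma comp_sub f g : comp f -> comp g -> comp (fun x => f x - g x).
Proof.
move=> hf hg; apply: (@comp_ext (fun x => prec (f x) (fun _ u => u.-1) (g x))).
  by move=> x; elim: (g x) => [|k /= ->]; rewrite ?subn0 ?subnS.
by apply: comp_prec => //; apply/comp_pred/comp_snd/comp_snd/comp_id.
Qed.

Definition dec (P : nat -> bool) := comp (fun x => nat_of_bool (P x)).

Lemma comp_if P f g : dec P -> comp f -> comp g ->
  comp (fun x => if P x then f x else g x).
Proof.
move=> hP hf hg; apply: (@comp_ext (fun x => prec (g x) (fun _ _ => f x) (P x))).
  by move=> x; case: (P x).
by apply: comp_prec => //; apply: (comp_app hf); apply/comp_fst/comp_id.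
Qed.

Lemma dec_ext P Q : P =1 Q -> dec P -> dec Q.
Proof. by move=> PQ; apply: comp_ext => x; rewrite PQ. Qed.

Lemma dec_not P : dec P -> dec (fun x => ~~ P x).
Proof.
move=> hP; apply: (@comp_ext (fun x => if P x then 0 else 1)).
  by move=> x; case: (P x).
by apply: comp_if => //; exact: comp_const.
Qed.

Lemma dec_and P Q : dec P -> dec Q -> dec (fun x => P x && Q x).
Proof.
move=> hP hQ; apply: (@comp_ext (fun x => if P x then nat_of_bool (Q x) else 0)).
  by move=> x; case: (P x).
by apply: comp_if => //; exact: comp_const.
Qed.

Lemma dec_or P Q : dec P -> dec Q -> dec (fun x => P x || Q x).
Proof.
move=> hP hQ; apply: (@comp_ext (fun x => if P x then 1 else nat_of_bool (Q x))).
  by move=> x; case: (P x).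
by apply: comp_if => //; exact: comp_const.
Qed.

Lemma dec_leq f g : comp f -> comp g -> dec (fun x => f x <= g x).
Proof.
move=> hf hg; apply: (@comp_ext (fun x => 1 - (f x - g x))).
  by move=> x; lia.
by apply: comp_sub; [exact: comp_const | exact: comp_sub].
Qed.

Lemma dec_eq f g : comp f -> comp g -> dec (fun x => f x == g x).
Proof.
move=> hf hg; apply: (@dec_ext (fun x => (f x <= g x) && (g x <= f x))).
  by move=> x; rewrite eqn_leq.
by apply: dec_and; exact: dec_leq.
Qed.

Definition ballb (n : nat) (P : nat -> bool) : bool := all P (iota 0 n).

Lemma ballbP n (P : nat -> bool) : reflect (forall i, i < n -> P i) (ballb n P).
Proof.
by apply: (iffP allP) => H i; move: (H i); rewrite mem_iota.
Qed.

Lemma dec_ballb b (P : nat -> nat -> bool) : comp b -> dec (fun y => P (nfst y) (nsnd y)) ->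
  dec (fun x => ballb (b x) (P x)).
Proof.
move=> hb hP.
apply: (@comp_ext (fun x => prec 1 (fun k u => if P x k then u else 0) (b x))).
  move=> x; elim: (b x) => [//|k /= ->].
  by rewrite /ballb -[k.+1]addn1 iotaD all_cat /= add0n andbT; case: (P x k); rewrite ?andbT ?andbF.
apply: comp_prec => //; first exact: comp_const.
apply: comp_if; last exact: comp_const; last exact/comp_snd/comp_snd/comp_id.
apply: (@comp_ext (fun y => (fun y => nat_of_bool (P (nfst y) (nsnd y))) (npair (nfst y) (nfst (nsnd y))))).
  by move=> y /=; rewrite !npE.
apply: (comp_app hP); apply: comp_pair; first exact/comp_fst/comp_id.
exact/comp_fst/comp_snd/comp_id.
Qed.

(** Stated for the graph, so that it also covers inputs without a witness, on which the search
    diverges; the reduction rests on this divergence. *)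
Lemma search_code (P : nat -> nat -> bool) : dec (fun y => P (nfst y) (nsnd y)) ->
  exists c, forall x y, evals c x y <-> (P x y /\ forall m, m < y -> ~~ P x m).
Proof.
move=> /dec_not[c cP]; exists (CMin c) => x y /=.
have E m v : evals c (npair x m) v <-> v = ~~ P x m.
  have := cP (npair x m); rewrite !npE => cm.
  by split=> [cv|->//]; apply: evals_fun cv cm.
split.
  move=> [/E e1 H]; split; first by case: (P x y) e1.
  by move=> m /H[u /E]; case: (P x m).
by move=> [Pxy H]; split; [apply/E; rewrite Pxy | move=> m /H Pm; exists 0; apply/E; rewrite Pm].
Qed.

Lemma comp_search (P : nat -> nat -> bool) f : dec (fun y => P (nfst y) (nsnd y)) ->
  (forall x, P x (f x) /\ forall m, m < f x -> ~~ P x m) -> comp f.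
Proof. by move=> /search_code[c cP] H; exists c => x; apply/cP. Qed.

Definition Sig (P : nat -> Prop) :=
  exists2 r, dec (fun y => r (nfst y) (nsnd y)) & forall x, P x <-> exists z, r x z.

Lemma comp_app2 (F : nat -> nat -> nat) f g : comp (fun y => F (nfst y) (nsnd y)) ->
  comp f -> comp g -> comp (fun x => F (f x) (g x)).
Proof.
move=> hF hf hg; apply: comp_ext (comp_app hF (comp_pair hf hg)) => x.
by rewrite !npE.
Qed.

Lemma dec_app2 (F : nat -> nat -> bool) f g : dec (fun y => F (nfst y) (nsnd y)) ->
  comp f -> comp g -> dec (fun x => F (f x) (g x)).
Proof. exact: (@comp_app2 (fun x y => nat_of_bool (F x y))). Qed.

Lemma Sig_ext P Q : (forall x, P x <-> Q x) -> Sig P -> Sig Q.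
Proof. by move=> PQ [r hr H]; exists r => // x; rewrite -PQ. Qed.

Lemma Sig_dec (P : nat -> bool) : dec P -> Sig (fun x => P x).
Proof.
move=> hP; exists (fun x _ => P x); first exact: (comp_app hP (comp_fst comp_id)).
by move=> x; split=> [|[]//]; exists 0.
Qed.

Lemma Sig_app P f : Sig P -> comp f -> Sig (fun x => P (f x)).
Proof.
move=> [r hr H] hf; exists (fun x => r (f x)) => [|x]; last exact: H.
apply: (dec_app2 hr); last exact/comp_snd/comp_id.
by apply: (comp_app hf); apply/comp_fst/comp_id.
Qed.

Lemma Sig_and P Q : Sig P -> Sig Q -> Sig (fun x => P x /\ Q x).
Proof.
move=> [r hr H] [t ht K]; exists (fun x z => r x (nfst z) && t x (nsnd z)).
  apply: dec_and; [apply: (dec_app2 hr)|apply: (dec_app2 ht)];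
  [exact/comp_fst/comp_id | exact/comp_fst/comp_snd/comp_id |
   exact/comp_fst/comp_id | exact/comp_snd/comp_snd/comp_id].
move=> x; rewrite H K; split; last by move=> [z /andP[? ?]]; split; [exists (nfst z) | exists (nsnd z)].
by move=> [[z rz] [w tw]]; exists (npair z w); rewrite !npE rz.
Qed.

Lemma Sig_ex P : Sig (fun y => P (nfst y) (nsnd y)) -> Sig (fun x => exists z, P x z).
Proof.
move=> [r hr H]; exists (fun x z => r (npair x (nfst z)) (nsnd z)).
  apply: (dec_app2 hr); last exact/comp_snd/comp_snd/comp_id.
  by apply: comp_pair; [exact/comp_fst/comp_id | exact/comp_fst/comp_snd/comp_id].
move=> x; split=> [[z]|[z rz]].
  have := H (npair x z); rewrite !npE => -> [w rw].
  by exists (npair z w); rewrite !npE.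
by exists (nfst z); have := H (npair x (nfst z)); rewrite !npE => ->; exists (nsnd z).
Qed.

Lemma Sig_or P Q : Sig P -> Sig Q -> Sig (fun x => P x \/ Q x).
Proof.
move=> [r hr H] [t ht K]; exists (fun x z => r x z || t x z); first exact: dec_or.
move=> x; rewrite H K; split; last by move=> [z /orP[]]; [left|right]; exists z.
by move=> [[z rz]|[z tz]]; exists z; rewrite ?rz ?tz ?orbT.
Qed.

Lemma Sig_eq f g : comp f -> comp g -> Sig (fun x => f x = g x).
Proof.
move=> hf hg; apply: Sig_ext (Sig_dec (dec_eq hf hg)) => x.
by split=> /eqP.
Qed.

(** Every number codes an infinite sequence by iterated pairing: no length is stored, and any finite
    initial segment can be prescribed. *)
Definition lnth (L i : nat) : nat := nfst (iter i nsnd L).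

Lemma lnth_ex (g : nat -> nat) b : exists L, forall i, i < b -> lnth L i = g i.
Proof.
elim: b g => [|b IH] g; first by exists 0.
have [L HL] := IH (fun i => g i.+1); exists (npair (g 0) L) => -[|i] lt.
  by rewrite /lnth /= npE.
by rewrite /lnth iterSr npE; apply: HL.
Qed.

Lemma lnth_le L i : lnth L i <= L.
Proof.
apply: leq_trans (nfst_le _) _; elim: i => //= i IH.
exact: leq_trans (nsnd_le _) IH.
Qed.

Lemma comp_lnth f g : comp f -> comp g -> comp (fun x => lnth (f x) (g x)).
Proof.
move=> hf hg; apply: comp_fst.
apply: (@comp_ext (fun x => prec (f x) (fun _ u => nsnd u) (g x))).
  by move=> x; elim: (g x) => //= k ->.
by apply: comp_prec => //; apply/comp_snd/comp_snd/comp_snd/comp_id.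
Qed.

(** Collection: the witness for each [i] below the bound is stored as entry [i] of one list code. *)
Lemma Sig_ball b P : Sig (fun y => P (nfst y) (nsnd y)) -> comp b ->
  Sig (fun x => forall i, i < b x -> P x i).
Proof.
move=> [r hr H] hb; exists (fun x z => ballb (b x) (fun i => r (npair x i) (lnth z i))).
  apply: (@dec_ballb (fun y => b (nfst y)) (fun y i => r (npair (nfst y) i) (lnth (nsnd y) i))).
    by apply: (comp_app hb); apply/comp_fst/comp_id.
  apply: (dec_app2 hr).
    by apply: comp_pair; [exact/comp_fst/comp_fst/comp_id | exact/comp_snd/comp_id].
  by apply: comp_lnth; [exact/comp_snd/comp_fst/comp_id | exact/comp_snd/comp_id].
move=> x; split=> [K|[z /ballbP K] i lt].
  (* Beyond the bound any number will do; this makes choice applicable to all [i]. *)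
  have E i : exists z, i < b x -> r (npair x i) z.
    case: (ltnP i (b x)) => [/K|_]; last by exists 0.
    by have := H (npair x i); rewrite !npE => -> [z rz]; exists z.
  have [g Hg] := choice E; have [L HL] := lnth_ex g (b x).
  by exists L; apply/ballbP => i lt; rewrite HL //; apply: Hg.
by have := H (npair x i); rewrite !npE => ->; exists (lnth z i); apply: K.
Qed.

Lemma Sig_ltn f g : comp f -> comp g -> Sig (fun x => f x < g x).
Proof. by move=> hf hg; apply/Sig_dec/dec_leq => //; exact: comp_succ. Qed.

Lemma Sig_leq f g : comp f -> comp g -> Sig (fun x => f x <= g x).
Proof. by move=> hf hg; apply/Sig_dec/dec_leq. Qed.

Definition Pi2 (P : nat -> Prop) :=
  exists2 Q, Sig (fun y => Q (nfst y) (nsnd y)) & forall x, P x <-> forall y, Q x y.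

Lemma Pi2_ext P Q : (forall x, P x <-> Q x) -> Pi2 P -> Pi2 Q.
Proof. by move=> PQ [r hr H]; exists r => // x; rewrite -PQ. Qed.

Lemma Sig_app2 P f g : Sig (fun y => P (nfst y) (nsnd y)) -> comp f -> comp g ->
  Sig (fun x => P (f x) (g x)).
Proof.
move=> hP hf hg; apply: Sig_ext (Sig_app hP (comp_pair hf hg)) => x.
by rewrite !npE.
Qed.

Lemma Pi2_Sig P : Sig P -> Pi2 P.
Proof.
move=> hP; exists (fun x _ => P x); first exact: (Sig_app hP (comp_fst comp_id)).
by move=> x; split=> // /(_ 0).
Qed.

Lemma Pi2_all P : Pi2 (fun y => P (nfst y) (nsnd y)) -> Pi2 (fun x => forall z, P x z).
Proof.
move=> [Q hQ H]; exists (fun x w => Q (npair x (nfst w)) (nsnd w)).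
  apply: (Sig_app2 hQ); last exact/comp_snd/comp_snd/comp_id.
  by apply: comp_pair; [exact/comp_fst/comp_id | exact/comp_fst/comp_snd/comp_id].
move=> x; split=> [K w|K z].
  by have := H (npair x (nfst w)); rewrite !npE => -[/(_ (K _))].
have := H (npair x z); rewrite !npE => ->.
by move=> w; have := K (npair z w); rewrite !npE.
Qed.

Lemma Pi2_and P Q : Pi2 P -> Pi2 Q -> Pi2 (fun x => P x /\ Q x).
Proof.
move=> [P' hP H] [Q' hQ K]; exists (fun x w => P' x w /\ Q' x w); first exact: Sig_and.
move=> x; rewrite H K; split=> [[? ?]//|L].
by split=> y; case: (L y).
Qed.

(** The existential quantifier of the premise becomes a universal one in front of the implication;
    what remains is the disjunction of a decidable and a Sigma^0_1 formula. *)
Lemma Pi2_imp P Q : Sig P -> Pi2 Q -> Pi2 (fun x => P x -> Q x).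
Proof.
move=> [r hr H] [Q' hQ K].
exists (fun x w => ~~ r x (nfst w) \/ Q' x (nsnd w)).
  apply: Sig_or.
    apply/Sig_dec/dec_not/(dec_app2 hr); first exact/comp_fst/comp_id.
    exact/comp_fst/comp_snd/comp_id.
  by apply: (Sig_app2 hQ); [exact/comp_fst/comp_id | exact/comp_snd/comp_snd/comp_id].
move=> x; rewrite H K; split=> [L w|L [z rz] y].
  case: (boolP (r x (nfst w))) => [rw|]; last by left.
  by right; apply: L; exists (nfst w).
by have := L (npair z y); rewrite !npE rz => -[].
Qed.

Lemma Pi2_app P f : Pi2 P -> comp f -> Pi2 (fun x => P (f x)).
Proof.
move=> [Q hQ H] hf; exists (fun x w => Q (f x) w) => [|x]; last exact: H.
apply: (Sig_app2 hQ); last exact/comp_snd/comp_id.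
by apply: (comp_app hf); apply/comp_fst/comp_id.
Qed.

Lemma Pi2_Pi02 P : Pi2 P -> Pi02 P.
Proof.
move=> [Q [r hr H] K]; exists (fun x y z => r (npair x y) z).
  apply: comp_computable; apply: (dec_app2 hr); last exact/comp_snd/comp_snd/comp_id.
  by apply: comp_pair; [exact/comp_fst/comp_id | exact/comp_fst/comp_snd/comp_id].
move=> x; rewrite K.
by split=> L y; have := L y; have := H (npair x y); rewrite !npE => ->.
Qed.

(** [evals] recurses on programs and so is not visibly Sigma^0_1. Here it is split into single rules
    on code numbers, with [K] standing for the computations already justified. [K] occurs only
    positively, and the only universal quantifier is bounded. *)
Definition stepv (K : nat -> nat -> nat -> Prop) (c x y : nat) : Prop :=
  (c = 0 /\ y = 0) \/ (c = 1 /\ y = x.+1) \/ (c = 2 /\ y = nfst x) \/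
  (c = 3 /\ y = nsnd x) \/
  (exists d, exists u, exists v, c = 4 * d + 4 /\ K (nfst d) x u /\
     K (nsnd d) x v /\ y = npair u v) \/
  (exists d, exists u, c = 4 * d + 5 /\ K (nsnd d) x u /\ K (nfst d) u y) \/
  (exists d, c = 4 * d + 6 /\ nsnd x = 0 /\ K (nfst d) (nfst x) y) \/
  (exists d, exists k, exists u, c = 4 * d + 6 /\ nsnd x = k.+1 /\
     K c (npair (nfst x) k) u /\ K (nsnd d) (npair (nfst x) (npair k u)) y) \/
  (exists d, c = 4 * d + 7 /\ K d (npair x y) 0 /\
     forall m, m < y -> exists u, K d (npair x m) u.+1).

Lemma stepv_mono (K K' : nat -> nat -> nat -> Prop) c x y :
  (forall c x y, K c x y -> K' c x y) -> stepv K c x y -> stepv K' c x y.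
Proof.
move=> KK; rewrite /stepv; case=> [?|]; first by left.
case=> [?|]; first by right; left.
case=> [?|]; first by do 2 right; left.
case=> [?|]; first by do 3 right; left.
case=> [[d [u [v [? [/KK ? [/KK ? ?]]]]]]|]; first by do 4 right; left; exists d, u, v.
case=> [[d [u [? [/KK ? /KK ?]]]]|]; first by do 5 right; left; exists d, u.
case=> [[d [? [? /KK ?]]]|]; first by do 6 right; left; exists d.
case=> [[d [k [u [? [? [/KK ? /KK ?]]]]]]|]; first by do 7 right; left; exists d, k, u.
move=> [d [? [/KK ? H]]]; do 8 right; exists d; split=> //; split=> //.
by move=> m /H[u /KK]; exists u.
Qed.

Lemma stepv_sound c x y : stepv phi_eval c x y -> phi_eval c x y.
Proof.
case=> [[-> ->]|]; first by exists CZero.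
case=> [[-> ->]|]; first by exists CSucc.
case=> [[-> ->]|]; first by exists CFst.
case=> [[-> ->]|]; first by exists CSnd.
case=> [[d [u [v [-> [[c1 e1 h1] [[c2 e2 h2] ->]]]]]]|].
  by exists (CPair c1 c2); [rewrite /= e1 e2 npairK | exists u, v].
case=> [[d [u [-> [[c1 e1 h1] [c2 e2 h2]]]]]|].
  by exists (CComp c2 c1); [rewrite /= e1 e2 npairK | exists u].
case=> [[d [-> [x0 [c1 e1 h1]]]]|].
  have [c2 e2] := encode_code_surj (nsnd d).
  exists (CRec c1 c2); first by rewrite /= e1 e2 npairK.
  by rewrite -(npairK x) x0; apply/evals_CRec0.
case=> [[d [k [u [-> [xk [h1 [c2 e2 h2]]]]]]]|].
  have [c1 e1] := encode_code_surj (nfst d).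
  have e : 4 * d + 6 = encode_code (CRec c1 c2) by rewrite /= e1 e2 npairK.
  rewrite e; apply/phi_evalE; rewrite -(npairK x) xk; apply/evals_CRecS.
  by exists u => //; apply/phi_evalE; rewrite -e.
move=> [d [-> [[c1 e1 h1] H]]]; exists (CMin c1); first by rewrite /= e1.
split=> // m /H[u]; rewrite -e1 => /phi_evalE hu; by exists u.
Qed.

(* A finite set of computations that is closed under the evaluation rules;
   every item is justified by items further down the list. *)
Fixpoint valid (s : seq (nat * (nat * nat))) : Prop :=
  if s is t :: s' then
    stepv (fun c x y => (c, (x, y)) \in s') t.1 t.2.1 t.2.2 /\ valid s'
  else True.

Lemma valid_cat s t : valid s -> valid t -> valid (s ++ t).
Proof.
elim: s => //= a s IH [h1 h2] ht; split; last exact: IH.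
by apply: stepv_mono h1 => c x y; rewrite mem_cat => ->.
Qed.

Definition derivable c x y := exists2 s, valid s & (c, (x, y)) \in s.

(** For minimisation, whose rule rests on one subcomputation for each smaller argument. *)
Lemma derivable_join (I : eqType) (r : seq I) (c x y : I -> nat) :
  (forall i, i \in r -> derivable (c i) (x i) (y i)) ->
  exists2 s, valid s & forall i, i \in r -> (c i, (x i, y i)) \in s.
Proof.
elim: r => [|a r IH] H; first by exists [::].
have [s vs hs] := IH (fun i ir => H i (mem_behead (s := a :: r) ir)).
have [t vt ht] := H a (mem_head _ _).
exists (t ++ s); first exact: valid_cat.
move=> i; rewrite inE mem_cat => /orP[/eqP ->|/hs ->]; last by rewrite orbT.
by rewrite ht.
Qed.

Lemma stepv_derivable s c x y : valid s ->
  stepv (fun c x y => (c, (x, y)) \in s) c x y -> derivable c x y.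
Proof. by move=> vs h; exists ((c, (x, y)) :: s) => //; rewrite mem_head. Qed.

Lemma derivable2 c x y c' x' y' : derivable c x y -> derivable c' x' y' ->
  exists2 s, valid s & ((c, (x, y)) \in s) && ((c', (x', y')) \in s).
Proof.
move=> [s vs hs] [t vt ht]; exists (s ++ t); first exact: valid_cat.
by rewrite !mem_cat hs ht orbT.
Qed.

Lemma evals_derivable c x y : evals c x y -> derivable (encode_code c) x y.
Proof.
elim: c x y => [||||c IHc d IHd|c IHc d IHd|c IHc d IHd|c IHc] x y.
- by move=> /= ->; apply: (@stepv_derivable [::]) => //; left.
- by move=> /= ->; apply: (@stepv_derivable [::]) => //; right; left.
- by move=> /= ->; apply: (@stepv_derivable [::]) => //; do 2 right; left.
- by move=> /= ->; apply: (@stepv_derivable [::]) => //; do 3 right; left.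
- move=> /= [u [v [/IHc h1 /IHd h2 ->]]]; have [s vs /andP[h h']] := derivable2 h1 h2.
  apply: (stepv_derivable vs); do 4 right; left.
  by exists (npair (encode_code c) (encode_code d)), u, v; rewrite !npE.
- move=> /= [u /IHd h1 /IHc h2]; have [s vs /andP[h h']] := derivable2 h1 h2.
  apply: (stepv_derivable vs); do 5 right; left.
  by exists (npair (encode_code c) (encode_code d)), u; rewrite !npE.
- rewrite -(npairK x); move: (nfst x) (nsnd x) => a k; elim: k y => [|k IHk] y.
    move=> /evals_CRec0/IHc[s vs hs]; apply: (stepv_derivable vs); do 6 right; left.
    by exists (npair (encode_code c) (encode_code d)); rewrite !npE.
  move=> /evals_CRecS[u /IHk h1 /IHd h2]; have [s vs /andP[h h']] := derivable2 h1 h2.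
  apply: (stepv_derivable vs); do 7 right; left.
  by exists (npair (encode_code c) (encode_code d)), k, u; rewrite !npE.
- move=> /= [/IHc h0 H].
  have E m : exists u, m < y -> derivable (encode_code c) (npair x m) u.+1.
    by case: (ltnP m y) => [/H[u /IHc]|_]; [exists u | exists 0].
  have [g Hg] := choice E.
  have [s vs hs] := @derivable_join _ (iota 0 y) (fun=> encode_code c) (npair x)
    (fun m => (g m).+1) (fun m hm => Hg m (ltac:(by rewrite mem_iota in hm))).
  case: h0 => t vt ht.
  apply: (stepv_derivable (valid_cat vt vs)); do 8 right.
  exists (encode_code c); split=> //; split; first by rewrite mem_cat ht.
  by move=> m lt; exists (g m); rewrite mem_cat hs ?orbT // mem_iota.
Qed.

(** The form of [valid] for a list of [b] entries coded by the number [L]. Requiring [i < j] rules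
    out circular justifications. *)
Definition certK (b L i : nat) (c x y : nat) : Prop :=
  exists j, i < j /\ j < b /\ lnth L j = npair c (npair x y).

Definition cert_ok (b L : nat) : Prop := forall i, i < b ->
  stepv (certK b L i) (nfst (lnth L i)) (nfst (nsnd (lnth L i)))
    (nsnd (nsnd (lnth L i))).

(** Kleene's normal form: a halting computation is witnessed by a numerical certificate whose
    correctness is Sigma^0_1. *)
Lemma phi_eval_cert e x y : phi_eval e x y <->
  exists b, exists L, cert_ok b L /\ exists i, i < b /\ lnth L i = npair e (npair x y).
Proof.
split.
  move=> [c <- /evals_derivable[s vs hs]].
  pose t0 := (0, (0, 0)); pose cd (t : nat * (nat * nat)) := npair t.1 (npair t.2.1 t.2.2).
  have [L HL] := lnth_ex (fun i => cd (nth t0 s i)) (size s).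
  exists (size s), L; split; last first.
    exists (index (encode_code c, (x, y)) s); rewrite index_mem; split=> //.
    by rewrite HL ?index_mem // nth_index.
  move=> i lt; rewrite HL // /cd !npE.
  have : stepv (fun c x y => (c, (x, y)) \in drop i.+1 s) (nth t0 s i).1
      (nth t0 s i).2.1 (nth t0 s i).2.2.
    elim: s vs {hs HL} i lt => //= a s IH [h vs] [|i] lt; first by rewrite drop0.
    exact: IH.
  apply: stepv_mono => c' x' y' /(nthP t0)[k]; rewrite size_drop nth_drop => ltk ek.
  exists (i.+1 + k); split; first by lia.
  have lt' : i.+1 + k < size s by rewrite -ltn_subRL.
  by split=> //; rewrite HL // /cd ek.
move=> [b [L [ok [i [lt e1]]]]].
(* Induction on the distance from the end of the list, since entries are justified by later ones. *)
have key n : forall j, b - j <= n -> j < b -> phi_eval (nfst (lnth L j))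
    (nfst (nsnd (lnth L j))) (nsnd (nsnd (lnth L j))).
  elim: n => [|n IH] j le ltj; first by lia.
  apply: stepv_sound; apply: stepv_mono (ok j ltj) => c' x' y' [k [jk [kb ek]]].
  have hk : b - k <= n by clear - le jk kb; lia.
  by have := IH k hk kb; rewrite ek !npE.
by have := key b i (leq_subr _ _) lt; rewrite e1 !npE.
Qed.

Ltac comp_tac := repeat first
  [ exact: comp_id | exact: comp_nfst | exact: comp_nsnd | exact: comp_const | apply: comp_lnth | apply: comp_fst | apply: comp_snd
  | apply: comp_pair | apply: comp_succ | apply: comp_add | apply: comp_mul
  | apply: comp_exp | apply: comp_sub | apply: comp_pred ].

Ltac sig_tac := cbv beta; repeat first
  [ apply: Sig_and | apply: Sig_or | apply: Sig_ex; cbv beta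
  | apply: Sig_ball; cbv beta
  | apply: Sig_eq | apply: Sig_ltn | apply: Sig_leq ].

Lemma Sig_stepv (K : nat -> nat -> nat -> nat -> Prop) f g h :
  Sig (fun w => K (nfst w) (nfst (nsnd w)) (nfst (nsnd (nsnd w))) (nsnd (nsnd (nsnd w)))) ->
  comp f -> comp g -> comp h -> Sig (fun w => stepv (K w) (f w) (g w) (h w)).
Proof.
move=> hK hf hg hh.
have K4 p q r t : comp p -> comp q -> comp r -> comp t ->
    Sig (fun w => K (p w) (q w) (r w) (t w)).
  move=> hp hq hr ht.
  apply: Sig_ext (Sig_app hK (comp_pair hp (comp_pair hq (comp_pair hr ht)))) => x.
  by rewrite !npE.
rewrite /stepv; sig_tac; try (apply: K4);
  repeat first [progress comp_tac | apply: (comp_app hf) | apply: (comp_app hg) | apply: (comp_app hh)].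
Qed.

Lemma Sig_phi_eval f g h : comp f -> comp g -> comp h ->
  Sig (fun x => phi_eval (f x) (g x) (h x)).
Proof.
move=> hf hg hh.
have H : Sig (fun w => phi_eval (nfst w) (nfst (nsnd w)) (nsnd (nsnd w))).
  apply: (Sig_ext (fun w => iff_sym (phi_eval_cert _ _ _))).
  rewrite /cert_ok; apply: Sig_ex; cbv beta; apply: Sig_ex; cbv beta; apply: Sig_and.
    apply: Sig_ball; cbv beta; last by comp_tac.
    apply: (@Sig_stepv (fun w => certK (nsnd (nfst (nfst w))) (nsnd (nfst w)) (nsnd w)));
      try by comp_tac.
    by rewrite /certK; sig_tac; comp_tac.
  by sig_tac; comp_tac.
apply: Sig_ext (Sig_app H (comp_pair hf (comp_pair hg hh))) => x.
by rewrite !npE.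
Qed.

(** * Arithmetical form of the isomorphism problem *)

(** Arithmetic on the triples of [rat_of_code], where (u, v, d) stands for (u - v) / (d + 1); the
    shift of the denominator explains [.-1]. *)
Definition radd a b := npair
  (npair (nfst (nfst a) * (nsnd b).+1 + nfst (nfst b) * (nsnd a).+1)
         (nsnd (nfst a) * (nsnd b).+1 + nsnd (nfst b) * (nsnd a).+1))
  ((nsnd a).+1 * (nsnd b).+1).-1.
Definition rmul a b := npair
  (npair (nfst (nfst a) * nfst (nfst b) + nsnd (nfst a) * nsnd (nfst b))
         (nfst (nfst a) * nsnd (nfst b) + nsnd (nfst a) * nfst (nfst b)))
  ((nsnd a).+1 * (nsnd b).+1).-1.
Definition rneg a := npair (npair (nsnd (nfst a)) (nfst (nfst a))) (nsnd a).
Definition rlt a b :=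
  nfst (nfst a) * (nsnd b).+1 + nsnd (nfst b) * (nsnd a).+1 <
  nfst (nfst b) * (nsnd a).+1 + nsnd (nfst a) * (nsnd b).+1.
Definition r0 := npair (npair 0 0) 0.
Definition r1 := npair (npair 1 0) 0.
Definition rm1 := npair (npair 0 1) 0.
(** The rational 1 / (K + 1), positive for every [K], so that precisions need no side condition;
    [r2 k] is 2^-k. *)
Definition rinv K := npair (npair 1 0) K.
Definition r2 k := npair (npair 1 0) (2 ^ k).-1.

(** The constructors of [starpoly] on codes, written as in [encode_poly] so that both agree by
    conversion. *)
Definition pconst m n := 5 * npair m n.
Definition pstar p := 5 * p + 2.
Definition padd p q := 5 * npair p q + 3.
Definition pmul p q := 5 * npair p q + 4.
Definition p0 := pconst r0 r0.
Definition pone := pconst r1 r0.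
Definition psub p q := padd p (pmul (pconst rm1 r0) q).
Definition psum n (F : nat -> nat) := prec p0 (fun k u => padd u (F k)) n.

Lemma comp_radd f g : comp f -> comp g -> comp (fun x => radd (f x) (g x)).
Proof. by move=> hf hg; rewrite /radd; comp_tac. Qed.

Lemma comp_rmul f g : comp f -> comp g -> comp (fun x => rmul (f x) (g x)).
Proof. by move=> hf hg; rewrite /rmul; comp_tac. Qed.

Lemma comp_rneg f : comp f -> comp (fun x => rneg (f x)).
Proof. by move=> hf; rewrite /rneg; comp_tac. Qed.

Lemma dec_rlt f g : comp f -> comp g -> dec (fun x => rlt (f x) (g x)).
Proof. by move=> hf hg; apply: dec_leq; comp_tac. Qed.

Lemma comp_rinv f : comp f -> comp (fun x => rinv (f x)).
Proof. by move=> hf; rewrite /rinv; comp_tac. Qed.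

Lemma comp_r2 f : comp f -> comp (fun x => r2 (f x)).
Proof. by move=> hf; rewrite /r2; comp_tac. Qed.

Lemma comp_pconst f g : comp f -> comp g -> comp (fun x => pconst (f x) (g x)).
Proof. by move=> hf hg; rewrite /pconst; comp_tac. Qed.

Lemma comp_pstar f : comp f -> comp (fun x => pstar (f x)).
Proof. by move=> hf; rewrite /pstar; comp_tac. Qed.

Lemma comp_padd f g : comp f -> comp g -> comp (fun x => padd (f x) (g x)).
Proof. by move=> hf hg; rewrite /padd; comp_tac. Qed.

Lemma comp_pmul f g : comp f -> comp g -> comp (fun x => pmul (f x) (g x)).
Proof. by move=> hf hg; rewrite /pmul; comp_tac. Qed.

Lemma comp_psub f g : comp f -> comp g -> comp (fun x => psub (f x) (g x)).
Proof.
move=> hf hg; apply: comp_padd => //; apply: comp_pmul => //.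
exact: comp_const.
Qed.

Lemma comp_psum b F : comp b -> comp (fun y => F (nfst y) (nsnd y)) ->
  comp (fun x => psum (b x) (F x)).
Proof.
move=> hb hF; apply: comp_prec => //; first exact: comp_const.
apply: comp_padd; first by comp_tac.
by apply: (comp_app2 hF); comp_tac.
Qed.

Lemma Sig_rlt f g : comp f -> comp g -> Sig (fun x => rlt (f x) (g x)).
Proof. by move=> hf hg; apply/Sig_dec/dec_rlt. Qed.

Lemma Sig_nrlt f g : comp f -> comp g -> Sig (fun x => ~~ rlt (f x) (g x)).
Proof. by move=> hf hg; apply/Sig_dec/dec_not/dec_rlt. Qed.

Definition ment (L i j : nat) := lnth L (npair i j).

Lemma comp_ment f g h : comp f -> comp g -> comp h ->
  comp (fun x => ment (f x) (g x) (h x)).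
Proof. by move=> hf hg hh; apply: comp_lnth => //; apply: comp_pair. Qed.

(* [tol] is the tolerance allowed when passing to finer matrix units: the n^3 absorbs the sum of up
   to n matrix entries and leaves 1/n^2, which with (T+1)^2 absorbs n^2 coefficients of size at most
   2T. The constant in [kap] is what the perturbation of approximate into exact matrix units costs. *)
Definition tol (n T : nat) := n ^ 3 * T.+1 ^ 2.
Definition kap (n T : nat) := 10 ^ 5 * (n ^ 6 * T.+1 ^ 2).

Lemma comp_tol f g : comp f -> comp g -> comp (fun x => tol (f x) (g x)).
Proof.
move=> hf hg; apply: comp_mul; first exact: (comp_exp hf (comp_const 3)).
exact: (comp_exp (comp_succ hg) (comp_const 2)).
Qed.

Lemma comp_kap f g : comp f -> comp g -> comp (fun x => kap (f x) (g x)).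
Proof.
move=> hf hg; apply: comp_mul; first exact: comp_const.
apply: comp_mul; first exact: (comp_exp hf (comp_const 6)).
exact: (comp_exp (comp_succ hg) (comp_const 2)).
Qed.

Opaque npair nfst nsnd pconst pstar padd pmul psub psum radd rmul rneg rinv r2 rlt r0 r1 rm1 p0 pone.

Ltac comp_step := cbv beta; lazymatch goal with
  | |- comp (fun _ => ?c) => exact (comp_const c)
  | |- comp (fun x => x) => exact comp_id
  | |- comp nfst => exact comp_nfst
  | |- comp nsnd => exact comp_nsnd
  | |- comp (fun x => nfst _) => apply comp_fst
  | |- comp (fun x => nsnd _) => apply comp_snd
  | |- comp (fun x => npair _ _) => apply comp_pair
  | |- comp (fun x => psum _ _) => apply comp_psum
  | |- comp (fun x => psub _ _) => apply comp_psub
  | |- comp (fun x => padd _ _) => apply comp_padd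
  | |- comp (fun x => pmul _ _) => apply comp_pmul
  | |- comp (fun x => pconst _ _) => apply comp_pconst
  | |- comp (fun x => pstar _) => apply comp_pstar
  | |- comp (fun x => radd _ _) => apply comp_radd
  | |- comp (fun x => rmul _ _) => apply comp_rmul
  | |- comp (fun x => rneg _) => apply comp_rneg
  | |- comp (fun x => rinv _) => apply comp_rinv
  | |- comp (fun x => r2 _) => apply comp_r2
  | |- comp (fun x => ment _ _ _) => apply comp_ment
  | |- comp (fun x => lnth _ _) => apply comp_lnth
  | |- comp (fun x => kap _ _) => apply comp_kap
  | |- comp (fun x => tol _ _) => apply comp_tol
  | |- comp (fun x => if _ then _ else _) => apply comp_if
  | |- dec (fun x => _ == _) => apply dec_eq
  | |- comp (fun x => S _) => apply comp_succ
  | |- comp (fun x => addn _ _) => apply comp_add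
  | |- comp (fun x => muln _ _) => apply comp_mul
  | |- comp (fun x => expn _ _) => apply comp_exp
  | |- comp _ => assumption
  | |- comp (fun x => ?e _) => match goal with h : comp e |- _ => apply (comp_app h) end
  end.

Ltac comp_tac2 := repeat comp_step.

(** * Seminorm and matrix unit conditions in terms of upper cuts *)

Section Formulas.
Variable U : nat -> nat -> nat -> Prop.
Hypothesis U_Sig : forall f g h, comp f -> comp g -> comp h ->
  Sig (fun x => U (f x) (g x) (h x)).

(** Relations between seminorms, with [U e p r] read as s(p) < r. Comparing squares keeps everything
    rational; [rlt r0 r] excludes negative [r], whose squares would give false bounds. *)
Definition zero_form (A : nat -> nat) e := forall x K, U e (A x) (rinv K).
Definition le_form (A B : nat -> nat) e := forall x r, U e (B x) r -> U e (A x) r.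
Definition add_form (A B C : nat -> nat) e := forall x r t,
  U e (B x) r -> U e (C x) t -> U e (A x) (radd r t).
Definition mul_form (A B C : nat -> nat) e := forall x r t,
  U e (B x) r -> U e (C x) t -> U e (A x) (rmul r t).
Definition sqr_form (A B : nat -> nat) e := forall x r, rlt r0 r ->
  U e (B x) (rmul r r) -> U e (A x) r.
Definition const_form (A a b : nat -> nat) e := forall x r, rlt r0 r ->
  rlt (radd (rmul (a x) (a x)) (rmul (b x) (b x))) (rmul r r) -> U e (A x) r.

Lemma Pi2_zero_form A e : comp A -> comp e -> Pi2 (fun y => zero_form A (e y)).
Proof.
move=> hA he; apply: Pi2_all; apply: Pi2_all; apply/Pi2_Sig/U_Sig; cbv beta.
- by apply: (comp_app he); comp_tac2.
- by apply: (comp_app hA); comp_tac2.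
- by comp_tac2.
Qed.

Lemma Pi2_le_form A B e : comp A -> comp B -> comp e -> Pi2 (fun y => le_form A B (e y)).
Proof.
move=> hA hB he; apply: Pi2_all; apply: Pi2_all; apply: Pi2_imp; last apply: Pi2_Sig;
apply: U_Sig; cbv beta;
  do [by apply: (comp_app he); comp_tac2 | by apply: (comp_app hA); comp_tac2
   | by apply: (comp_app hB); comp_tac2 | by comp_tac2].
Qed.

Lemma Pi2_add_form A B C e : comp A -> comp B -> comp C -> comp e ->
  Pi2 (fun y => add_form A B C (e y)).
Proof.
move=> hA hB hC he; apply: Pi2_all; apply: Pi2_all; apply: Pi2_all; apply: Pi2_imp; last first.
  apply: Pi2_imp; last apply: Pi2_Sig; apply: U_Sig; cbv beta;
  do [by apply: (comp_app he); comp_tac2 | by apply: (comp_app hA); comp_tac2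
   | by apply: (comp_app hC); comp_tac2 | by comp_tac2].
apply: U_Sig; cbv beta; do [by apply: (comp_app he); comp_tac2
   | by apply: (comp_app hB); comp_tac2 | by comp_tac2].
Qed.

Lemma Pi2_mul_form A B C e : comp A -> comp B -> comp C -> comp e ->
  Pi2 (fun y => mul_form A B C (e y)).
Proof.
move=> hA hB hC he; apply: Pi2_all; apply: Pi2_all; apply: Pi2_all; apply: Pi2_imp; last first.
  apply: Pi2_imp; last apply: Pi2_Sig; apply: U_Sig; cbv beta;
  do [by apply: (comp_app he); comp_tac2 | by apply: (comp_app hA); comp_tac2
   | by apply: (comp_app hC); comp_tac2 | by comp_tac2].
apply: U_Sig; cbv beta; do [by apply: (comp_app he); comp_tac2
   | by apply: (comp_app hB); comp_tac2 | by comp_tac2].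
Qed.

Lemma Pi2_sqr_form A B e : comp A -> comp B -> comp e -> Pi2 (fun y => sqr_form A B (e y)).
Proof.
move=> hA hB he; apply: Pi2_all; apply: Pi2_all; apply: Pi2_imp.
  by apply: Sig_rlt; comp_tac2.
apply: Pi2_imp; last apply: Pi2_Sig; apply: U_Sig; cbv beta;
  do [by apply: (comp_app he); comp_tac2 | by apply: (comp_app hA); comp_tac2
   | by apply: (comp_app hB); comp_tac2 | by comp_tac2].
Qed.

Lemma Pi2_const_form A a b e : comp A -> comp a -> comp b -> comp e ->
  Pi2 (fun y => const_form A a b (e y)).
Proof.
move=> hA ha hb he; apply: Pi2_all; apply: Pi2_all; apply: Pi2_imp.
  by apply: Sig_rlt; comp_tac2.
have ha' : comp (fun y => a (nsnd (nfst y))) by apply: (comp_app ha); comp_tac2.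
have hb' : comp (fun y => b (nsnd (nfst y))) by apply: (comp_app hb); comp_tac2.
apply: Pi2_imp; first by apply: Sig_rlt; comp_tac2.
by apply: Pi2_Sig; apply: U_Sig; cbv beta;
  do [by apply: (comp_app he); comp_tac2 | by apply: (comp_app hA); comp_tac2 | by comp_tac2].
Qed.

Local Notation X1 x := (nfst x).
Local Notation X2 x := (nfst (nsnd x)).
Local Notation X3 x := (nfst (nsnd (nsnd x))).
Local Notation X4 x := (nsnd (nsnd (nsnd x))).

(* The Horn clauses in [U] saying that the numbers whose upper cuts are given
   by [U] form a C*-seminorm on *-polynomials. *)
Definition norm_cond (e : nat) : Prop :=
  (forall p, U e p r0 -> 0 = 1) /\
  (U e pone r1 -> 0 = 1) /\
  add_form (fun x => padd (X1 x) (X2 x)) (fun x => X1 x) (fun x => X2 x) e /\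
  mul_form (fun x => pmul (X1 x) (X2 x)) (fun x => X1 x) (fun x => X2 x) e /\
  le_form (fun x => pstar (X1 x)) (fun x => X1 x) e /\
  sqr_form (fun x => X1 x) (fun x => pmul (pstar (X1 x)) (X1 x)) e /\
  const_form (fun x => pconst (X1 x) (X2 x)) (fun x => X1 x) (fun x => X2 x) e /\
  zero_form (fun x => psub (X1 x) (X1 x)) e /\
  le_form (fun x => psub (X1 x) (X2 x)) (fun x => psub (X2 x) (X1 x)) e /\
  add_form (fun x => psub (X1 x) (X3 x)) (fun x => psub (X1 x) (X2 x))
    (fun x => psub (X2 x) (X3 x)) e /\
  add_form (fun x => X1 x) (fun x => X2 x) (fun x => psub (X1 x) (X2 x)) e /\
  le_form (fun x => psub (X1 x) p0) (fun x => X1 x) e /\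
  add_form (fun x => psub (padd (X1 x) (X2 x)) (padd (X3 x) (X4 x)))
    (fun x => psub (X1 x) (X3 x)) (fun x => psub (X2 x) (X4 x)) e /\
  mul_form (fun x => psub (pmul (X1 x) (X2 x)) (pmul (X1 x) (X3 x)))
    (fun x => X1 x) (fun x => psub (X2 x) (X3 x)) e /\
  mul_form (fun x => psub (pmul (X1 x) (X3 x)) (pmul (X2 x) (X3 x)))
    (fun x => psub (X1 x) (X2 x)) (fun x => X3 x) e /\
  le_form (fun x => psub (pstar (X1 x)) (pstar (X2 x))) (fun x => psub (X1 x) (X2 x)) e /\
  const_form (fun x => psub (pconst (X1 x) (X2 x)) (pconst (X3 x) (X4 x)))
    (fun x => radd (X1 x) (rneg (X3 x))) (fun x => radd (X2 x) (rneg (X4 x))) e /\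
  zero_form (fun x => psub (padd (X1 x) (padd (X2 x) (X3 x)))
    (padd (padd (X1 x) (X2 x)) (X3 x))) e /\
  zero_form (fun x => psub (padd (X1 x) (X2 x)) (padd (X2 x) (X1 x))) e /\
  zero_form (fun x => psub (padd p0 (X1 x)) (X1 x)) e /\
  zero_form (fun x => psub (padd (pmul (pconst rm1 r0) (X1 x)) (X1 x)) p0) e /\
  zero_form (fun x => psub (pmul (X1 x) (pmul (X2 x) (X3 x)))
    (pmul (pmul (X1 x) (X2 x)) (X3 x))) e /\
  zero_form (fun x => psub (pmul pone (X1 x)) (X1 x)) e /\
  zero_form (fun x => psub (pmul (X1 x) pone) (X1 x)) e /\
  zero_form (fun x => psub (pmul (padd (X1 x) (X2 x)) (X3 x))
    (padd (pmul (X1 x) (X3 x)) (pmul (X2 x) (X3 x)))) e /\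
  zero_form (fun x => psub (pmul (X1 x) (padd (X2 x) (X3 x)))
    (padd (pmul (X1 x) (X2 x)) (pmul (X1 x) (X3 x)))) e /\
  zero_form (fun x => psub (padd (pconst (X1 x) (X2 x)) (pconst (X3 x) (X4 x)))
    (pconst (radd (X1 x) (X3 x)) (radd (X2 x) (X4 x)))) e /\
  zero_form (fun x => psub (pmul (pconst (X1 x) (X2 x)) (pconst (X3 x) (X4 x)))
    (pconst (radd (rmul (X1 x) (X3 x)) (rneg (rmul (X2 x) (X4 x))))
            (radd (rmul (X1 x) (X4 x)) (rmul (X2 x) (X3 x))))) e /\
  zero_form (fun x => psub (pmul (pconst (X1 x) (X2 x)) (X3 x))
    (pmul (X3 x) (pconst (X1 x) (X2 x)))) e /\
  zero_form (fun x => psub (pstar (pconst (X1 x) (X2 x))) (pconst (X1 x) (rneg (X2 x)))) e /\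
  zero_form (fun x => psub (pstar (pstar (X1 x))) (X1 x)) e /\
  zero_form (fun x => psub (pstar (padd (X1 x) (X2 x))) (padd (pstar (X1 x)) (pstar (X2 x)))) e /\
  zero_form (fun x => psub (pstar (pmul (X1 x) (X2 x))) (pmul (pstar (X2 x)) (pstar (X1 x)))) e.

Lemma Pi2_norm_cond e : comp e -> Pi2 (fun y => norm_cond (e y)).
Proof.
move=> he.
apply: Pi2_and.
  (* [0 = 1] stands for falsity, in the shape of a decidable formula. *)
  apply: Pi2_all; apply: Pi2_imp; last by apply/Pi2_Sig/Sig_eq; comp_tac2.
  by apply: U_Sig; first (by apply: (comp_app he); comp_tac2); comp_tac2.
apply: Pi2_and.
  apply: Pi2_imp; last by apply/Pi2_Sig/Sig_eq; comp_tac2.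
  by apply: U_Sig; comp_tac2.
repeat apply: Pi2_and;
lazymatch goal with
| |- Pi2 (fun y => zero_form _ _) => apply: Pi2_zero_form
| |- Pi2 (fun y => le_form _ _ _) => apply: Pi2_le_form
| |- Pi2 (fun y => add_form _ _ _ _) => apply: Pi2_add_form
| |- Pi2 (fun y => mul_form _ _ _ _) => apply: Pi2_mul_form
| |- Pi2 (fun y => sqr_form _ _ _) => apply: Pi2_sqr_form
| |- Pi2 (fun y => const_form _ _ _ _) => apply: Pi2_const_form
end; by comp_tac2.
Qed.

Definition good (e L n K : nat) : Prop :=
  (forall i, i < n -> forall j, j < n ->
     U e (psub (pstar (ment L i j)) (ment L j i)) (rinv K)) /\
  (forall i, i < n -> forall j, j < n -> forall k, k < n -> forall l, l < n ->
     U e (psub (pmul (ment L i j) (ment L k l)) (if j == k then ment L i l else p0))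
       (rinv K)) /\
  U e (psub (psum n (fun i => ment L i i)) pone) (rinv K).

(** Index [i * m + l] is the l-th place in the i-th block of size [m], so that the third condition
    compares the old units with block sums of the new ones, as in the embedding x |-> x tensor 1_m.
    Bounding the code [c] by [T'] bounds all coefficients at once, since the entries of a list never
    exceed its code. *)
Definition extn (e n T L T0 j m T' L' c : nat) : Prop :=
  c <= T' /\
  good e L' (n * m) (kap (n * m) T') /\
  (forall i, i < n -> forall i', i' < n ->
     U e (psub (ment L i i') (psum m (fun l => ment L' (i * m + l) (i' * m + l))))
       (rinv (tol n T))) /\
  U e (psub j (psum (n * m) (fun a => psum (n * m) (fun b =>
         pmul (pconst (nfst (ment c a b)) (nsnd (ment c a b))) (ment L' a b)))))
    (rinv T0).

(* Approximate matrix units in both algebras can be refined by the same factor [m], in such a way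
   that the [j]-th *-polynomial is approximated by their span; the coefficients, coded by [c], are
   bounded by [T'], to which the precision of the new matrix units is adapted. *)
Definition ext_cond (e e' : nat) : Prop :=
  forall n T L1 L2 T0 j, 0 < n ->
    good e L1 n (kap n T) -> good e' L2 n (kap n T) ->
    exists m, exists T', 0 < m /\ T0 <= T' /\
      (exists L', exists c, extn e n T L1 T0 j m T' L' c) /\
      (exists L', exists c, extn e' n T L2 T0 j m T' L' c).

Ltac sig_tac2 := cbv beta; repeat first
  [ apply: Sig_and | apply: Sig_ex; cbv beta | apply: Sig_ball; cbv beta
  | apply: Sig_ltn | apply: Sig_leq | apply: U_Sig ].

Lemma Sig_good e L n K : comp e -> comp L -> comp n -> comp K ->
  Sig (fun x => good (e x) (L x) (n x) (K x)).
Proof.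
move=> he hL hn hK.
have H : Sig (fun w => good (nfst w) (nfst (nsnd w)) (nfst (nsnd (nsnd w)))
    (nsnd (nsnd (nsnd w)))).
  by rewrite /good; sig_tac2; comp_tac2.
apply: Sig_ext (Sig_app H (comp_pair he (comp_pair hL (comp_pair hn hK)))) => x.
by rewrite !npE.
Qed.

Lemma Pi2_ext_cond : Pi2 (fun x => ext_cond (nfst x) (nsnd x)).
Proof.
rewrite /ext_cond; do 6 (apply: Pi2_all; cbv beta).
apply: Pi2_imp; first by apply: Sig_ltn; comp_tac2.
apply: Pi2_imp; first by apply: Sig_good; comp_tac2.
apply: Pi2_imp; first by apply: Sig_good; comp_tac2.
apply: Pi2_Sig; rewrite /extn.
repeat first [apply: Sig_good | progress sig_tac2]; by comp_tac2.
Qed.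

Definition pair_cond (I : nat -> Prop) (x : nat) : Prop :=
  (I (nfst x) /\ I (nsnd x)) /\ (norm_cond (nfst x) /\ norm_cond (nsnd x)) /\
  ext_cond (nfst x) (nsnd x).

Lemma Pi2_pair_cond I : Pi2 I -> Pi2 (pair_cond I).
Proof.
move=> hI; apply: Pi2_and; first by apply: Pi2_and; apply: (Pi2_app hI); comp_tac2.
apply: Pi2_and; last exact: Pi2_ext_cond.
by apply: Pi2_and; apply: Pi2_norm_cond; comp_tac2.
Qed.

End Formulas.

(* [U_comp e p r] (resp. [U_ce e p r]) says that the norm of the *-polynomial p, as given by the
   index e, is smaller than the rational r, [L_comp] that it is larger; [I_comp] and [I_ce] say that
   these cuts are those of real numbers approximated as required of an index. *)
Definition U_comp (e p r : nat) : Prop := exists k, exists n,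
  phi_eval e (npair p k) n /\ rlt (radd n (r2 k)) r.
Definition L_comp (e p r : nat) : Prop := exists k, exists n,
  phi_eval e (npair p k) n /\ rlt r (radd n (rneg (r2 k))).
Definition I_comp (e : nat) : Prop :=
  (forall x, exists n, phi_eval e x n) /\
  (forall p k n, phi_eval e (npair p k) n -> U_comp e p (radd n (r2 k))) /\
  (forall p k n, phi_eval e (npair p k) n -> L_comp e p (radd n (rneg (r2 k)))) /\
  (forall p k n k' n', phi_eval e (npair p k) n -> phi_eval e (npair p k') n' ->
     ~~ rlt (radd n (r2 k)) (radd n' (rneg (r2 k')))).

Definition U_ce (e p r : nat) : Prop := exists k, exists n,
  phi_eval e (npair p k) n /\ rlt n r.
Definition I_ce (e : nat) : Prop :=
  (forall x, exists n, phi_eval e x n) /\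
  (forall p k n n', phi_eval e (npair p k) n -> phi_eval e (npair p k.+1) n' ->
     ~~ rlt n n') /\
  (forall p k n, phi_eval e (npair p k) n -> ~~ rlt n r0).

Lemma Sig_U_comp f g h : comp f -> comp g -> comp h ->
  Sig (fun x => U_comp (f x) (g x) (h x)).
Proof.
move=> hf hg hh.
have H : Sig (fun w => U_comp (nfst w) (nfst (nsnd w)) (nsnd (nsnd w))).
  do 2 (apply: Sig_ex; cbv beta); apply: Sig_and; first by apply: Sig_phi_eval; comp_tac2.
  by apply: Sig_rlt; comp_tac2.
apply: Sig_ext (Sig_app H (comp_pair hf (comp_pair hg hh))) => x.
by rewrite !npE.
Qed.

Lemma Sig_L_comp f g h : comp f -> comp g -> comp h ->
  Sig (fun x => L_comp (f x) (g x) (h x)).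
Proof.
move=> hf hg hh.
have H : Sig (fun w => L_comp (nfst w) (nfst (nsnd w)) (nsnd (nsnd w))).
  do 2 (apply: Sig_ex; cbv beta); apply: Sig_and; first by apply: Sig_phi_eval; comp_tac2.
  by apply: Sig_rlt; comp_tac2.
apply: Sig_ext (Sig_app H (comp_pair hf (comp_pair hg hh))) => x.
by rewrite !npE.
Qed.

Lemma Sig_U_ce f g h : comp f -> comp g -> comp h ->
  Sig (fun x => U_ce (f x) (g x) (h x)).
Proof.
move=> hf hg hh.
have H : Sig (fun w => U_ce (nfst w) (nfst (nsnd w)) (nsnd (nsnd w))).
  do 2 (apply: Sig_ex; cbv beta); apply: Sig_and; first by apply: Sig_phi_eval; comp_tac2.
  by apply: Sig_rlt; comp_tac2.
apply: Sig_ext (Sig_app H (comp_pair hf (comp_pair hg hh))) => x.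
by rewrite !npE.
Qed.

Lemma Pi2_I_comp : Pi2 I_comp.
Proof.
apply: Pi2_and.
  by apply: Pi2_all; apply: Pi2_Sig; apply: Sig_ex; apply: Sig_phi_eval; comp_tac2.
apply: Pi2_and.
  do 3 (apply: Pi2_all; cbv beta); apply: Pi2_imp; first by apply: Sig_phi_eval; comp_tac2.
  by apply: Pi2_Sig; apply: Sig_U_comp; comp_tac2.
apply: Pi2_and.
  do 3 (apply: Pi2_all; cbv beta); apply: Pi2_imp; first by apply: Sig_phi_eval; comp_tac2.
  by apply: Pi2_Sig; apply: Sig_L_comp; comp_tac2.
do 5 (apply: Pi2_all; cbv beta); do 2 (apply: Pi2_imp; first by apply: Sig_phi_eval; comp_tac2).
by apply: Pi2_Sig; apply: Sig_nrlt; comp_tac2.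
Qed.

Lemma Pi2_I_ce : Pi2 I_ce.
Proof.
apply: Pi2_and.
  by apply: Pi2_all; apply: Pi2_Sig; apply: Sig_ex; apply: Sig_phi_eval; comp_tac2.
apply: Pi2_and.
  do 4 (apply: Pi2_all; cbv beta); do 2 (apply: Pi2_imp; first by apply: Sig_phi_eval; comp_tac2).
  by apply: Pi2_Sig; apply: Sig_nrlt; comp_tac2.
do 3 (apply: Pi2_all; cbv beta); apply: Pi2_imp; first by apply: Sig_phi_eval; comp_tac2.
by apply: Pi2_Sig; apply: Sig_nrlt; comp_tac2.
Qed.
Transparent npair nfst nsnd pconst pstar padd pmul psub psum radd rmul rneg rinv r2 rlt r0 r1 rm1 p0 pone.


(** * Programs for the reduction *)

Lemma comp_div5 f : comp f -> comp (fun x => f x %/ 5).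
Proof.
move=> hf; apply: (@comp_app (fun x => x %/ 5)) => //.
apply: (@comp_search (fun x y => x < 5 * y.+1)) => [|x].
  by apply: dec_leq; comp_tac2.
by split=> [|m]; have := divn_eq x 5; have := ltn_pmod x (isT : 0 < 5); lia.
Qed.

Lemma comp_mod5 f : comp f -> comp (fun x => f x %% 5).
Proof.
move=> hf; apply: (@comp_ext (fun x => f x - 5 * (f x %/ 5))) => [x|].
  by have := divn_eq (f x) 5; lia.
by apply: comp_sub => //; apply: comp_mul; [exact: comp_const | exact: comp_div5].
Qed.

(* The value at 0 of the *-polynomial coded by [k], as a pair of codes of rationals, computed from
   the list [u] of the values of the *-polynomials k-1, ..., 0. *)
Definition value_step (k u : nat) : nat :=
  let q := k %/ 5 in let look i := lnth u (k.-1 - i) in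
  let x := look (nfst q) in let y := look (nsnd q) in
  if k %% 5 == 0 then q else
  if k %% 5 == 1 then npair r0 r0 else
  if k %% 5 == 2 then npair (nfst (look q)) (rneg (nsnd (look q))) else
  if k %% 5 == 3 then npair (radd (nfst x) (nfst y)) (radd (nsnd x) (nsnd y)) else
  npair (radd (rmul (nfst x) (nfst y)) (rneg (rmul (nsnd x) (nsnd y))))
        (radd (rmul (nfst x) (nsnd y)) (rmul (nsnd x) (nfst y))).

Definition value_table (k : nat) : nat := prec 0 (fun k u => npair (value_step k u) u) k.

Definition value (p : nat) : nat := value_step p (value_table p).

Lemma comp_value : comp value.
Proof.
have step : comp (fun y => value_step (nfst (nsnd y)) (nsnd (nsnd y))).
  have hk : comp (fun y => nfst (nsnd y)) by comp_tac2.
  have hq := comp_div5 hk; have hm := comp_mod5 hk.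
  have look f : comp f -> comp (fun y => lnth (nsnd (nsnd y)) ((nfst (nsnd y)).-1 - f y)).
    move=> hf; apply: comp_lnth; first by comp_tac2.
    by apply: comp_sub => //; apply: comp_pred.
  have hx := look _ (comp_fst hq); have hy := look _ (comp_snd hq); have hz := look _ hq.
  rewrite /value_step; cbv zeta; do 4 (apply: comp_if;
    [by apply: dec_eq => //; exact: comp_const | by repeat first [assumption | comp_step] | ]);
  by repeat first [assumption | comp_step].
have tab : comp value_table.
  apply: (@comp_prec (fun=> 0) (fun _ k u => npair (value_step k u) u) (fun x => x)); by comp_tac2.
apply: comp_ext (comp_app step (comp_pair comp_id (comp_pair comp_id tab))) => p.
by rewrite !npE.
Qed.

Lemma value_look k i : i < k -> lnth (value_table k) (k.-1 - i) = value i.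
Proof.
elim: k => // k IH; rewrite ltnS leq_eqVlt => /orP[/eqP ->|ik] /=.
  by rewrite subnn /lnth /= npE.
have -> : k - i = (k.-1 - i).+1 by lia.
by rewrite /lnth iterSr npE -/(lnth _ _); exact: IH.
Qed.

Lemma value_const m n : value (pconst m n) = npair m n.
Proof. by rewrite /value /value_step /pconst mulKn // modnMr. Qed.

Lemma value_star p : value (pstar p) = npair (nfst (value p)) (rneg (nsnd (value p))).
Proof.
rewrite {1}/value /value_step /pstar [5 * p]mulnC modnMDl divnMDl // addn0 /=.
by rewrite value_look //; lia.
Qed.

Lemma value_add p q : value (padd p q) = npair
  (radd (nfst (value p)) (nfst (value q))) (radd (nsnd (value p)) (nsnd (value q))).
Proof.
rewrite {1}/value /value_step /padd [5 * _]mulnC modnMDl divnMDl // addn0 /= !npE.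
by rewrite !value_look //; have := leq_npair p q; lia.
Qed.

Lemma value_mul p q : value (pmul p q) = npair
  (radd (rmul (nfst (value p)) (nfst (value q))) (rneg (rmul (nsnd (value p)) (nsnd (value q)))))
  (radd (rmul (nfst (value p)) (nsnd (value q))) (rmul (nsnd (value p)) (nfst (value q)))).
Proof.
rewrite {1}/value /value_step /pmul [5 * _]mulnC modnMDl divnMDl // addn0 /= !npE.
by rewrite !value_look //; have := leq_npair p q; lia.
Qed.

Opaque value.

Definition value_sqr p := radd (rmul (nfst (value p)) (nfst (value p)))
  (rmul (nsnd (value p)) (nsnd (value p))).
Definition dyadic j y := npair (npair y 0) (2 ^ j).-1.
(** For x = (p, j), the test whether the modulus of the value of [p] is less than y / 2^(j+1). The
    modulus involves a root, its square is rational; hence the test is decidable. *)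
Definition above x y := rlt (value_sqr (nfst x))
  (rmul (dyadic (nsnd x).+1 y) (dyadic (nsnd x).+1 y)).

Lemma dec_above : dec (fun w => above (nfst w) (nsnd w)).
Proof.
have hv f : comp f -> comp (fun x => value (f x)) by move=> hf; exact: comp_app comp_value hf.
have hd : comp (fun w => dyadic (nsnd (nfst w)).+1 (nsnd w)).
  apply: comp_pair; first by comp_tac2.
  by apply: comp_pred; comp_tac2.
apply: dec_rlt; last exact: comp_rmul.
have h : comp (fun w => value (nfst (nfst w))) by apply: hv; comp_tac2.
by rewrite /value_sqr; comp_tac2.
Qed.

Section Guarded.
Variables (r : nat -> nat -> nat -> bool) (g : nat -> nat).
Hypothesis hr : computable_rel3 r.
Hypothesis hg : comp g.

(** The search for [z] is run first and its result is then discarded, so the program for [g]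
    inherits the divergence of the search. *)
Lemma guarded_code : exists d, forall x i y,
  evals d (npair x i) y <-> (exists z, r x i z) /\ y = g i.
Proof.
have [c hc] : exists c, forall w z, evals c w z <->
    (r (nfst w) (nsnd w) z /\ forall m, m < z -> ~~ r (nfst w) (nsnd w) m).
  apply: (@search_code (fun w z => r (nfst w) (nsnd w) z)).
  have H := computable_comp hr.
  apply: comp_ext (comp_app H (_ : comp (fun y => npair (nfst (nfst y))
    (npair (nsnd (nfst y)) (nsnd y))))); last by comp_tac2.
  by move=> y; rewrite !npE.
have [c' hc'] : comp (fun u => g (nsnd (nsnd u))) by apply: (comp_app hg); comp_tac2.
have [ci hi] := comp_id.
exists (CComp c' (CPair c ci)) => x i y /=; split.
  move=> [u [z [w [/hc[rz _] ew ->]]] eu].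
  have -> := evals_fun eu (hc' _); have := evals_fun ew (hi _) => ->.
  by rewrite !npE in rz *; split=> //; exists z.
move=> [ez ->]; case: (ex_minnP ez) => z rz zmin.
exists (npair z (npair x i)); last by have := hc' (npair z (npair x i)); rewrite !npE.
exists z, (npair x i); split=> //; apply/hc; rewrite !npE; split=> // m.
by apply: contraTN => /zmin; rewrite -leqNgt.
Qed.

(* The s-m-n construction: the parameter is stored in a constant function. *)
Lemma guarded_index : exists2 f, comp f & forall x i y,
  phi_eval (f x) i y <-> (exists z, r x i z) /\ y = g i.
Proof.
have [d hd] := guarded_code; have [ci hi] := comp_id.
pose K := fix K x := if x is x'.+1 then CComp CSucc (K x') else CZero.
have hK x i y : evals (K x) i y <-> y = x.
  elim: x y => [|x IH] y //=; split=> [[u /IH -> ->]//|->].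
  by exists x => //; apply/IH.
exists (fun x => encode_code (CComp d (CPair (K x) ci))) => [|x i y].
  have hk : comp (fun x => encode_code (K x)).
    (* [1] is the code of [CSucc], and [4 * _ + 5] that of a composition. *)
    apply: (@comp_ext (fun x => prec 0 (fun _ u => 4 * npair 1 u + 5) x)) => [x|].
      by elim: x => //= x ->.
    apply: (@comp_prec (fun=> 0) (fun _ _ u => 4 * npair 1 u + 5) (fun x => x)); comp_tac2.
  have -> : (fun x => encode_code (CComp d (CPair (K x) ci))) = (fun x => 4 * npair (encode_code d)
    (4 * npair (encode_code (K x)) (encode_code ci) + 4) + 5) by [].
  by comp_tac2.
rewrite phi_evalE -hd /=; split.
  by move=> [u [a [b [/hK -> eb ->]]]]; have -> := evals_fun eb (hi _).
by move=> h; exists (npair x i) => //; exists x, i; split=> //; apply/hK.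
Qed.

End Guarded.
Local Open Scope ring_scope.

(** * Norms in C*-algebras *)

Section CStarNorm.
Variables (R : realType) (A : cstarType R).
Implicit Types x y : calg A.

Definition nrm x : R := rnorm (x : A).

Lemma nrmC x : `|x : A| = (nrm x)%:C%C.
Proof.
have : 0 <= `|x : A| by apply: normr_ge0.
rewrite lecE /nrm /rnorm => /andP[/eqP h _].
by case: `|x : A| h => a b /= ->.
Qed.

Lemma nrm_ge0 x : 0 <= nrm x.
Proof. by rewrite -lecR -nrmC normr_ge0. Qed.

Lemma nrm0 : nrm 0 = 0.
Proof. by rewrite /nrm /rnorm normr0. Qed.

Lemma nrm_eq0 x : nrm x = 0 -> x = 0.
Proof. by move=> h; apply: (@normr0_eq0 _ A); rewrite nrmC h. Qed.

Lemma nrmD x y : nrm (x + y) <= nrm x + nrm y.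
Proof. by rewrite -lecR rmorphD /= -!nrmC; exact: (@ler_normD _ A). Qed.

Lemma nrmZ (c : R[i]) x : nrm (c *: x) = normc c * nrm x.
Proof.
have : `|c *: (x : A)| = `|c| * `|x : A| by exact: normrZ.
by rewrite !nrmC /= => /(congr1 (@complex.Re R)); rewrite /= !mul0r subr0.
Qed.

Lemma nrmN x : nrm (- x) = nrm x.
Proof. by rewrite /nrm /rnorm; congr complex.Re; exact: (@normrN _ A). Qed.

Lemma nrmBC x y : nrm (x - y) = nrm (y - x).
Proof. by rewrite -nrmN opprB. Qed.

Lemma nrmB_le x y : nrm (x - y) <= nrm x + nrm y.
Proof. by rewrite -[nrm y]nrmN; exact: nrmD. Qed.

Lemma nrm_triangle y x z : nrm (x - z) <= nrm (x - y) + nrm (y - z).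
Proof. by rewrite -[x - z](subrKA y) ; exact: nrmD. Qed.

Lemma nrm_le_dist x y : nrm x <= nrm y + nrm (x - y).
Proof. by rewrite -{1}[x](subrKC y) ; exact: nrmD. Qed.

Lemma nrmM x y : nrm (x * y) <= nrm x * nrm y.
Proof. by rewrite -lecR rmorphM /= -!nrmC; exact: (@cnormM _ A). Qed.

Lemma nrm_sqr x : nrm (star x * x) = nrm x ^+ 2.
Proof.
have : `|cmul (cstar (x : A)) (x : A)| = `|x : A| ^+ 2 by exact: cnorm_star.
by rewrite !nrmC -rmorphXn /= => /(congr1 (@complex.Re R)).
Qed.

Lemma nrm_star_le x : nrm x <= nrm (star x).
Proof.
have [->|/eqP n0] := eqVneq (nrm x) 0; first exact: nrm_ge0.
have p : 0 < nrm x by rewrite lt_neqAle nrm_ge0 andbT eq_sym; apply/eqP.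
by rewrite -(ler_pM2r p) -expr2 -nrm_sqr nrmM.
Qed.

Lemma nrm_star x : nrm (star x) = nrm x.
Proof. by apply/le_anti; rewrite nrm_star_le -{2}[x]starK nrm_star_le. Qed.

Lemma star0 : star (0 : calg A) = 0.
Proof. by rewrite -(scale0r (0 : calg A)) starZ rmorph0 !scale0r. Qed.

Lemma star1 : star (1 : calg A) = 1.
Proof. by rewrite -[star 1]mul1r -{1}[1]starK -starM mul1r starK. Qed.

Lemma starN x : star (- x) = - star x.
Proof. by rewrite -scaleN1r starZ rmorphN rmorph1 scaleN1r. Qed.

Lemma starB x y : star (x - y) = star x - star y.
Proof. by rewrite starD starN. Qed.

Lemma star_sum I (r : seq I) (P : pred I) (F : I -> calg A) :
  star (\sum_(i <- r | P i) F i) = \sum_(i <- r | P i) star (F i).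
Proof. exact: (big_morph _ (@starD _ _) star0). Qed.

Lemma nrm1 : nrm 1 = 1.
Proof.
have /eqP := nrm_sqr 1; rewrite star1 mul1r expr2 -{1}[nrm 1]mul1r -subr_eq0 -mulrBl mulf_eq0.
case/orP => /eqP; first by move/eqP; rewrite subr_eq0 => /eqP.
by move/nrm_eq0/eqP; rewrite oner_eq0.
Qed.

Lemma nrm_sum I (r : seq I) (P : pred I) (F : I -> calg A) :
  nrm (\sum_(i <- r | P i) F i) <= \sum_(i <- r | P i) nrm (F i).
Proof.
elim/big_rec2: _ => [|i y x _ IH]; first by rewrite nrm0.
by apply: le_trans (nrmD _ _) _; rewrite lerD2l.
Qed.

Lemma nrm_scalar (c : R[i]) : nrm c%:A = normc c.
Proof. by rewrite nrmZ nrm1 mulr1. Qed.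

Lemma nrmM_dist x x' y y' :
  nrm (x * y - x' * y') <= nrm (x - x') * nrm y + nrm x' * nrm (y - y').
Proof.
have -> : x * y - x' * y' = (x - x') * y + x' * (y - y').
  by rewrite mulrBl mulrBr addrA subrK.
by apply: le_trans (nrmD _ _) _; apply: lerD; exact: nrmM.
Qed.

Lemma nrm_starB x y : nrm (star x - star y) = nrm (x - y).
Proof. by rewrite -starB nrm_star. Qed.

Lemma nrmD_dist x y x' y' :
  nrm (x + y - (x' + y')) <= nrm (x - x') + nrm (y - y').
Proof. by rewrite opprD addrACA nrmD. Qed.

End CStarNorm.

(** * Rational codes as real numbers *)

Section RationalCodes.
Variable R : realType.

Definition qr (n : nat) : R := ratr (rat_of_code n).

Lemma qrE n : qr n = ((nfst (nfst n))%:R - (nsnd (nfst n))%:R) / (nsnd n).+1%:R.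
Proof. by rewrite /qr /rat_of_code fmorph_div rmorphB !rmorph_nat. Qed.

Let den_gt0 n : 0 < (nsnd n).+1%:R :> R.
Proof. by rewrite ltr0n. Qed.

Lemma qr_radd a b : qr (radd a b) = qr a + qr b.
Proof.
rewrite !qrE /radd !npE prednK // !natrD !natrM.
have := den_gt0 a; have := den_gt0 b.
move: (nsnd a).+1%:R (nsnd b).+1%:R => x y yp xp.
by field; rewrite !gt_eqF.
Qed.

Lemma qr_rmul a b : qr (rmul a b) = qr a * qr b.
Proof.
rewrite !qrE /rmul !npE prednK // !natrD !natrM.
have := den_gt0 a; have := den_gt0 b.
move: (nsnd a).+1%:R (nsnd b).+1%:R => x y yp xp.
by field; rewrite !gt_eqF.
Qed.

Lemma qr_rneg a : qr (rneg a) = - qr a.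
Proof. by rewrite !qrE /rneg !npE -mulNr opprB. Qed.

Lemma rltE a b : rlt a b = (qr a < qr b).
Proof.
rewrite !qrE ltr_pdivrMr // mulrAC ltr_pdivlMr // !mulrBl -!natrM.
by rewrite ltrBlDr addrAC ltrBrDr -!natrD ltr_nat /rlt; lia.
Qed.

Lemma qr_r0 : qr r0 = 0.
Proof. by rewrite qrE /r0 !npE subrr mul0r. Qed.

Lemma qr_r1 : qr r1 = 1.
Proof. by rewrite qrE /r1 !npE subr0 divr1. Qed.

Lemma qr_rm1 : qr rm1 = -1.
Proof. by rewrite qrE /rm1 !npE sub0r divr1. Qed.

Lemma qr_rinv K : qr (rinv K) = K.+1%:R^-1.
Proof. by rewrite qrE /rinv !npE subr0 mul1r. Qed.

Lemma qr_r2 k : qr (r2 k) = 2 ^- k.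
Proof. by rewrite qrE /r2 !npE subr0 mul1r prednK ?expn_gt0 // natrX. Qed.

Lemma rat_of_code_surj q : exists n, rat_of_code n = q.
Proof.
exists (npair (npair (if 0 <= numq q then `|numq q|%N else 0)
                     (if 0 <= numq q then 0 else `|numq q|%N)) (`|denq q|%N.-1)).
rewrite /rat_of_code !npE prednK ?absz_gt0 ?denq_neq0 //.
rewrite -[RHS]divq_num_den; congr (_ / _); last first.
  by rewrite -[in RHS](gtz0_abs (denq_gt0 q)).
case: ifPn => h; first by rewrite subr0 -[in RHS](gez0_abs h).
rewrite sub0r; have h' : numq q <= 0 by rewrite ltW // ltNge.
by rewrite -[in RHS](opprK (numq q)) -(lez0_abs h') [RHS]rmorphN.
Qed.

Lemma qr_dense (x y : R) : x < y -> exists n, x < qr n < y.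
Proof.
move=> /rat_in_itvoo[q]; rewrite in_itv /= => h.
by have [n e] := rat_of_code_surj q; exists n; rewrite /qr e.
Qed.

Lemma qr_approx (x e : R) : 0 < e -> exists n, `|x - qr n| < e.
Proof.
move=> e0; have [n /andP[h1 h2]] : exists n, x - e < qr n < x + e by apply: qr_dense; lra.
by exists n; rewrite ltr_norml; lra.
Qed.

Lemma rinv_lt (e : R) : 0 < e -> exists K, forall K', (K <= K')%N -> K'.+1%:R^-1 < e.
Proof.
move=> e0; exists (Num.bound e^-1) => K' le.
rewrite invf_plt ?posrE ?ltr0n //.
apply: lt_le_trans (archi_boundP _) _; first by rewrite invr_ge0 ltW.
by rewrite ler_nat; apply: leq_trans le _.
Qed.

Lemma exp2_lt (e : R) : 0 < e -> exists k, forall k', (k <= k')%N -> 2 ^- k' < e.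
Proof.
move=> /rinv_lt[K HK]; exists K => k' le; apply: le_lt_trans (HK k' le).
rewrite lef_pV2 ?posrE ?exprn_gt0 ?ltr0n // -natrX ler_nat.
exact: ltn_expl.
Qed.

End RationalCodes.

(** * Evaluation of coded *-polynomials *)

Section PolyCodes.

Lemma encode_poly_inj p q : encode_poly p = encode_poly q -> p = q.
Proof.
elim: p q => [m n|n|p IH|p IHp p' IHp'|p IHp p' IHp'] [m' n'|n'|q|q q'|q q'] /= e;
  try (exfalso; lia).
- have /npair_inj[-> ->] // : npair m n = npair m' n' by lia.
- by congr PVar; lia.
- by rewrite (IH q) //; lia.
- have /npair_inj[/IHp -> /IHp' ->] // :
    npair (encode_poly p) (encode_poly p') = npair (encode_poly q) (encode_poly q') by lia.
- have /npair_inj[/IHp -> /IHp' ->] // :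
    npair (encode_poly p) (encode_poly p') = npair (encode_poly q) (encode_poly q') by lia.
Qed.

Lemma encode_poly_surj n : exists p, encode_poly p = n.
Proof.
have [m] := ubnP n; elim: m n => // m IH n lt.
have [q [r [nE ltr]]] : exists q r, n = (5 * q + r)%N /\ (r < 5)%N.
  by exists (n %/ 5)%N, (n %% 5)%N; have := divn_eq n 5; have := ltn_mod n 5; lia.
have h1 := nfst_le q; have h2 := nsnd_le q.
case: r nE ltr => [|[|[|[|[|//]]]]] nE _.
- by exists (PConst (nfst q) (nsnd q)) => /=; rewrite npairK; lia.
- by exists (PVar q) => /=; lia.
- by have [|p e] := IH q _; [lia | exists (PStar p) => /=; lia].
- have [|p e] := IH (nfst q) _; first by lia.
  have [|p' e'] := IH (nsnd q) _; first by lia.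
  by exists (PAdd p p') => /=; rewrite e e' npairK; lia.
- have [|p e] := IH (nfst q) _; first by lia.
  have [|p' e'] := IH (nsnd q) _; first by lia.
  by exists (PMul p p') => /=; rewrite e e' npairK; lia.
Qed.

Definition pdec (n : nat) : starpoly := projT1 (cid (encode_poly_surj n)).

Lemma pdecK n : encode_poly (pdec n) = n.
Proof. exact: (projT2 (cid (encode_poly_surj n))). Qed.

Lemma encode_polyK p : pdec (encode_poly p) = p.
Proof. by apply: encode_poly_inj; rewrite pdecK. Qed.

Variables (R : realType) (A : cstarType R) (a : nat -> A).

Definition pval (n : nat) : calg A := peval a (pdec n).

Definition cst (m n : nat) : R[i] := (qr R m +i* qr R n)%C.

Lemma cstE m n : (ratr (rat_of_code m) + 'i * ratr (rat_of_code n) : R[i]) = cst m n.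
Proof.
rewrite -!(fmorph_rat (real_complex R)) -complexiE /cst /qr.
by apply/eqP; rewrite eq_complex /=; apply/andP; split; apply/eqP; ring.
Qed.

Lemma pval_encode p : pval (encode_poly p) = peval a p.
Proof. by rewrite /pval encode_polyK. Qed.

Lemma pval_const m n : pval (pconst m n) = (cst m n)%:A.
Proof. by rewrite -[pconst m n]/(encode_poly (PConst m n)) pval_encode /= cstE. Qed.

Lemma pval_star p : pval (pstar p) = star (pval p).
Proof. by rewrite -{1}(pdecK p) -[pstar _]/(encode_poly (PStar (pdec p))) pval_encode. Qed.

Lemma pval_add p q : pval (padd p q) = pval p + pval q.
Proof.
by rewrite -{1}(pdecK p) -{1}(pdecK q) -[padd _ _]/(encode_poly (PAdd (pdec p) (pdec q))) pval_encode.
Qed.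

Lemma pval_mul p q : pval (pmul p q) = pval p * pval q.
Proof.
by rewrite -{1}(pdecK p) -{1}(pdecK q) -[pmul _ _]/(encode_poly (PMul (pdec p) (pdec q))) pval_encode.
Qed.

Lemma cst00 : cst r0 r0 = 0.
Proof. by rewrite /cst qr_r0. Qed.

Lemma cst10 : cst r1 r0 = 1.
Proof. by rewrite /cst qr_r0 qr_r1. Qed.

Lemma cstm10 : cst rm1 r0 = -1.
Proof. by rewrite /cst qr_r0 qr_rm1; apply/eqP; rewrite eq_complex /= oppr0 !eqxx. Qed.

Lemma pval0 : pval p0 = 0.
Proof. by rewrite -[p0]/(pconst r0 r0) pval_const cst00 scale0r. Qed.

Lemma pval1 : pval pone = 1.
Proof. by rewrite -[pone]/(pconst r1 r0) pval_const cst10 scale1r. Qed.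

Lemma pval_sub p q : pval (psub p q) = pval p - pval q.
Proof.
rewrite -[psub p q]/(padd p (pmul (pconst rm1 r0) q)).
by rewrite pval_add pval_mul pval_const cstm10 -scalerAl mul1r scaleN1r.
Qed.

Lemma pval_sum n F : pval (psum n F) = \sum_(i < n) pval (F i).
Proof.
elim: n => [|n IH]; first by rewrite big_ord0 -[psum 0 F]/p0 pval0.
by rewrite big_ord_recr /= -IH -pval_add.
Qed.

End PolyCodes.

Lemma normc_sqr (R : realType) (a b : R) : normc (a +i* b)%C ^+ 2 = a ^+ 2 + b ^+ 2.
Proof. by rewrite /normc sqr_sqrtr // addr_ge0 ?sqr_ge0. Qed.

Lemma normc_ge0 (R : realType) (c : R[i]) : 0 <= normc c.
Proof. by case: c => a b; exact: sqrtr_ge0. Qed.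

(** * Indices and seminorms *)

(* The seminorms that *-polynomials inherit from unital C*-algebras;
   *-polynomials are represented by their codes. *)
Record cstar_seminorm (R : realType) (s : nat -> R) : Prop := {
  s_ge0 : forall p, 0 <= s p;
  s_one : 1 <= s pone;
  s_add : forall p q, s (padd p q) <= s p + s q;
  s_mul : forall p q, s (pmul p q) <= s p * s q;
  s_star : forall p, s (pstar p) <= s p;
  s_sqr : forall p, s p ^+ 2 <= s (pmul (pstar p) p);
  s_const : forall p q, s (pconst p q) ^+ 2 <= qr R p ^+ 2 + qr R q ^+ 2;
  s_refl : forall p, s (psub p p) = 0;
  s_sym : forall p q, s (psub p q) <= s (psub q p);
  s_tri : forall p q r, s (psub p r) <= s (psub p q) + s (psub q r);
  s_le : forall p q, s p <= s q + s (psub p q);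
  s_p0 : forall p, s (psub p p0) <= s p;
  s_addd : forall p q r t, s (psub (padd p q) (padd r t)) <= s (psub p r) + s (psub q t);
  s_mull : forall p q r, s (psub (pmul p q) (pmul p r)) <= s p * s (psub q r);
  s_mulr : forall p q r, s (psub (pmul p r) (pmul q r)) <= s (psub p q) * s r;
  s_stard : forall p q, s (psub (pstar p) (pstar q)) <= s (psub p q);
  s_constd : forall p q r t, s (psub (pconst p q) (pconst r t)) ^+ 2 <=
    (qr R p - qr R r) ^+ 2 + (qr R q - qr R t) ^+ 2;
  s_addA : forall p q r, s (psub (padd p (padd q r)) (padd (padd p q) r)) = 0;
  s_addC : forall p q, s (psub (padd p q) (padd q p)) = 0;
  s_add0 : forall p, s (psub (padd p0 p) p) = 0;
  s_addN : forall p, s (psub (padd (pmul (pconst rm1 r0) p) p) p0) = 0;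
  s_mulA : forall p q r, s (psub (pmul p (pmul q r)) (pmul (pmul p q) r)) = 0;
  s_mul1p : forall p, s (psub (pmul pone p) p) = 0;
  s_mulp1 : forall p, s (psub (pmul p pone) p) = 0;
  s_mulDl : forall p q r, s (psub (pmul (padd p q) r) (padd (pmul p r) (pmul q r))) = 0;
  s_mulDr : forall p q r, s (psub (pmul p (padd q r)) (padd (pmul p q) (pmul p r))) = 0;
  s_constD : forall p q r t, 
    s (psub (padd (pconst p q) (pconst r t)) (pconst (radd p r) (radd q t))) = 0;
  s_constM : forall p q r t, 
    s (psub (pmul (pconst p q) (pconst r t))
      (pconst (radd (rmul p r) (rneg (rmul q t))) (radd (rmul p t) (rmul q r)))) = 0;
  s_constC : forall p q r, s (psub (pmul (pconst p q) r) (pmul r (pconst p q))) = 0;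
  s_starC : forall p q, s (psub (pstar (pconst p q)) (pconst p (rneg q))) = 0;
  s_starK : forall p, s (psub (pstar (pstar p)) p) = 0;
  s_starD : forall p q, s (psub (pstar (padd p q)) (padd (pstar p) (pstar q))) = 0;
  s_starM : forall p q, s (psub (pstar (pmul p q)) (pmul (pstar q) (pstar p))) = 0
}.

Definition cuts (R : realType) (U : nat -> nat -> nat -> Prop) (e : nat) (s : nat -> R) :=
  forall p r, U e p r <-> s p < qr R r.

(** * Seminorm inequalities as statements on upper cuts *)

Section CutForms.
Variables (R : realType) (U : nat -> nat -> nat -> Prop) (e : nat) (s : nat -> R).
Hypothesis hU : cuts U e s.
Hypothesis s0 : forall p, 0 <= s p.

Lemma zero_formP A : zero_form U A e <-> forall x, s (A x) = 0.
Proof.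
split=> H x; last by move=> K; apply/hU; rewrite H qr_rinv invr_gt0 ltr0n.
apply/le_anti; rewrite s0 andbT leNgt; apply/negP => /rinv_lt[K /(_ K (leqnn _))].
by have /hU := H x K; rewrite qr_rinv => h1 h2; move: (lt_trans h1 h2); rewrite ltxx.
Qed.

Lemma le_formP A B : le_form U A B e <-> forall x, s (A x) <= s (B x).
Proof.
split=> H x; last by move=> r /hU h; apply/hU; apply: le_lt_trans h.
rewrite leNgt; apply/negP => /qr_dense[n /andP[h1 h2]].
have /hU h3 : U e (A x) n by apply: H; apply/hU.
by move: (lt_trans h2 h3); rewrite ltxx.
Qed.

Lemma add_formP A B C : add_form U A B C e <-> forall x, s (A x) <= s (B x) + s (C x).
Proof.
split=> H x; last first.
  move=> r t /hU hr /hU ht; apply/hU; rewrite qr_radd.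
  by apply: le_lt_trans (H x) _; rewrite ltrD.
rewrite leNgt; apply/negP => lt.
pose d := (s (A x) - (s (B x) + s (C x))) / 2%:R.
have d0 : 0 < d by rewrite /d; lra.
have [r /andP[r1 r2]] := @qr_dense R (s (B x)) (s (B x) + d) ltac:(lra).
have [t /andP[t1 t2]] := @qr_dense R (s (C x)) (s (C x) + d) ltac:(lra).
have /hU : U e (A x) (radd r t) by apply: H; apply/hU.
by rewrite qr_radd => h; move: d0 r2 t2 h; rewrite /d; lra.
Qed.

Lemma mul_formP A B C : mul_form U A B C e <-> forall x, s (A x) <= s (B x) * s (C x).
Proof.
split=> H x; last first.
  move=> r t /hU hr /hU ht; apply/hU; rewrite qr_rmul.
  by apply: le_lt_trans (H x) _; apply: ltr_pM.
rewrite leNgt; apply/negP => lt.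
set b := s (B x) in lt *; set c := s (C x) in lt *; set a := s (A x) in lt *.
have b0 : 0 <= b by exact: s0.
have c0 : 0 <= c by exact: s0.
(* As [d <= 1], (b + d)(c + d) <= b c + d (b + c + 1) <= a, so rational bounds within [d] of [b] and
   [c] contradict [H]. *)
pose d := Num.min 1 ((a - b * c) / (b + c + 1)).
have d0 : 0 < d by rewrite lt_min ltr01 divr_gt0 //; lra.
have d1 : d <= 1 by rewrite ge_min lexx.
have d2 : d * (b + c + 1) <= a - b * c.
  by rewrite -ler_pdivlMr ?ge_min ?lexx ?orbT //; lra.
have [r /andP[r1 r2]] := @qr_dense R b (b + d) ltac:(lra).
have [t /andP[t1 t2]] := @qr_dense R c (c + d) ltac:(lra).
have /hU : U e (A x) (rmul r t) by apply: H; apply/hU.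
rewrite qr_rmul -/a => h.
have : qr R r * qr R t <= (b + d) * (c + d) by apply: ler_pM; lra.
have : d * d <= d by rewrite ler_piMr // ltW.
by move: d2 h; clear; nra.
Qed.

Let sqr_gap (a c : R) : 0 <= a -> 0 <= c -> c < a ^+ 2 ->
  exists r, [/\ 0 < qr R r, c < qr R r * qr R r & qr R r < a].
Proof.
move=> a0 c0 lt.
have h : Num.sqrt c < a by rewrite -(ltr_pXn2r (n := 2)) ?nnegrE ?sqrtr_ge0 // sqr_sqrtr.
have [r /andP[r1 r2]] := qr_dense h; exists r.
have p : 0 < qr R r by apply: le_lt_trans r1; exact: sqrtr_ge0.
split=> //; rewrite -expr2 -[c]sqr_sqrtr // ltr_pXn2r // ?nnegrE ?sqrtr_ge0 //.
exact: ltW.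
Qed.

Lemma sqr_formP A B : sqr_form U A B e <-> forall x, s (A x) ^+ 2 <= s (B x).
Proof.
split=> H x; last first.
  move=> r; rewrite (rltE R) qr_r0 => r0 /hU; rewrite qr_rmul -expr2 => h; apply/hU.
  rewrite -(ltr_pXn2r (n := 2)) ?nnegrE ?s0 ?(ltW r0) //.
  exact: le_lt_trans (H x) h.
rewrite leNgt; apply/negP => lt.
have [r [h1 h2 h3]] := sqr_gap (s0 _) (s0 _) lt.
have /hU : U e (A x) r by apply: H; [rewrite (rltE R) qr_r0 | apply/hU; rewrite qr_rmul].
by rewrite ltNge ltW.
Qed.

Lemma const_formP A a b : const_form U A a b e <->
  forall x, s (A x) ^+ 2 <= qr R (a x) ^+ 2 + qr R (b x) ^+ 2.
Proof.
split=> H x; last first.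
  move=> r; rewrite !(rltE R) qr_r0 qr_radd !qr_rmul -!expr2 => r0 h; apply/hU.
  rewrite -(ltr_pXn2r (n := 2)) ?nnegrE ?s0 ?(ltW r0) //.
  exact: le_lt_trans (H x) h.
rewrite leNgt; apply/negP => lt.
have [r [h1 h2 h3]] := sqr_gap (s0 _) (addr_ge0 (sqr_ge0 _) (sqr_ge0 _)) lt.
have /hU : U e (A x) r.
  apply: H; rewrite (rltE R) ?qr_r0 // qr_radd !qr_rmul.
  by move: h2; rewrite -!expr2.
by rewrite ltNge ltW.
Qed.

End CutForms.

Lemma norm_cond_seminorm (R : realType) U e (s : nat -> R) :
  cuts U e s -> norm_cond U e -> cstar_seminorm s.
Proof.
move=> hU H.
(* Nonnegativity comes first, because the equivalences for zeros, products and squares depend on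
   it. *)
have s0 p : 0 <= s p.
  by case: H => [h _]; rewrite leNgt; apply/negP; rewrite -(qr_r0 R) => /hU/h.
case: H => [h1 [h2 [h3 [h4 [h5 [h6 [h7 [h8 [h9 [h10 [h11 [h12 [h13 [h14 [h15 [h16 [h17 [h18 [h19 [h20 [h21 [h22 [h23 [h24 [h25 [h26 [h27 [h28 [h29 [h30 [h31 [h32 h33]]]]]]]]]]]]]]]]]]]]]]]]]]]]]]]]; split.
- exact: s0.
- by rewrite leNgt; apply/negP; rewrite -(qr_r1 R) => /hU/h2.
(* From here on each clause quantifies over one number that packs its variables; the remaining
   positions are filled with 0. *)
- by move=> p q; have := proj1 (add_formP hU _ _ _) h3 (npair p (npair q (npair 0 0)))%N; rewrite !npE.
- by move=> p q; have := proj1 (mul_formP hU s0 _ _ _) h4 (npair p (npair q (npair 0 0)))%N; rewrite !npE.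
- by move=> p; have := proj1 (le_formP hU _ _) h5 (npair p (npair 0 (npair 0 0)))%N; rewrite !npE.
- by move=> p; have := proj1 (sqr_formP hU s0 _ _) h6 (npair p (npair 0 (npair 0 0)))%N; rewrite !npE.
- by move=> p q; have := proj1 (const_formP hU s0 _ _ _) h7 (npair p (npair q (npair 0 0)))%N; rewrite !npE.
- by move=> p; have := proj1 (zero_formP hU s0 _) h8 (npair p (npair 0 (npair 0 0)))%N; rewrite !npE.
- by move=> p q; have := proj1 (le_formP hU _ _) h9 (npair p (npair q (npair 0 0)))%N; rewrite !npE.
- by move=> p q r; have := proj1 (add_formP hU _ _ _) h10 (npair p (npair q (npair r 0)))%N; rewrite !npE.
- by move=> p q; have := proj1 (add_formP hU _ _ _) h11 (npair p (npair q (npair 0 0)))%N; rewrite !npE.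
- by move=> p; have := proj1 (le_formP hU _ _) h12 (npair p (npair 0 (npair 0 0)))%N; rewrite !npE.
- by move=> p q r t; have := proj1 (add_formP hU _ _ _) h13 (npair p (npair q (npair r t)))%N; rewrite !npE.
- by move=> p q r; have := proj1 (mul_formP hU s0 _ _ _) h14 (npair p (npair q (npair r 0)))%N; rewrite !npE.
- by move=> p q r; have := proj1 (mul_formP hU s0 _ _ _) h15 (npair p (npair q (npair r 0)))%N; rewrite !npE.
- by move=> p q; have := proj1 (le_formP hU _ _) h16 (npair p (npair q (npair 0 0)))%N; rewrite !npE.
- by move=> p q r t; have := proj1 (const_formP hU s0 _ _ _) h17 (npair p (npair q (npair r t)))%N; rewrite !npE !qr_radd !qr_rneg.
- by move=> p q r; have := proj1 (zero_formP hU s0 _) h18 (npair p (npair q (npair r 0)))%N; rewrite !npE.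
- by move=> p q; have := proj1 (zero_formP hU s0 _) h19 (npair p (npair q (npair 0 0)))%N; rewrite !npE.
- by move=> p; have := proj1 (zero_formP hU s0 _) h20 (npair p (npair 0 (npair 0 0)))%N; rewrite !npE.
- by move=> p; have := proj1 (zero_formP hU s0 _) h21 (npair p (npair 0 (npair 0 0)))%N; rewrite !npE.
- by move=> p q r; have := proj1 (zero_formP hU s0 _) h22 (npair p (npair q (npair r 0)))%N; rewrite !npE.
- by move=> p; have := proj1 (zero_formP hU s0 _) h23 (npair p (npair 0 (npair 0 0)))%N; rewrite !npE.
- by move=> p; have := proj1 (zero_formP hU s0 _) h24 (npair p (npair 0 (npair 0 0)))%N; rewrite !npE.
- by move=> p q r; have := proj1 (zero_formP hU s0 _) h25 (npair p (npair q (npair r 0)))%N; rewrite !npE.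
- by move=> p q r; have := proj1 (zero_formP hU s0 _) h26 (npair p (npair q (npair r 0)))%N; rewrite !npE.
- by move=> p q r t; have := proj1 (zero_formP hU s0 _) h27 (npair p (npair q (npair r t)))%N; rewrite !npE.
- by move=> p q r t; have := proj1 (zero_formP hU s0 _) h28 (npair p (npair q (npair r t)))%N; rewrite !npE.
- by move=> p q r; have := proj1 (zero_formP hU s0 _) h29 (npair p (npair q (npair r 0)))%N; rewrite !npE.
- by move=> p q; have := proj1 (zero_formP hU s0 _) h30 (npair p (npair q (npair 0 0)))%N; rewrite !npE.
- by move=> p; have := proj1 (zero_formP hU s0 _) h31 (npair p (npair 0 (npair 0 0)))%N; rewrite !npE.
- by move=> p q; have := proj1 (zero_formP hU s0 _) h32 (npair p (npair q (npair 0 0)))%N; rewrite !npE.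
- by move=> p q; have := proj1 (zero_formP hU s0 _) h33 (npair p (npair q (npair 0 0)))%N; rewrite !npE.
Qed.

Lemma seminorm_norm_cond (R : realType) U e (s : nat -> R) :
  cuts U e s -> cstar_seminorm s -> norm_cond U e.
Proof.
move=> hU H; have s0 := s_ge0 H.
split; first by move=> p /hU; rewrite qr_r0 ltNge (s_ge0 H).
split; first by move=> /hU; rewrite qr_r1 ltNge (s_one H).
split; first by apply/(add_formP hU) => x; exact: (s_add H).
split; first by apply/(mul_formP hU s0) => x; exact: (s_mul H).
split; first by apply/(le_formP hU) => x; exact: (s_star H).
split; first by apply/(sqr_formP hU s0) => x; exact: (s_sqr H).
split; first by apply/(const_formP hU s0) => x; exact: (s_const H).
split; first by apply/(zero_formP hU s0) => x; exact: (s_refl H).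
split; first by apply/(le_formP hU) => x; exact: (s_sym H).
split; first by apply/(add_formP hU) => x; exact: (s_tri H).
split; first by apply/(add_formP hU) => x; exact: (s_le H).
split; first by apply/(le_formP hU) => x; exact: (s_p0 H).
split; first by apply/(add_formP hU) => x; exact: (s_addd H).
split; first by apply/(mul_formP hU s0) => x; exact: (s_mull H).
split; first by apply/(mul_formP hU s0) => x; exact: (s_mulr H).
split; first by apply/(le_formP hU) => x; exact: (s_stard H).
split; first by apply/(const_formP hU s0) => x; rewrite !qr_radd !qr_rneg; exact: (s_constd H).
split; first by apply/(zero_formP hU s0) => x; exact: (s_addA H).
split; first by apply/(zero_formP hU s0) => x; exact: (s_addC H).
split; first by apply/(zero_formP hU s0) => x; exact: (s_add0 H).
split; first by apply/(zero_formP hU s0) => x; exact: (s_addN H).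
split; first by apply/(zero_formP hU s0) => x; exact: (s_mulA H).
split; first by apply/(zero_formP hU s0) => x; exact: (s_mul1p H).
split; first by apply/(zero_formP hU s0) => x; exact: (s_mulp1 H).
split; first by apply/(zero_formP hU s0) => x; exact: (s_mulDl H).
split; first by apply/(zero_formP hU s0) => x; exact: (s_mulDr H).
split; first by apply/(zero_formP hU s0) => x; exact: (s_constD H).
split; first by apply/(zero_formP hU s0) => x; exact: (s_constM H).
split; first by apply/(zero_formP hU s0) => x; exact: (s_constC H).
split; first by apply/(zero_formP hU s0) => x; exact: (s_starC H).
split; first by apply/(zero_formP hU s0) => x; exact: (s_starK H).
split; first by apply/(zero_formP hU s0) => x; exact: (s_starD H).
by apply/(zero_formP hU s0) => x; exact: (s_starM H).
Qed.

Section IndexCuts.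
Variable R : realType.

Lemma comp_index_cuts e (A : cstarType R) (a : nat -> A) : computable_index e a ->
  I_comp e /\ cuts U_comp e (fun p => nrm (pval a p)).
Proof.
move=> [_ H].
have tot x : exists n, phi_eval e x n.
  have [n h _] := H (pdec (nfst x)) (nsnd x).
  by exists n; rewrite pdecK npairK in h.
have ap p k n : phi_eval e (npair p k) n -> `|qr R n - nrm (pval a p)| < 2 ^- k.
  move=> h; have [n' h' lt] := H (pdec p) k; rewrite pdecK in h'.
  by rewrite (phi_eval_fun h h').
have half (d : R) : 0 < d -> exists k, 2 ^- k < d / 2.
  by move=> d0; have [k hk] := @exp2_lt R (d / 2) ltac:(lra); exists k; apply: hk.
have hU : cuts U_comp e (fun p => nrm (pval a p)).
  move=> p r; split=> [[k [n [h]]]|lt].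
    by rewrite (rltE R) qr_radd qr_r2; have := ap _ _ _ h; rewrite ltr_norml; lra.
  have [k hk] := half (qr R r - nrm (pval a p)) ltac:(lra).
  have [n h] := tot (npair p k); exists k, n; split=> //.
  by rewrite (rltE R) qr_radd qr_r2; have := ap _ _ _ h; rewrite ltr_norml; lra.
split=> //; split=> //; split=> [p k n h|].
  by apply/hU; rewrite qr_radd qr_r2; have := ap _ _ _ h; rewrite ltr_norml; lra.
split=> [p k n h|p k n k' n' h h'].
  have hn := ap _ _ _ h; rewrite ltr_norml in hn.
  (* The estimate of an index is strict; twice a sufficiently fine precision fits into the gap that
     it leaves. *)
  have [k' hk] := half (nrm (pval a p) - (qr R n - 2 ^- k)) ltac:(lra).
  have [n' h'] := tot (npair p k'); exists k', n'; split=> //.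
  by rewrite (rltE R) !qr_radd !qr_rneg !qr_r2; have := ap _ _ _ h'; rewrite ltr_norml; lra.
rewrite (rltE R) !qr_radd qr_rneg !qr_r2 -leNgt.
by have := ap _ _ _ h; have := ap _ _ _ h'; rewrite !ltr_norml; lra.
Qed.

Lemma inf_cut (S : set R) (m : R) : S !=set0 -> (forall x, S x -> m <= x) ->
  (forall x, S x -> inf S <= x) /\ (forall y, inf S < y -> exists2 x, S x & x < y).
Proof.
move=> ne lb.
have hS : has_inf S by split=> //; exists m => x /lb.
split=> [x Sx|y lt]; first by apply: ge_inf => //; case: hS.
have [x Sx hx] := @inf_adherent _ S (y - inf S) ltac:(by rewrite subr_gt0) hS.
by exists x => //; move: hx; rewrite addrC subrK.
Qed.

(** The norm is recovered as the infimum of all upper estimates n + 2^-k; the last clause of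
    [I_comp] keeps it above every lower estimate n - 2^-k. The second and third clauses provide, for
    each estimate, one strictly inside it, which turns these weak bounds into the strict ones that
    an index requires. *)
Lemma comp_index_complete e : I_comp e -> exists s : nat -> R, cuts U_comp e s /\
  forall (A : cstarType R) (a : nat -> A), is_presentation a ->
    (forall p, nrm (pval a p) = s p) -> computable_index e a.
Proof.
move=> [tot [hU [hL hC]]].
pose S p : set R := fun x => exists k n, phi_eval e (npair p k) n /\ x = qr R n + 2 ^- k.
have low p k n x : phi_eval e (npair p k) n -> S p x -> qr R n - 2 ^- k <= x.
  move=> h [k' [n' [h' ->]]]; have := hC _ _ _ _ _ h' h.
  by rewrite (rltE R) !qr_radd qr_rneg !qr_r2 -leNgt.
have ne p : S p !=set0.
  by have [n h] := tot (npair p 0%N); exists (qr R n + 2 ^- 0); exists 0%N, n.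
have cut p : (forall x, S p x -> inf (S p) <= x) /\
    (forall y, inf (S p) < y -> exists2 x, S p x & x < y).
  have [n h] := tot (npair p 0%N).
  by apply: (@inf_cut _ (qr R n - 2 ^- 0)) => // x; apply: low.
have low' p k n : phi_eval e (npair p k) n -> qr R n - 2 ^- k <= inf (S p).
  move=> h; rewrite leNgt; apply/negP => /(proj2 (cut p))[x Sx].
  by rewrite ltNge (low _ _ _ _ h).
exists (fun p => inf (S p)); split.
  move=> p r; split.
    move=> [k [n [h]]]; rewrite (rltE R) qr_radd qr_r2; apply: le_lt_trans.
    by apply: (proj1 (cut p)); exists k, n.
  move=> /(proj2 (cut p))[_ [k [n [h ->]]] lt]; exists k, n; split=> //.
  by rewrite (rltE R) qr_radd qr_r2.
move=> A a pres eqs; split=> // p k.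
have [n h] := tot (npair (encode_poly p) k); exists n => //.
rewrite -[rnorm _]/(nrm (peval a p)) -pval_encode eqs -[ratr _]/(qr R n) ltr_norml.
have [k1 [n1 [h1]]] := hU _ _ _ h; rewrite (rltE R) !qr_radd !qr_r2 => lt1.
have [k2 [n2 [h2]]] := hL _ _ _ h; rewrite (rltE R) !qr_radd !qr_rneg !qr_r2 => lt2.
have le1 : inf (S (encode_poly p)) <= qr R n1 + 2 ^- k1.
  by apply: (proj1 (cut _)); exists k1, n1.
by have := low' _ _ _ h2; lra.
Qed.

Lemma ce_index_cuts e (A : cstarType R) (a : nat -> A) : ce_index e a ->
  I_ce e /\ cuts U_ce e (fun p => nrm (pval a p)).
Proof.
move=> [_ H].
have {}H p : exists u : nat -> nat, [/\ forall j, phi_eval e (npair p j) (u j),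
    forall i j, (i <= j)%N -> qr R (u j) <= qr R (u i),
    forall j, nrm (pval a p) <= qr R (u j) &
    forall d, 0 < d -> exists j, qr R (u j) < nrm (pval a p) + d].
  have [u [h1 h2 h3]] := H (pdec p); rewrite pdecK in h1; exists u.
  have h4 i j : (i <= j)%N -> qr R (u j) <= qr R (u i).
    by move=> /h2; rewrite /qr ler_rat.
  split=> // [j|d d0].
    rewrite leNgt; apply/negP => lt.
    have /cvgrPdist_lt/(_ (nrm (pval a p) - qr R (u j))) := h3.
    rewrite subr_gt0 => /(_ lt)[N _ /(_ (maxn N j) (leq_maxl _ _))] /=.
    rewrite -[ratr _]/(qr R (u (maxn N j))) -[rnorm _]/(nrm (pval a p)) ltr_norml.
    by have := h4 _ _ (leq_maxr N j); lra.
  have /cvgrPdist_lt/(_ d d0)[N _ /(_ N (leqnn _))] /= := h3.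
  rewrite -[ratr _]/(qr R (u N)) -[rnorm _]/(nrm (pval a p)) ltr_norml.
  by exists N; lra.
have hU : cuts U_ce e (fun p => nrm (pval a p)).
  move=> p r; have [u [h1 h2 h3 h4]] := H p; split=> [[k [n [h]]]|lt].
    by rewrite (rltE R) (phi_eval_fun h (h1 k)); apply: le_lt_trans.
  have [j hj] := h4 (qr R r - nrm (pval a p)) ltac:(lra).
  by exists j, (u j); split=> //; rewrite (rltE R); lra.
split=> //; split=> [x|].
  have [u [h1 _ _ _]] := H (nfst x).
  by exists (u (nsnd x)); rewrite -{1}(npairK x).
split=> [p k n n' h h'|p k n h]; have [u [h1 h2 h3 h4]] := H p; rewrite (rltE R) -leNgt.
  by rewrite (phi_eval_fun h (h1 _)) (phi_eval_fun h' (h1 _)) h2.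
by rewrite (phi_eval_fun h (h1 _)) qr_r0; apply: le_trans (h3 _); exact: nrm_ge0.
Qed.

Lemma ce_index_complete e : I_ce e -> exists s : nat -> R, cuts U_ce e s /\
  forall (A : cstarType R) (a : nat -> A), is_presentation a ->
    (forall p, nrm (pval a p) = s p) -> ce_index e a.
Proof.
move=> [tot [hM h0]].
have [u hu] := choice tot.
pose v p j := qr R (u (npair p j)).
have vM p i j : (i <= j)%N -> v p j <= v p i.
  move=> /subnK <-; elim: (j - i)%N => // k IH; apply: le_trans IH.
  by have := hM _ _ _ _ (hu (npair p (k + i))) (hu (npair p (k + i).+1)); rewrite (rltE R) -leNgt.
pose S p : set R := range (v p).
have cut p : (forall x, S p x -> inf (S p) <= x) /\
    (forall y, inf (S p) < y -> exists2 x, S p x & x < y).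
  apply: (@inf_cut _ 0) => [|x [j _ <-]]; first by exists (v p 0%N); exists 0%N.
  by have := h0 _ _ _ (hu (npair p j)); rewrite (rltE R) qr_r0 -leNgt.
exists (fun p => inf (S p)); split.
  move=> p r; split.
    move=> [k [n [h]]]; rewrite (rltE R) (phi_eval_fun h (hu _)); apply: le_lt_trans.
    by apply: (proj1 (cut p)); exists k.
  move=> /(proj2 (cut p))[_ [j _ <-] lt]; exists j, (u (npair p j)); split=> //.
  by rewrite (rltE R).
move=> A a pres eqs; split=> // p; exists (fun j => u (npair (encode_poly p) j)).
split=> // [i j le|]; first by have := vM (encode_poly p) _ _ le; rewrite /v /qr ler_rat.
rewrite -[rnorm _]/(nrm (peval a p)) -pval_encode eqs.
apply/cvgrPdist_lt => d d0.
have [_ [j _ <-] lt] := proj2 (cut (encode_poly p)) (inf (S (encode_poly p)) + d) ltac:(lra).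
exists j => // k /= le; rewrite -[ratr _]/(v (encode_poly p) k) ltr_norml.
have le2 : inf (S (encode_poly p)) <= v (encode_poly p) k by apply: (proj1 (cut _)); exists k.
by have := vM (encode_poly p) _ _ le; lra.
Qed.

End IndexCuts.

Lemma calg_seminorm (R : realType) (A : cstarType R) (a : nat -> A) :
  cstar_seminorm (fun p => nrm (pval a p)).
Proof.
have nc (x y : R) : normc (x +i* y)%C ^+ 2 <= x ^+ 2 + y ^+ 2 by rewrite normc_sqr.
have cstB m n m' n' : cst R m n - cst R m' n' = ((qr R m - qr R m') +i* (qr R n - qr R n'))%C by [].
split=> *; rewrite ?(pval_sub, pval_add, pval_mul, pval_star, pval0, pval1).
- exact: nrm_ge0.
- by rewrite nrm1.
- exact: nrmD.
- exact: nrmM.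
- by rewrite nrm_star.
- by rewrite nrm_sqr.
- by rewrite pval_const nrm_scalar nc.
- by rewrite subrr nrm0.
- by rewrite nrmBC.
- exact: nrm_triangle.
- exact: nrm_le_dist.
- by rewrite subr0.
- exact: nrmD_dist.
- by rewrite -mulrBr nrmM.
- by rewrite -mulrBl nrmM.
- by rewrite nrm_starB.
- by rewrite !pval_const -scalerBl nrm_scalar cstB nc.
- by rewrite addrA subrr nrm0.
- by rewrite [X in X - _]addrC subrr nrm0.
- by rewrite add0r subrr nrm0.
- by rewrite pval_const cstm10 scaleN1r mulN1r addNr subr0 nrm0.
- by rewrite mulrA subrr nrm0.
- by rewrite mul1r subrr nrm0.
- by rewrite mulr1 subrr nrm0.
- by rewrite mulrDl subrr nrm0.
- by rewrite mulrDr subrr nrm0.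
- rewrite !pval_const -scalerDl; set x := (X in nrm X); suff -> : x = 0 by rewrite nrm0.
  apply/eqP; rewrite subr_eq0; apply/eqP; congr (_ *: _).
  by apply/eqP; rewrite eq_complex /= !qr_radd !eqxx.
- rewrite !pval_const -scalerAl mul1r scalerA; set x := (X in nrm X); suff -> : x = 0 by rewrite nrm0.
  apply/eqP; rewrite subr_eq0; apply/eqP; congr (_ *: _).
  by apply/eqP; rewrite eq_complex /= !qr_radd ?qr_rneg !qr_rmul !eqxx.
- by rewrite !pval_const -scalerAl -scalerAr mul1r mulr1 subrr nrm0.
- rewrite !pval_const starZ star1; set x := (X in nrm X); suff -> : x = 0 by rewrite nrm0.
  apply/eqP; rewrite subr_eq0; apply/eqP; congr (_ *: _).
  by apply/eqP; rewrite eq_complex /= qr_rneg !eqxx.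
- by rewrite starK subrr nrm0.
- by rewrite starD subrr nrm0.
- by rewrite starM subrr nrm0.
Qed.

(** * Completion of the *-polynomials *)

Section Null.
Variable R : realType.
Implicit Types f g : nat -> R.

(* Used for nonnegative sequences only, where it means convergence to 0. *)
Definition null f := forall e, 0 < e -> exists N, forall n, (N <= n)%N -> f n <= e.

Lemma null_le f g : null g -> (forall n, f n <= g n) -> null f.
Proof. by move=> ng fg e /ng[N HN]; exists N => n /HN; apply: le_trans. Qed.

Lemma null_add f g : null f -> null g -> null (fun n => f n + g n).
Proof.
move=> nf ng e e0; have e2 : 0 < e / 2%:R by lra.
have [N HN] := nf _ e2; have [M HM] := ng _ e2; exists (maxn N M) => n.
by rewrite geq_max => /andP[/HN h1 /HM h2]; lra.
Qed.

Lemma null0 : null (fun=> 0).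
Proof. by move=> e e0; exists 0%N => n _; exact: ltW. Qed.

Lemma null_scale c f : 0 <= c -> null f -> null (fun n => c * f n).
Proof.
move=> c0 nf e e0; have [N HN] := nf (e / (c + 1)) ltac:(by rewrite divr_gt0 //; lra).
exists N => n /HN h; have : (c + 1) * f n <= e by rewrite mulrC -ler_pdivlMr //; lra.
case: (lerP 0 (f n)) => h0; first by nra.
by move=> _; apply: le_trans (ltW e0); rewrite mulr_ge0_le0 // ltW.
Qed.

Lemma null_mul f g : (forall n, 0 <= f n) -> (forall n, 0 <= g n) ->
  null f -> null g -> null (fun n => f n * g n).
Proof.
move=> f0 g0 nf ng e e0; have [N HN] := nf _ ltr01; have [M HM] := ng e e0.
exists (maxn N M) => n; rewrite geq_max => /andP[/HN h1 /HM h2].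
by have := f0 n; have := g0 n; nra.
Qed.

Lemma null_rinv : null (fun n => n.+1%:R^-1).
Proof. by move=> e /rinv_lt[K HK]; exists K => n /HK/ltW. Qed.

Lemma null_sub f : null f -> forall h : nat -> nat, (forall n, (n <= h n)%N) ->
  null (fun n => f (h n)).
Proof. by move=> nf h hh e /nf[N HN]; exists N => n le; apply/HN/(leq_trans le). Qed.

Lemma null_cst0 c : null (fun=> c) -> c <= 0.
Proof.
move=> nc; rewrite leNgt; apply/negP => c0.
by have [N /(_ N (leqnn _))] := nc (c / 2) ltac:(lra); lra.
Qed.

Lemma null_squeeze (a b : R) f : (forall n, a <= b + f n) -> null f -> a <= b.
Proof.
move=> h nf; rewrite -subr_le0; apply: null_cst0; apply: (null_le nf) => n.
by rewrite lerBlDl.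
Qed.

Lemma null_cvg (u : nat -> R) l : null (fun n => `|l - u n|) <-> u @ \oo --> l.
Proof.
split=> [nu|/cvgrPdist_le h e e0].
  by apply/cvgrPdist_le => e /nu[N HN]; exists N.
by have [N _ HN] := h e e0; exists N => n /HN.
Qed.

End Null.
Arguments null_rinv : clear implicits.
Arguments null0 : clear implicits.
Arguments null_le {R f g} _ _.

Lemma normc_le (R : realType) (x y : R) : normc (x +i* y)%C <= `|x| + `|y|.
Proof.
rewrite -(ler_pXn2r (n := 2)) ?nnegrE ?normc_ge0 ?addr_ge0 //.
rewrite normc_sqr -[x ^+ 2]real_normK ?num_real // -[y ^+ 2]real_normK ?num_real //.
by have := normr_ge0 x; have := normr_ge0 y; nra.
Qed.

Section Completion.
Variables (R : realType) (s : nat -> R) (Hs : cstar_seminorm s).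
Implicit Types (p q : nat) (u v : nat -> nat).

Local Notation d p q := (s (psub p q)).

Lemma d_ge0 p q : 0 <= d p q. Proof. exact: s_ge0. Qed.
Hint Resolve d_ge0 : core.
Lemma dC p q : d p q = d q p.
Proof. by apply/le_anti; rewrite !(s_sym Hs). Qed.
Let d_tri p q r : d p r <= d p q + d q r := s_tri Hs p q r.
Lemma sE p : s p = d p p0.
Proof.
apply/le_anti; rewrite (s_p0 Hs) andbT; apply: le_trans (s_le Hs p p0) _.
have : s p0 ^+ 2 <= 0 by have := s_const Hs r0 r0; rewrite qr_r0 expr0n /= addr0.
have := s_ge0 Hs p0; have := s_ge0 Hs (psub p p0); nra.
Qed.

(* A point of the completion is represented by its distances to the polynomials. *)
Record completion (H : cstar_seminorm s) := Completion { cdist :> nat -> R;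
  complP : forall e, 0 < e -> exists p, forall q, `|cdist q - d p q| <= e }.
Local Notation compl := (completion Hs).
Local Notation Compl := (@Completion Hs _).
Implicit Types x y z : compl.

HB.instance Definition _ := gen_eqMixin compl.
HB.instance Definition _ := gen_choiceMixin compl.

Lemma cdist_approx x e : 0 < e -> exists p, x p <= e.
Proof.
move=> /(complP x)[p /(_ p)]; rewrite (s_refl Hs) subr0 => h; exists p.
exact: le_trans (ler_norm _) h.
Qed.

Let eps_le (a b : R) : (forall e, 0 < e -> a <= b + e) -> a <= b.
Proof. by move=> h; apply/ler_addgt0Pr. Qed.

Lemma cdist_le x p q : x p <= x q + d q p.
Proof.
apply: eps_le => e e0; have [r hr] := complP x (e := e / 2) ltac:(lra).
have := hr p; have := hr q; rewrite !ler_norml; have := d_tri r q p.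
lra.
Qed.

Lemma d_le x p q : d p q <= x p + x q.
Proof.
apply: eps_le => e e0; have [r hr] := complP x (e := e / 2) ltac:(lra).
have := hr p; have := hr q; rewrite !ler_norml; have := d_tri p r q; rewrite (dC p r).
lra.
Qed.

Lemma cdist_ge0 x p : 0 <= x p.
Proof. by have := d_le x p p; rewrite (s_refl Hs); lra. Qed.
Hint Resolve cdist_ge0 : core.

(** If some polynomials come arbitrarily close to both points at once, the triangle inequality
    identifies the two distance functions, and proof irrelevance does the rest. *)
Lemma cdist_eq x y : (forall e, 0 < e -> exists p, x p <= e /\ y p <= e) -> x = y.
Proof.
move=> h; have e : cdist x = cdist y.
  have main (z t : compl) : (forall e, 0 < e -> exists p, z p <= e /\ t p <= e) ->
      forall q, z q <= t q.
    move=> H q; apply: eps_le => e e0; have [p [h1 h2]] := H (e / 2) ltac:(lra).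
    by have := cdist_le z q p; have := d_le t p q; lra.
  apply/funext => q; apply/le_anti; rewrite !main // => e0 /h[p []].
  by exists p.
by case: x y e {h} => f hf [g hg] /= e; case: g / e hg => hg; congr Compl; exact: Prop_irrelevance.
Qed.

Local Notation conv u x := (null (fun n : nat => cdist x (u n))).
Definition cauchyq u := forall e, 0 < e -> exists N, forall m n,
  (N <= m)%N -> (N <= n)%N -> d (u m) (u n) <= e.

Lemma cauchyq_conv u : cauchyq u -> exists x, conv u x.
Proof.
move=> cu.
(* The limit of d(u_n, q), obtained as the infimum of its eventual upper bounds. *)
pose S q : set R := fun t => exists N, forall n, (N <= n)%N -> d (u n) q <= t.
pose f q := inf (S q).
have key q e N : (forall m n, (N <= m)%N -> (N <= n)%N -> d (u m) (u n) <= e) ->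
    `|f q - d (u N) q| <= e.
  move=> HN.
  have lb t : S q t -> d (u N) q - e <= t.
    move=> [M HM]; have := HM _ (leq_maxr N M); have := HN _ _ (leqnn N) (leq_maxl N M).
    by have := d_tri (u N) (u (maxn N M)) q; lra.
  have Sm : S q (d (u N) q + e).
    exists N => n le; have := HN _ _ le (leqnn _); have := d_tri (u n) (u N) q; lra.
  have [h1 h2] := inf_cut (ex_intro _ _ Sm) lb.
  rewrite ler_norml; apply/andP; split; last by have := h1 _ Sm; rewrite -/(f q); lra.
  rewrite -subr_ge0 leNgt; apply/negP => lt.
  have [t /lb ht] := h2 (d (u N) q - e) ltac:(by move: lt; rewrite /f; lra).
  by lra.
have hf e : 0 < e -> exists p, forall q, `|f q - d p q| <= e.
  by move=> /cu[N HN]; exists (u N) => q; apply: key.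
exists (Compl hf) => e e0; have [N HN] := cu (e / 2) ltac:(lra); exists N => n le /=.
have := key (u n) _ _ HN; rewrite ler_norml; have := HN _ _ (leqnn N) le; lra.
Qed.

Definition ipoly_fun p : nat -> R := fun q => d p q.
Lemma ipoly_subproof p e : 0 < e -> exists r, forall q, `|ipoly_fun p q - d r q| <= e.
Proof. by move=> e0; exists p => q; rewrite subrr normr0 ltW. Qed.
Definition ipoly p := Compl (@ipoly_subproof p).

Definition clim u : compl := xget (ipoly p0) [set x | conv u x].

Lemma climP u : cauchyq u -> conv u (clim u).
Proof. by move=> /cauchyq_conv h; apply: (@xgetPex _ _ [set x | conv u x]). Qed.

Lemma rep_ex x : exists u, forall n, x (u n) <= n.+1%:R^-1.
Proof.
have h n : exists p, x p <= n.+1%:R^-1 by apply: cdist_approx; rewrite invr_gt0 ltr0n.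
by have [u hu] := choice h; exists u.
Qed.
Definition rep x : nat -> nat := projT1 (cid (rep_ex x)).
Lemma rep_conv x : conv (rep x) x.
Proof. by apply: (null_le (null_rinv R)) => n; apply: (projT2 (cid (rep_ex x))). Qed.

Lemma conv_ipoly p : conv (fun=> p) (ipoly p).
Proof. by apply: (null_le (null0 R)) => n; rewrite /= /ipoly_fun (s_refl Hs). Qed.

Lemma conv_near u v x : conv u x -> null (fun n => d (u n) (v n)) -> conv v x.
Proof. by move=> cu nd; apply: (null_le (null_add cu nd)) => n; exact: cdist_le. Qed.

Lemma near_conv u v x : conv u x -> conv v x -> null (fun n => d (u n) (v n)).
Proof. by move=> cu cv; apply: (null_le (null_add cu cv)) => n; exact: d_le. Qed.

Lemma conv_uniq u v x y : conv u x -> conv v y -> (forall n, d (u n) (v n) = 0) -> x = y.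
Proof.
move=> cu cv duv; apply: cdist_eq => e e0.
have [N HN] := cu e e0; have [M HM] := cv e e0; exists (u (maxn N M)).
split; first exact/HN/leq_maxl.
apply: le_trans (HM _ (leq_maxr N M)); apply: le_trans (cdist_le _ _ (v (maxn N M))) _.
by rewrite dC duv addr0.
Qed.

Lemma conv_inj u x y : conv u x -> conv u y -> x = y.
Proof. by move=> cx cy; apply: (conv_uniq cx cy) => n; exact: s_refl. Qed.

Lemma near_cauchyq u (f : nat -> R) : null f ->
  (forall m n, d (u m) (u n) <= f m + f n) -> cauchyq u.
Proof.
move=> nf h e e0; have [N HN] := nf (e / 2) ltac:(lra).
by exists N => m n /HN h1 /HN h2; apply: le_trans (h m n) _; lra.
Qed.

(** The operations are computed on chosen representing sequences. [conv_add], [conv_mul] and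
    [conv_star] make them independent of this choice, after which [conv_uniq] turns each identity
    that holds up to seminorm zero into a law of the completion. *)
Definition cadd x y := clim (fun n => padd (rep x n) (rep y n)).
Definition cmulq x y := clim (fun n => pmul (rep x n) (rep y n)).
Definition cstarq x := clim (fun n => pstar (rep x n)).

Lemma conv_add u v x y : conv u x -> conv v y ->
  conv (fun n => padd (u n) (v n)) (cadd x y).
Proof.
move=> cu cv.
have C : conv (fun n => padd (rep x n) (rep y n)) (cadd x y).
  apply/climP/(near_cauchyq (null_add (rep_conv x) (rep_conv y))) => m n.
  apply: le_trans (s_addd Hs _ _ _ _) _; rewrite addrACA.
  by apply: lerD; exact: d_le.
apply: (conv_near C).
apply: (null_le (null_add (near_conv (rep_conv x) cu) (near_conv (rep_conv y) cv))) => n.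
exact: s_addd.
Qed.

Lemma conv_star u x : conv u x -> conv (fun n => pstar (u n)) (cstarq x).
Proof.
move=> cu.
have C : conv (fun n => pstar (rep x n)) (cstarq x).
  apply/climP/(near_cauchyq (rep_conv x)) => m n.
  by apply: le_trans (s_stard Hs _ _) _; exact: d_le.
apply: (conv_near C); apply: (null_le (near_conv (rep_conv x) cu)) => n.
exact: s_stard.
Qed.

Lemma s_le_cdist x p : s p <= x p0 + x p.
Proof. by rewrite sE addrC d_le. Qed.

Lemma d_mul p q p' q' : d (pmul p q) (pmul p' q') <= d p p' * s q + s p' * d q q'.
Proof.
apply: le_trans (s_tri Hs _ (pmul p' q) _) _.
by apply: lerD; [exact: s_mulr | exact: s_mull].
Qed.

Lemma null_mul_near x y (u v u' v' : nat -> nat) : conv u x -> conv u' x -> conv v y -> conv v' y ->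
  null (fun n => d (pmul (u n) (v n)) (pmul (u' n) (v' n))).
Proof.
move=> cu cu' cv cv'.
have nu := near_conv cu cu'; have nv := near_conv cv cv'.
pose bnd n := y p0 * d (u n) (u' n) + d (u n) (u' n) * y (v n) +
  (x p0 * d (v n) (v' n) + x (u' n) * d (v n) (v' n)).
apply: (@null_le _ _ bnd) => [|n].
  apply: null_add; first by apply: null_add; [exact: null_scale | exact: null_mul].
  by apply: null_add; [exact: null_scale | exact: null_mul].
apply: le_trans (d_mul _ _ _ _) _; rewrite /bnd [y p0 * _]mulrC -mulrDr -mulrDl.
by apply: lerD; [apply: ler_wpM2l | apply: ler_wpM2r] => //; exact: s_le_cdist.
Qed.

Lemma conv_mul u v x y : conv u x -> conv v y ->
  conv (fun n => pmul (u n) (v n)) (cmulq x y).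
Proof.
move=> cu cv.
have C : conv (fun n => pmul (rep x n) (rep y n)) (cmulq x y).
  apply: climP => e e0.
  (* A bound for the sum of the seminorms of the two representing sequences from some index on;
     distances of at most 2 t with 2 t b <= e then suffice. *)
  pose b := (x p0 + 1) + (y p0 + 1).
  have b0 : 0 < b by rewrite /b; have := cdist_ge0 x p0; have := cdist_ge0 y p0; lra.
  pose t := Num.min 1 (e / (2 * b)).
  have t0 : 0 < t by rewrite lt_min ltr01 divr_gt0 //; lra.
  have t1 : t <= 1 by rewrite ge_min lexx.
  have tb : 2 * t * b <= e.
    by rewrite -mulrA mulrCA -ler_pdivlMr ?ge_min ?lexx ?orbT //; lra.
  have [N HN] := rep_conv x t0; have [M HM] := rep_conv y t0.
  exists (maxn N M) => m n; rewrite !geq_max => /andP[m1 m2] /andP[n1 n2].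
  apply: le_trans (d_mul _ _ _ _) _.
  have h1 : d (rep x m) (rep x n) <= 2 * t.
    by apply: le_trans (d_le x _ _) _; have := HN _ m1; have := HN _ n1; lra.
  have h2 : d (rep y m) (rep y n) <= 2 * t.
    by apply: le_trans (d_le y _ _) _; have := HM _ m2; have := HM _ n2; lra.
  have h3 : s (rep y m) <= y p0 + 1.
    by apply: le_trans (s_le_cdist y _) _; have := HM _ m2; lra.
  have h4 : s (rep x n) <= x p0 + 1.
    by apply: le_trans (s_le_cdist x _) _; have := HN _ n1; lra.
  apply: le_trans tb; rewrite /b mulrDr addrC [2 * t * _]mulrC.
  apply: lerD; first by apply: ler_pM => //; exact: s_ge0.
  by apply: ler_pM => //; exact: s_ge0.
by apply: (conv_near C); apply: (null_mul_near (rep_conv x) cu (rep_conv y) cv).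
Qed.

Lemma crep_ex (c : R[i]) : exists v : nat -> nat * nat,
  forall n, `|complex.Re c - qr R (v n).1| <= n.+1%:R^-1 /\
            `|complex.Im c - qr R (v n).2| <= n.+1%:R^-1.
Proof.
have h n : exists v : nat * nat, `|complex.Re c - qr R v.1| <= n.+1%:R^-1 /\
    `|complex.Im c - qr R v.2| <= n.+1%:R^-1.
  have h : 0 < n.+1%:R^-1 :> R by rewrite invr_gt0 ltr0n.
  have [a ha] := qr_approx (complex.Re c) h; have [b hb] := qr_approx (complex.Im c) h.
  by exists (a, b); rewrite !ltW.
by have [v hv] := choice h; exists v.
Qed.
Definition crep (c : R[i]) n : nat * nat := projT1 (cid (crep_ex c)) n.

Definition ccvg (a b : nat -> nat) (c : R[i]) :=
  null (fun n => `|complex.Re c - qr R (a n)|) /\ null (fun n => `|complex.Im c - qr R (b n)|).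

Lemma crepP c : ccvg (fun n => (crep c n).1) (fun n => (crep c n).2) c.
Proof.
by split; apply: (null_le (null_rinv R)) => n; case: (projT2 (cid (crep_ex c)) n).
Qed.

Definition ccst (c : R[i]) := clim (fun n => pconst (crep c n).1 (crep c n).2).

Lemma d_const p q r t : d (pconst p q) (pconst r t) <=
  `|qr R p - qr R r| + `|qr R q - qr R t|.
Proof.
have := s_constd Hs p q r t; rewrite -normc_sqr ler_pXn2r // ?nnegrE ?normc_ge0 // => h.
by apply: le_trans h _; exact: normc_le.
Qed.

Lemma conv_const a b c : ccvg a b c -> conv (fun n => pconst (a n) (b n)) (ccst c).
Proof.
move=> [ca cb]; have [ra rb] := crepP c.
have C : conv (fun n => pconst (crep c n).1 (crep c n).2) (ccst c).
  apply/climP/(near_cauchyq (null_add ra rb)) => m n.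
  apply: le_trans (d_const _ _ _ _) _; rewrite addrACA.
  apply: lerD; rewrite [X in _ <= X + _]distrC; exact: ler_distD.
apply: (conv_near C).
apply: (null_le (null_add (null_add ra ca) (null_add rb cb))) => n.
apply: le_trans (d_const _ _ _ _) _.
by apply: lerD; rewrite [X in _ <= X + _]distrC; exact: ler_distD.
Qed.

Lemma ccvgD a b c a' b' c' : ccvg a b c -> ccvg a' b' c' ->
  ccvg (fun n => radd (a n) (a' n)) (fun n => radd (b n) (b' n)) (c + c').
Proof.
move=> [h1 h2] [h3 h4]; split.
  apply: (null_le (null_add h1 h3)) => n; rewrite qr_radd.
  by case: c {h1 h2} c' {h3 h4} => x y [x' y'] /=; rewrite opprD addrACA ler_normD.
apply: (null_le (null_add h2 h4)) => n; rewrite qr_radd.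
by case: c {h1 h2} c' {h3 h4} => x y [x' y'] /=; rewrite opprD addrACA ler_normD.
Qed.

Let null_prod (x y : R) (f g : nat -> nat) : null (fun n => `|x - qr R (f n)|) ->
  null (fun n => `|y - qr R (g n)|) -> null (fun n => `|x * y - qr R (rmul (f n) (g n))|).
Proof.
move=> nf ng.
apply: (@null_le _ _ (fun n => `|x| * `|y - qr R (g n)| + (`|y| * `|x - qr R (f n)| +
   `|x - qr R (f n)| * `|y - qr R (g n)|))) => [|n].
  apply: null_add; first exact: null_scale.
  by apply: null_add; [exact: null_scale | exact: null_mul].
rewrite qr_rmul.
have -> : x * y - qr R (f n) * qr R (g n) = x * (y - qr R (g n)) +
   (y * (x - qr R (f n)) - (x - qr R (f n)) * (y - qr R (g n))) by ring.
rewrite -!normrM; apply: le_trans (ler_normD _ _) _; rewrite lerD2l.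
exact: ler_normB.
Qed.

Let null_dist_add (x y : R) (f g : nat -> nat) : null (fun n => `|x - qr R (f n)|) ->
  null (fun n => `|y - qr R (g n)|) -> null (fun n => `|x + y - qr R (radd (f n) (g n))|).
Proof.
move=> nf ng; apply: (null_le (null_add nf ng)) => n.
by rewrite qr_radd opprD addrACA ler_normD.
Qed.

Let null_dist_neg (x : R) (f : nat -> nat) : null (fun n => `|x - qr R (f n)|) ->
  null (fun n => `|- x - qr R (rneg (f n))|).
Proof. by move=> nf; apply: (null_le nf) => n; rewrite qr_rneg -opprD normrN. Qed.

Lemma ccvgM a b c a' b' c' : ccvg a b c -> ccvg a' b' c' ->
  ccvg (fun n => radd (rmul (a n) (a' n)) (rneg (rmul (b n) (b' n))))
       (fun n => radd (rmul (a n) (b' n)) (rmul (b n) (a' n))) (c * c').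
Proof.
case: c c' => x y [x' y'] [h1 h2] [h3 h4] /=; split=> /=.
  by apply: null_dist_add; [exact: null_prod | apply: null_dist_neg; exact: null_prod].
by apply: null_dist_add; exact: null_prod.
Qed.

Lemma ccvg_cst m n : ccvg (fun=> m) (fun=> n) (cst R m n).
Proof. by split; apply: (null_le (null0 R)) => k /=; rewrite subrr normr0. Qed.

Lemma ccst_cst m n : ccst (cst R m n) = ipoly (pconst m n).
Proof. exact: conv_inj (conv_const (ccvg_cst m n)) (conv_ipoly _). Qed.

Let conv_zero : conv (fun=> p0) (ccst 0).
Proof. by rewrite -cst00 ccst_cst; exact: conv_ipoly. Qed.
Let conv_one : conv (fun=> pone) (ccst 1).
Proof. by rewrite -cst10 ccst_cst; exact: conv_ipoly. Qed.
Let conv_m1 : conv (fun=> pconst rm1 r0) (ccst (-1)).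
Proof. by rewrite -cstm10 ccst_cst; exact: conv_ipoly. Qed.

(** Defined through the constant -1 to match [psub], so that differences of limits are limits of
    [psub]. *)
Definition copp x := cmulq (ccst (-1)) x.

Lemma caddA : associative cadd.
Proof.
move=> x y z; have [[h1 h2] h3] := (rep_conv x, rep_conv y, rep_conv z).
apply: (conv_uniq (conv_add h1 (conv_add h2 h3)) (conv_add (conv_add h1 h2) h3)) => n.
exact: s_addA.
Qed.

Lemma caddC : commutative cadd.
Proof.
move=> x y; have [h1 h2] := (rep_conv x, rep_conv y).
by apply: (conv_uniq (conv_add h1 h2) (conv_add h2 h1)) => n; exact: s_addC.
Qed.

Lemma cadd0 : left_id (ccst 0) cadd.
Proof.
move=> x; apply: (conv_uniq (conv_add conv_zero (rep_conv x)) (rep_conv x)) => n.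
exact: s_add0.
Qed.

Lemma caddN : left_inverse (ccst 0) copp cadd.
Proof.
move=> x; apply: (conv_uniq (conv_add (conv_mul conv_m1 (rep_conv x)) (rep_conv x)) conv_zero) => n.
exact: s_addN.
Qed.

Lemma cmulqA : associative cmulq.
Proof.
move=> x y z; have [[h1 h2] h3] := (rep_conv x, rep_conv y, rep_conv z).
apply: (conv_uniq (conv_mul h1 (conv_mul h2 h3)) (conv_mul (conv_mul h1 h2) h3)) => n.
exact: s_mulA.
Qed.

Lemma cmulq1x : left_id (ccst 1) cmulq.
Proof.
move=> x; apply: (conv_uniq (conv_mul conv_one (rep_conv x)) (rep_conv x)) => n.
exact: s_mul1p.
Qed.

Lemma cmulqx1 : right_id (ccst 1) cmulq.
Proof.
move=> x; apply: (conv_uniq (conv_mul (rep_conv x) conv_one) (rep_conv x)) => n.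
exact: s_mulp1.
Qed.

Lemma cmulqDl : left_distributive cmulq cadd.
Proof.
move=> x y z; have [[h1 h2] h3] := (rep_conv x, rep_conv y, rep_conv z).
apply: (conv_uniq (conv_mul (conv_add h1 h2) h3)
  (conv_add (conv_mul h1 h3) (conv_mul h2 h3))) => n.
exact: s_mulDl.
Qed.

Lemma cmulqDr : right_distributive cmulq cadd.
Proof.
move=> x y z; have [[h1 h2] h3] := (rep_conv x, rep_conv y, rep_conv z).
apply: (conv_uniq (conv_mul h1 (conv_add h2 h3))
  (conv_add (conv_mul h1 h2) (conv_mul h1 h3))) => n.
exact: s_mulDr.
Qed.

Lemma ccstD c c' : ccst (c + c') = cadd (ccst c) (ccst c').
Proof.
have [h1 h2] := (crepP c, crepP c'); apply/esym.
apply: (conv_uniq (conv_add (conv_const h1) (conv_const h2)) (conv_const (ccvgD h1 h2))) => n.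
exact: s_constD.
Qed.

Lemma ccstM c c' : ccst (c * c') = cmulq (ccst c) (ccst c').
Proof.
have [h1 h2] := (crepP c, crepP c'); apply/esym.
apply: (conv_uniq (conv_mul (conv_const h1) (conv_const h2)) (conv_const (ccvgM h1 h2))) => n.
exact: s_constM.
Qed.

Lemma ccstC c x : cmulq (ccst c) x = cmulq x (ccst c).
Proof.
have [h1 h2] := (crepP c, rep_conv x).
apply: (conv_uniq (conv_mul (conv_const h1) h2) (conv_mul h2 (conv_const h1))) => n.
exact: s_constC.
Qed.

Lemma cstarqK : involutive cstarq.
Proof.
move=> x; apply: (conv_uniq (conv_star (conv_star (rep_conv x))) (rep_conv x)) => n.
exact: s_starK.
Qed.

Lemma cstarqD x y : cstarq (cadd x y) = cadd (cstarq x) (cstarq y).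
Proof.
have [h1 h2] := (rep_conv x, rep_conv y).
apply: (conv_uniq (conv_star (conv_add h1 h2)) (conv_add (conv_star h1) (conv_star h2))) => n.
exact: s_starD.
Qed.

Lemma cstarqM x y : cstarq (cmulq x y) = cmulq (cstarq y) (cstarq x).
Proof.
have [h1 h2] := (rep_conv x, rep_conv y).
apply: (conv_uniq (conv_star (conv_mul h1 h2)) (conv_mul (conv_star h2) (conv_star h1))) => n.
exact: s_starM.
Qed.

Lemma ccst_star c : cstarq (ccst c) = ccst c^*.
Proof.
have h := crepP c.
have h' : ccvg (fun n => (crep c n).1) (fun n => rneg (crep c n).2) c^*.
  by case: c h => x y [h1 h2]; split=> //=; exact: null_dist_neg.
by apply: (conv_uniq (conv_star (conv_const h)) (conv_const h')) => n; exact: s_starC.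
Qed.

Definition cnorm x : R := x p0.

Lemma conv_cnorm u x : conv u x -> (fun n => s (u n)) @ \oo --> cnorm x.
Proof.
move=> cu; apply/null_cvg; apply: (null_le cu) => n; rewrite sE ler_norml /cnorm.
by have := cdist_le x p0 (u n); have := d_le x (u n) p0; lra.
Qed.

Lemma cnorm_ge0 x : 0 <= cnorm x. Proof. exact: cdist_ge0. Qed.

Lemma cnormD x y : cnorm (cadd x y) <= cnorm x + cnorm y.
Proof.
have [h1 h2] := (rep_conv x, rep_conv y).
apply: (ler_cvg_to (conv_cnorm (conv_add h1 h2)) (cvgD (conv_cnorm h1) (conv_cnorm h2))).
by apply: nearW => n; exact: s_add.
Qed.

Lemma cnormqM x y : cnorm (cmulq x y) <= cnorm x * cnorm y.
Proof.
have [h1 h2] := (rep_conv x, rep_conv y).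
apply: (ler_cvg_to (conv_cnorm (conv_mul h1 h2)) (cvgM (conv_cnorm h1) (conv_cnorm h2))).
by apply: nearW => n; exact: s_mul.
Qed.

Lemma cnormq_star x : cnorm (cstarq x) <= cnorm x.
Proof.
apply: (ler_cvg_to (conv_cnorm (conv_star (rep_conv x))) (conv_cnorm (rep_conv x))).
by apply: nearW => n; exact: s_star.
Qed.

Lemma cnorm_sqr x : cnorm x ^+ 2 <= cnorm (cmulq (cstarq x) x).
Proof.
have h := rep_conv x; rewrite expr2.
apply: (ler_cvg_to (cvgM (conv_cnorm h) (conv_cnorm h))
  (conv_cnorm (conv_mul (conv_star h) h))).
by apply: nearW => n; have := s_sqr Hs (rep x n); rewrite expr2.
Qed.

Lemma cnorm_eq0 x : cnorm x = 0 -> x = ccst 0.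
Proof.
move=> h; rewrite -cst00 ccst_cst; apply: cdist_eq => e e0; exists p0.
by rewrite -/(cnorm x) h /= /ipoly_fun (s_refl Hs) ltW.
Qed.

Lemma cnorm_ccst c : cnorm (ccst c) <= normc c.
Proof.
have [h1 h2] := crepP c; have h := conv_cnorm (conv_const (conj h1 h2)).
rewrite -(ler_pXn2r (n := 2)) ?nnegrE ?normc_ge0 ?cnorm_ge0 //.
case: c h1 h2 h => x y /= h1 h2 h; rewrite -/(normc (x +i* y)%C) normc_sqr !expr2.
apply: (ler_cvg_to (cvgM h h)); first apply: (cvgD (cvgM _ _) (cvgM _ _));
  try (apply/null_cvg; first [exact: h1 | exact: h2]).
by apply: nearW => n; have := s_const Hs (crep (x +i* y)%C n).1 (crep (x +i* y)%C n).2; rewrite !expr2.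
Qed.

(** Submultiplicativity gives only [<=]; the converse is the same inequality for the inverse
    scalar. *)
Lemma cnormZ c x : cnorm (cmulq (ccst c) x) = normc c * cnorm x.
Proof.
have le b y : cnorm (cmulq (ccst b) y) <= normc b * cnorm y.
  by apply: le_trans (cnormqM _ _) _; rewrite ler_wpM2r ?cnorm_ge0 ?cnorm_ccst.
apply/le_anti; rewrite le /=.
have [->|c0] := eqVneq c 0; first by rewrite normc0 mul0r cnorm_ge0.
have := le c^-1 (cmulq (ccst c) x).
rewrite cmulqA -ccstM mulVf // cmulq1x normcV.
have p : 0 < normc c.
  by rewrite lt_neqAle normc_ge0 andbT eq_sym; apply: contra c0 => /eqP/eq0_normc ->.
by rewrite mulrC ler_pdivlMr // mulrC.
Qed.

HB.instance Definition _ := GRing.isZmodule.Build compl caddA caddC cadd0 caddN.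

Lemma cscaleA (a b : R[i]) x :
  cmulq (ccst a) (cmulq (ccst b) x) = cmulq (ccst (a * b)) x.
Proof. by rewrite cmulqA ccstM. Qed.
Lemma cscaleDl x : {morph (fun a : R[i] => cmulq (ccst a) x) : a b / a + b}.
Proof. by move=> a b; rewrite ccstD cmulqDl. Qed.

HB.instance Definition _ := GRing.Zmodule_isLmodule.Build R[i] compl
  cscaleA cmulq1x (fun c => cmulqDr (ccst c)) cscaleDl.

Let cn x : R[i] := (cnorm x)%:C%C.
Let cn_D x y : cn (x + y) <= cn x + cn y.
Proof. by rewrite -rmorphD lecR; exact: cnormD. Qed.
Let cn_Z (c : R[i]) x : cn (c *: x) = `|c| * cn x.
Proof. by rewrite /cn cnormZ rmorphM. Qed.
Let cn_0 x : cn x = 0 -> x = 0.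
Proof. by move=> /(congr1 (@complex.Re R)); exact: cnorm_eq0. Qed.

HB.instance Definition _ := Lmodule_isNormed.Build R[i] compl cn_D cn_Z cn_0.

Lemma compl_normE x : `|x| = (cnorm x)%:C%C.
Proof. by []. Qed.

Lemma cnorm_sub_ipoly x p : cnorm (x - ipoly p) = x p.
Proof.
have h := conv_cnorm (conv_add (rep_conv x) (conv_mul conv_m1 (conv_ipoly p))).
rewrite -(cvg_lim (@norm_hausdorff _ _) h); apply: cvg_lim; first exact: norm_hausdorff.
apply/null_cvg.
apply: (null_le (rep_conv x)) => n; rewrite -[padd _ _]/(psub (rep x n) p) ler_norml.
by have := cdist_le x p (rep x n); have := d_le x (rep x n) p; lra.
Qed.

(** Seals the metric: the completeness proof uses only these five facts, and its estimates become
    linear arithmetic. *)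
Let dist_ex : exists dd : compl -> compl -> R,
  [/\ forall x y z, dd x z <= dd x y + dd y z, forall x y, dd x y = dd y x,
      forall x p, dd x (ipoly p) = x p, forall p q, dd (ipoly p) (ipoly q) = d p q &
      forall x y, `|x - y| = (dd x y)%:C%C].
Proof.
exists (fun x y => cnorm (x - y)); split=> // [x y z|x y|x p|p q].
- by rewrite -[x - z](subrKA y); exact: cnormD.
- by have := congr1 (@complex.Re R) (distrC x y).
- exact: cnorm_sub_ipoly.
- exact: cnorm_sub_ipoly.
Qed.

(** A Cauchy filter contains balls of radius 1 / (n + 1). Polynomials near their centres form a
    Cauchy sequence, whose limit is also that of the filter. *)
Lemma compl_complete (F : set_system compl) : ProperFilter F -> cauchy F -> cvg F.
Proof.
move=> FF /cauchyP cF; have [dd [tri symm dip dpp ddE]] := dist_ex.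
have Dinv n : 0 < n.+1%:R^-1 :> R by rewrite invr_gt0 ltr0n.
have [X HX] : exists X : nat -> compl, forall n, F [set y | dd (X n) y < n.+1%:R^-1].
  suff h n : exists x, F [set y | dd x y < n.+1%:R^-1].
    by have [X HX] := choice h; exists X.
  have [x] := cF ((n.+1%:R^-1 : R)%:C%C) ltac:(by rewrite -[0]/((0 : R)%:C%C) ltcR).
  rewrite -ball_normE => h; exists x; apply: filterS h => y /=.
  by rewrite ddE ltcR.
have [u hu] : exists u : nat -> nat, forall n, (X n) (u n) <= n.+1%:R^-1.
  have h n : exists p, (X n) p <= n.+1%:R^-1 by exact: cdist_approx.
  by have [u hu] := choice h; exists u.
have cu : cauchyq u.
  apply: (near_cauchyq (null_scale (ler0n R 2) (null_rinv R))) => m n.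
  have [y [h1 h2]] := filter_ex (filterI (HX m) (HX n)).
  have := tri (ipoly (u m)) (X m) (ipoly (u n)).
  have := tri (X m) (X n) (ipoly (u n)); have := tri (X m) y (X n).
  rewrite (symm (ipoly (u m)) (X m)) (symm y (X n)) !(dip (X _)) dpp.
  have := hu m; have := hu n; move: h1 h2 => /=.
  move: (dd _ _) (dd _ _) (dd _ _) (X m _) (X n _) (d _ _) => a1 a2 a3 a4 a5 a6.
  by move: (m.+1%:R^-1) (n.+1%:R^-1) => b1 b2; lra.
have [x hx] := cauchyq_conv cu.
apply/cvg_ex; exists x; apply/cvg_ballP => e e0.
have [h0 eE] : 0 < complex.Re e /\ e = (complex.Re e)%:C%C.
  by case: e e0 => a b; rewrite ltcE /= => /andP[/eqP -> ?].
have [N HN] := hx (complex.Re e / 4) ltac:(lra).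
have [M HM] := null_rinv R (complex.Re e / 4) ltac:(lra).
have [k hk1 hk2] : exists2 k, (N <= k)%N & (M <= k)%N.
  by exists (maxn N M); rewrite ?leq_maxl ?leq_maxr.
apply: filterS (HX k) => y /= hy; rewrite -ball_normE /= ddE eE ltcR.
have := tri x (ipoly (u k)) y; have := tri (ipoly (u k)) (X k) y.
rewrite (symm (ipoly (u k)) (X k)) !dip.
have := hu k; have := HN _ hk1; have := HM _ hk2.
move: hy h0; move: (dd _ _) (dd _ _) (dd _ _) (X k _) (x _) => a1 a2 a3 a4 a5.
by move: (k.+1%:R^-1) (complex.Re e) => b c; lra.
Qed.

HB.instance Definition _ := Uniform_isComplete.Build compl compl_complete.

Let compl_one_neq0 : ccst 1 != 0 :> compl.
Proof.
apply/eqP => h; have : cnorm (ccst 1) = 0 by rewrite h; have := congr1 (@complex.Re R) (@normr0 _ compl).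
rewrite -cst10 ccst_cst /cnorm /= /ipoly_fun -sE => h'.
by have := s_one Hs; rewrite -[pone]/(pconst r1 r0) h' ler10.
Qed.

Let compl_scaleAl (a : R[i]) x y : a *: cmulq x y = cmulq (a *: x) y.
Proof. exact: cmulqA. Qed.
Let compl_scaleAr (a : R[i]) x y : a *: cmulq x y = cmulq x (a *: y).
Proof.
by rewrite -[a *: y]/(cmulq (ccst a) y) cmulqA -ccstC -cmulqA.
Qed.
Let compl_starZ (a : R[i]) x : cstarq (a *: x) = a^* *: cstarq x.
Proof. by rewrite -[a *: x]/(cmulq (ccst a) x) cstarqM ccst_star -ccstC. Qed.
Let compl_normM x y : `|cmulq x y| <= `|x| * `|y|.
Proof. by rewrite !compl_normE -rmorphM lecR; exact: cnormqM. Qed.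
Let compl_norm_star x : `|cmulq (cstarq x) x| = `|x| ^+ 2.
Proof.
rewrite !compl_normE -rmorphXn; congr (_%:C%C); apply/le_anti; rewrite cnorm_sqr andbT.
by apply: le_trans (cnormqM _ _) _; rewrite expr2 ler_wpM2r ?cnorm_ge0 ?cnormq_star.
Qed.

HB.instance Definition _ := @CompleteNormedModule_isCStar.Build R compl
  (ccst 1) cmulq cstarq cmulqA cmulq1x cmulqx1 cmulqDl cmulqDr compl_one_neq0
  compl_scaleAl compl_scaleAr cstarqK cstarqD compl_starZ cstarqM
  compl_normM compl_norm_star.

End Completion.

(** * *-homomorphisms *)

Lemma lrmorphism_pack (K : pzRingType) (A B : algType K) (h : A -> B) :
  (forall x y, h (x - y) = h x - h y) -> h 1 = 1 ->
  (forall x y, h (x * y) = h x * h y) -> (forall c x, h (c *: x) = c *: h x) ->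
  exists f : {lrmorphism A -> B}, f =1 h.
Proof.
move=> hB h1 hM hZ.
pose ha := GRing.isZmodMorphism.Build A B h hB.
pose hm := GRing.isMonoidMorphism.Build A B h (h1, hM).
pose hs := GRing.isScalable.Build K A B *:%R h hZ.
pose f : {lrmorphism A -> B} := HB.pack h ha hm hs.
by exists f.
Qed.

Lemma normcR (R : realType) (r : R) : normc r%:C%C = `|r|.
Proof. by rewrite /= expr0n /= addr0 sqrtr_sqr. Qed.

Lemma normci (R : realType) : normc 'i = 1 :> R.
Proof. by rewrite -complexiE /= expr0n /= expr1n add0r sqrtr1. Qed.

Lemma conjcR (R : realType) (r : R) : (r%:C%C)^* = r%:C%C.
Proof. by apply/eqP; rewrite eq_complex /= oppr0 !eqxx. Qed.

(** * Density, presentations and limits of sequences *)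

Section Dense.
Variables (R : realType) (A : cstarType R).

Lemma realc_gt0 (e : R[i]) : 0 < e -> 0 < complex.Re e /\ e = (complex.Re e)%:C%C.
Proof. by case: e => a b; rewrite ltcE /= => /andP[/eqP -> ?]. Qed.

Lemma ballE (x y : calg A) (e : R) : ball (x : A) e%:C%C (y : A) <-> nrm (x - y) < e.
Proof.
rewrite -ball_normE /= -ltcR -nrmC.
by split.
Qed.

Lemma dense_nrm (S : set A) : dense S <->
  forall (x : calg A) e, 0 < e -> exists2 y : calg A, S y & nrm (x - y) < e.
Proof.
split=> [dS x e e0|dS O [x Ox] oO].
  have [|y [/ballE h1 h2]] := dS (ball (x : A) e%:C%C) _ (ball_open _ _); last by exists y.
  by exists (x : A); apply: ballxx; rewrite ltcR.
have /nbhs_ballP[e /= /realc_gt0[e0 eE] sub] : nbhs x O by apply: open_nbhs_nbhs.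
have [y Sy lt] := dS x _ e0.
by exists y; split=> //; apply: sub; rewrite eE; apply/ballE.
Qed.

Lemma cst_approx (c : R[i]) e : 0 < e -> exists m n, normc (c - cst R m n) < e.
Proof.
move=> e0; case: c => x y.
have [m hm] := qr_approx x (e := e / 2) ltac:(lra).
have [n hn] := qr_approx y (e := e / 2) ltac:(lra).
exists m, n; rewrite -[_ - _]/((x - qr R m) +i* (y - qr R n))%C.
by apply: le_lt_trans (normc_le _ _) _; lra.
Qed.

Lemma nrm_prod_near (x y : calg A) e : 0 < e -> exists2 d, 0 < d & forall x' y',
  nrm (x - x') < d -> nrm (y - y') < d -> nrm (x * y - x' * y') < e.
Proof.
move=> e0; pose b := nrm x + nrm y + 1.
have x0 := nrm_ge0 x; have y0 := nrm_ge0 y.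
have b0 : 0 < b by rewrite /b; lra.
exists (Num.min 1 (e / b)); first by rewrite lt_min ltr01 divr_gt0.
move=> x' y'; rewrite !lt_min => /andP[hx1 hx2] /andP[hy1 hy2].
apply: le_lt_trans (nrmM_dist _ _ _ _) _.
have hx' : nrm x' <= nrm x + 1 by have := nrm_le_dist x' x; rewrite nrmBC; lra.
have h1 : nrm (x - x') * nrm y <= e / b * nrm y by rewrite ler_wpM2r // ltW.
have h2 : nrm x' * nrm (y - y') <= (nrm x + 1) * nrm (y - y') by rewrite ler_wpM2r ?nrm_ge0.
have h3 : (nrm x + 1) * nrm (y - y') < (nrm x + 1) * (e / b) by rewrite ltr_pM2l //; lra.
have -> : e = (nrm x + nrm y + 1) * (e / b) by rewrite mulrCA mulfV ?mulr1 // gt_eqF.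
by move: h1 h2 h3; rewrite /b; lra.
Qed.

(** Bridges complex coefficients, allowed in the generated *-subalgebra, and the coefficients in
    Q(i) of generated points: the set [D] of elements that are approximable by generated points is
    itself a *-subalgebra containing the special points. *)
Lemma presentation_pval (a : nat -> A) : is_presentation a <->
  forall (x : calg A) e, 0 < e -> exists p, nrm (x - pval a p) < e.
Proof.
rewrite /is_presentation dense_nrm; split=> h x e e0; last first.
  have [p hp] := h x e e0; exists (pval a p) => //.
  move=> T [[T1 TD TZ TM TS] aT]; rewrite /pval.
  elim: (pdec p) => [m n|n|q IH|q IHq q' IHq'|q IHq q' IHq'] /=.
  - exact: TZ.
  - by apply: aT; exists n.
  - exact: TS.
  - exact: TD.
  - exact: TM.
pose D : set (calg A) := fun y => forall e, 0 < e -> exists p, nrm (y - pval a p) < e.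
have DM y z : D y -> D z -> D (y * z).
  move=> hy hz d d0; have [b b0 hb] := nrm_prod_near y z d0.
  have [p hp] := hy b b0; have [q hq] := hz b b0; exists (pmul p q).
  by rewrite pval_mul; apply: hb.
have DC c : D c%:A.
  move=> d d0; have [m [n hmn]] := cst_approx c d0; exists (pconst m n).
  by rewrite pval_const -scalerBl nrm_scalar.
have sD : star_subalgebra D.
  split=> //.
  - by rewrite -(scale1r (1 : calg A)).
  - move=> y z hy hz d d0; have [p hp] := hy (d / 2) ltac:(lra).
    have [q hq] := hz (d / 2) ltac:(lra); exists (padd p q).
    by rewrite pval_add; apply: le_lt_trans (nrmD_dist _ _ _ _) _; lra.
  - by move=> c y hy; rewrite -[y]mul1r scalerAl; apply: DM.
  - move=> y hy d d0; have [p hp] := hy d d0; exists (pstar p).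
    by rewrite pval_star nrm_starB.
have [y Sy lt] := h x (e / 2) ltac:(lra).
have Dy : D y.
  apply: Sy; split=> // _ [n _ <-] d d0; exists (encode_poly (PVar n)).
  by rewrite pval_encode /= subrr nrm0.
have [p hp] := Dy (e / 2) ltac:(lra); exists p.
by apply: le_lt_trans (nrm_triangle y _ _) _; lra.
Qed.

Lemma nrm_cauchy_lim (u : nat -> calg A) :
  (forall e, 0 < e -> exists N, forall m n, (N <= m)%N -> (N <= n)%N ->
     nrm (u m - u n) <= e) ->
  exists l, null (fun n => nrm (l - u n)).
Proof.
move=> cu.
have h : cvg ((u : nat -> A) @ \oo).
  apply: cauchy_cvg; apply: cauchy_exP => e /realc_gt0[e0 eE].
  have [N HN] := cu (complex.Re e / 2) ltac:(lra).
  exists (u N : A); exists N => // n /= le; rewrite eE; apply/ballE.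
  by apply: le_lt_trans (HN _ _ (leqnn _) le) _; lra.
have /cvg_ballP hl := h.
exists (lim ((u : nat -> A) @ \oo)) => e e0.
have [N _ HN] := hl e%:C%C ltac:(by rewrite ltcR).
by exists N => n /HN/ballE/ltW.
Qed.

Lemma nrm_lim_uniq (u : nat -> calg A) l l' : null (fun n => nrm (l - u n)) ->
  null (fun n => nrm (l' - u n)) -> l = l'.
Proof.
move=> h h'; apply/eqP; rewrite -subr_eq0; apply/eqP/nrm_eq0/le_anti; rewrite nrm_ge0 andbT.
apply: null_cst0; apply: (null_le (null_add h h')) => n.
by apply: le_trans (nrm_triangle (u n) _ _) _; rewrite [nrm (u n - l')]nrmBC.
Qed.

Lemma geometric_lim (u : nat -> calg A) c : 0 <= c ->
  (forall k, nrm (u k.+1 - u k) <= c * 2 ^- k) ->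
  exists l, forall k, nrm (l - u k) <= 2 * c * 2 ^- k.
Proof.
move=> c0 hu.
have p k : 0 < 2 ^- k :> R by rewrite invr_gt0 exprn_gt0.
(* Keeping the subtracted tail of the geometric series is what makes the induction go through. *)
have far k j : nrm (u (k + j)%N - u k) <= 2 * c * (2 ^- k - 2 ^- (k + j)).
  elim: j => [|j IH]; first by rewrite addn0 !subrr nrm0 mulr0.
  apply: le_trans (nrm_triangle (u (k + j)%N) _ _) _.
  have := hu (k + j)%N; rewrite -addnS => h1.
  have e2 : 2 ^- (k + j) = 2 * 2 ^- (k + j.+1) :> R.
    by rewrite addnS exprS invfM mulrA mulfV ?mul1r.
  by move: IH h1; rewrite e2; move: (c) c0 (nrm _) (nrm _) (2 ^- _) (2 ^- _) => *; nra.
have far' k j : nrm (u (k + j)%N - u k) <= 2 * c * 2 ^- k.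
  by apply: le_trans (far k j) _; apply: ler_wpM2l; [lra | have := p (k + j)%N; lra].
have [l hl] : exists l, null (fun n => nrm (l - u n)).
  apply: nrm_cauchy_lim => e e0.
  have [N HN] := @exp2_lt R (e / (4 * c + 1)) ltac:(by rewrite divr_gt0 //; lra).
  have bnd m : (N <= m)%N -> nrm (u m - u N) <= e / 2.
    move=> le; rewrite -(subnKC le); apply: le_trans (far' N (m - N)%N) _.
    have := HN N (leqnn _); rewrite ltr_pdivlMr; last by lra.
    have := p N; nra.
  exists N => m n /bnd hm /bnd hn; apply: le_trans (nrm_triangle (u N) _ _) _.
  by rewrite [nrm (u N - u n)]nrmBC; lra.
exists l => k.
have hs : null (fun j => nrm (l - u (k + j)%N)) by apply: (null_sub hl) => n; exact: leq_addl.
apply: (null_squeeze _ hs) => j; apply: le_trans (nrm_triangle (u (k + j)%N) _ _) _.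
by rewrite [leRHS]addrC lerD2l.
Qed.

End Dense.

Section ExtendHom.
Variables (R : realType) (A B : cstarType R) (G : calg A -> calg B -> Prop).
Hypothesis GB : forall x y x' y', G x y -> G x' y' -> G (x - x') (y - y').
Hypothesis GM : forall x y x' y', G x y -> G x' y' -> G (x * x') (y * y').
Hypothesis GS : forall x y, G x y -> G (star x) (star y).
Hypothesis GC : forall (c : R[i]) e, 0 < e ->
  exists x y, [/\ G x y, nrm (c%:A - x) < e & nrm (c%:A - y) < e].
Hypothesis Gle : forall x y, G x y -> nrm y <= nrm x.
Hypothesis Gdense : forall x e, 0 < e -> exists x' y', G x' y' /\ nrm (x - x') < e.

Let H x y := forall e, 0 < e -> exists x' y', [/\ G x' y', nrm (x - x') < e & nrm (y - y') < e].

Let H_inj x y z : H x y -> H x z -> y = z.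
Proof.
move=> h h'; apply/eqP; rewrite -subr_eq0; apply/eqP/nrm_eq0/le_anti; rewrite nrm_ge0 andbT.
apply/ler_addgt0Pr => e e0; rewrite add0r.
have [x1 [y1 [g1 a1 b1]]] := h (e / 4) ltac:(lra).
have [x2 [y2 [g2 a2 b2]]] := h' (e / 4) ltac:(lra).
have := Gle (GB g1 g2); have := nrm_triangle y1 y z; have := nrm_triangle y2 y1 z.
have := nrm_triangle x x1 x2; rewrite (nrmBC x1 x) (nrmBC y2 z); lra.
Qed.

Let H_ex x : exists y, H x y.
Proof.
have Dinv n : 0 < n.+1%:R^-1 :> R by rewrite invr_gt0 ltr0n.
have [u hu] := choice (fun n => Gdense x (Dinv n)).
have [v hv] := choice hu.
have [y hy] : exists y, null (fun n => nrm (y - v n)).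
  apply: nrm_cauchy_lim => e e0; have [N HN] := null_rinv R (e / 2) ltac:(lra).
  exists N => m n /HN hm /HN hn.
  have [g1 a1] := hv m; have [g2 a2] := hv n.
  apply: le_trans (Gle (GB g1 g2)) _; apply: le_trans (nrm_triangle x _ _) _.
  have b1 := lt_le_trans a1 hm; have b2 := lt_le_trans a2 hn.
  by rewrite (nrmBC (u m) x); lra.
exists y => e e0; have [N HN] := hy (e / 2) ltac:(lra).
have [M HM] := null_rinv R (e / 2) ltac:(lra).
exists (u (maxn N M)), (v (maxn N M)); have [g a] := hv (maxn N M); split=> //.
  by apply: lt_le_trans a _; apply: le_trans (HM _ (leq_maxr N M)) _; lra.
by have := HN _ (leq_maxl N M); lra.
Qed.

(** [G] is a contractive homomorphism given by its graph on a dense domain, and its closure [H] is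
    the graph of the extension: contractivity makes [H] single-valued, completeness of [B] makes it
    total. Scalars are required in [G] only approximately, because generated points have
    coefficients in Q(i). *)
Lemma extend_hom : exists h : {lrmorphism calg A -> calg B},
  [/\ star_preserving h, forall x y, G x y -> h x = y & forall x, nrm (h x) <= nrm x].
Proof.
have [h hh] := choice H_ex.
have hE x y : H x y -> h x = y by move=> Hxy; apply: H_inj (hh x) Hxy.
have HB x y x' y' : H x y -> H x' y' -> H (x - x') (y - y').
  move=> h1 h2 e e0; have [x1 [y1 [g1 a1 b1]]] := h1 (e / 2) ltac:(lra).
  have [x2 [y2 [g2 a2 b2]]] := h2 (e / 2) ltac:(lra).
  exists (x1 - x2), (y1 - y2); split; first exact: GB.
    by apply: le_lt_trans (nrmD_dist _ _ _ _) _; rewrite -opprD nrmN; lra.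
  by apply: le_lt_trans (nrmD_dist _ _ _ _) _; rewrite -opprD nrmN; lra.
have HM x y x' y' : H x y -> H x' y' -> H (x * x') (y * y').
  move=> h1 h2 e e0.
  have [d1 d10 hd1] := nrm_prod_near x x' e0; have [d2 d20 hd2] := nrm_prod_near y y' e0.
  have d0 : 0 < Num.min d1 d2 by rewrite lt_min d10.
  have [x1 [y1 [g1]]] := h1 _ d0; rewrite !lt_min => /andP[a1 a1'] /andP[b1 b1'].
  have [x2 [y2 [g2]]] := h2 _ d0; rewrite !lt_min => /andP[a2 a2'] /andP[b2 b2'].
  by exists (x1 * x2), (y1 * y2); split; [exact: GM | exact: hd1 | exact: hd2].
have HS x y : H x y -> H (star x) (star y).
  move=> h1 e e0; have [x1 [y1 [g1 a1 b1]]] := h1 _ e0.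
  by exists (star x1), (star y1); rewrite !nrm_starB; split=> //; exact: GS.
have HC c : H c%:A c%:A by move=> e; exact: GC.
have hC c : h c%:A = c%:A by exact: hE.
have [f fE] := @lrmorphism_pack _ _ _ h
  (fun x y => hE _ _ (HB _ _ _ _ (hh x) (hh y)))
  ltac:(by have := hC 1; rewrite !scale1r)
  (fun x y => hE _ _ (HM _ _ _ _ (hh x) (hh y)))
  ltac:(by move=> c x; rewrite -[x in LHS]mul1r -[h x]mul1r !scalerAl -(hC c);
           exact: hE (HM _ _ _ _ (hh _) (hh x))).
exists f; split.
- by move=> x; rewrite !fE; apply: hE (HS _ _ (hh x)).
- by move=> x y g; rewrite fE; apply: hE => e e0; exists x, y; rewrite !subrr !nrm0.
- move=> x; rewrite fE; apply/ler_addgt0Pr => e e0.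
  have [x1 [y1 [g a b]]] := hh x (e / 2) ltac:(lra).
  have := nrm_le_dist (h x) y1; have := Gle g; have := nrm_le_dist x1 x.
  by rewrite (nrmBC x1 x); lra.
Qed.

End ExtendHom.

(** * Automatic continuity of *-homomorphisms *)

Section AutomaticContinuity.
Variables (R : realType) (A : cstarType R).

(* The iteration w |-> (t + w^2) / 2 converges to 1 - sqrt (1 - t). *)
Lemma sqrt_near1 (z : calg A) : star z = z -> nrm z <= 2^-1 ->
  exists d, [/\ star d = d, d * z = z * d & d * d + z * z = 1].
Proof.
move=> zs z2; pose t := z * z; pose c : R[i] := (2^-1 : R)%:C%C.
have nc : normc c = 2^-1 by rewrite normcR ger0_norm // invr_ge0.
have cs : c^* = c by exact: conjcR.
pose w k := iter k (fun v => c *: (t + v * v)) (0 : calg A).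
have ts : star t = t by rewrite starM zs.
have wS k : star (w k) = w k.
  by elim: k => [|k IH] /=; rewrite ?star0 // starZ cs starD ts starM IH.
have wz k : w k * z = z * w k.
  elim: k => [|k IH] /=; first by rewrite mul0r mulr0.
  by rewrite -scalerAl -scalerAr mulrDl mulrDr -!mulrA IH !mulrA IH.
have tn : nrm t <= 4^-1.
  apply: le_trans (nrmM _ _) _; have -> : 4^-1 = 2^-1 * 2^-1 :> R by lra.
  by apply: ler_pM => //; exact: nrm_ge0.
have wn k : nrm (w k) <= 2^-1.
  elim: k => [|k IH] /=; first by rewrite nrm0.
  rewrite nrmZ nc; have := nrmD t (w k * w k); have := nrmM (w k) (w k).
  have := nrm_ge0 (w k); nra.
(* Each step is at most half the previous one: the factor 1/2 of the iteration meets the sum of two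
   norms, each at most 1/2. *)
have dw k : nrm (w k.+1 - w k) <= 1 * 2 ^- k.
  rewrite mul1r; elim: k => [|k IH].
    by rewrite expr0 subr0 invr1; apply: le_trans (wn 1%N) _; lra.
  rewrite -[w k.+2]/(c *: (t + w k.+1 * w k.+1)) -[X in _ - X]/(c *: (t + w k * w k)).
  rewrite -scalerBr nrmZ nc opprD addrACA subrr add0r exprS invfM ler_pM2l ?invr_gt0 //.
  apply: le_trans (nrmM_dist _ _ _ _) _.
  have := wn k; have := wn k.+1; have := nrm_ge0 (w k.+1 - w k); nra.
have [l hl] := geometric_lim ler01 dw.
have nl : null (fun k => nrm (l - w k)).
  apply: (@null_le _ _ (fun k => 2 * 2 ^- k)) => [|k]; last by have := hl k; rewrite mulr1.
  by apply: null_scale => // e /exp2_lt[K HK]; exists K => k /HK/ltW.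
have ls : star l = l.
  apply: (nrm_lim_uniq (u := w)) => //; apply: (null_le nl) => k.
  by rewrite -{1}(wS k) nrm_starB.
have lz : l * z = z * l.
  have n1 : null (fun k => nrm (l * z - w k * z)).
    by apply: (null_le (null_scale (nrm_ge0 z) nl)) => k; rewrite -mulrBl mulrC; exact: nrmM.
  apply: (nrm_lim_uniq n1); apply: (null_le (null_scale (nrm_ge0 z) nl)) => k.
  by rewrite wz -mulrBr; exact: nrmM.
have lE : l = c *: (t + l * l).
  apply: (nrm_lim_uniq (u := fun k => w k.+1)); first exact: (null_sub nl).
  apply: (@null_le _ _ (fun k => (nrm l + 1) * nrm (l - w k))) => [|k].
    by apply: null_scale => //; have := nrm_ge0 l; lra.
  rewrite -[w k.+1]/(c *: (t + w k * w k)) -scalerBr nrmZ nc opprD addrACA subrr add0r.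
  have := nrmM_dist l (w k) l (w k); have := wn k; have := nrm_ge0 l.
  have := nrm_ge0 (l - w k); nra.
(* The fixed point equation 2 l = t + l^2 says that (1 - l)^2 = 1 - t. *)
exists (1 - l); split; first by rewrite starB star1 ls.
  by rewrite mulrBl mulrBr mul1r mulr1 lz.
have e2 : t + l * l = l + l.
  rewrite [in RHS]lE -scalerDl -rmorphD /=.
  have -> : 2^-1 + 2^-1 = 1 :> R by lra.
  by rewrite rmorph1 scale1r.
rewrite mulrBr mulr1 mulrBl mul1r -/t opprB -addrA.
have -> : l * l - l + t = l by rewrite addrAC [l * l + t]addrC e2 addrK.
by rewrite subrK.
Qed.

(* [y + i g] and [y - i g] are unitary. *)
Lemma selfadj_circle (y g : calg A) : star y = y -> star g = g -> g * y = y * g ->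
  y * y + g * g = 1 -> nrm y <= 1.
Proof.
move=> ys gs yg e1.
have ii : 'i * 'i = -1 :> R[i] by rewrite -expr2 sqrCi.
have unit_nrm (u : calg A) : star u * u = 1 -> nrm u = 1.
  move=> hu; have := nrm_sqr u; rewrite hu nrm1 => /esym/eqP.
  by rewrite sqrf_eq1 => /orP[/eqP //|/eqP hm]; have := nrm_ge0 u; rewrite hm; lra.
have u1 : nrm (y + 'i *: g) = 1.
  apply: unit_nrm; rewrite starD starZ conjCi ys gs scaleNr mulrBl !mulrDr.
  rewrite -!scalerAl -!scalerAr scalerA ii scaleN1r yg.
  by rewrite opprD opprK addrA addrK.
have u2 : nrm (y - 'i *: g) = 1.
  apply: unit_nrm; rewrite starB starZ conjCi ys gs scaleNr opprK mulrDl !mulrBr.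
  rewrite -!scalerAl -!scalerAr scalerA ii scaleN1r yg opprK.
  by rewrite addrA subrK.
have := nrmD (y + 'i *: g) (y - 'i *: g).
rewrite addrACA subrr addr0 u1 u2 -[y in y + y]scale1r -scalerDl nrmZ.
have -> : normc (1 + 1 : R[i]) = 2.
  by rewrite -[1 + 1]/(real_complex R 1 + real_complex R 1) -rmorphD normcR ger0_norm; lra.
lra.
Qed.

End AutomaticContinuity.

Section HomBounded.
Variables (R : realType) (A B : cstarType R) (h : {lrmorphism calg A -> calg B}).
Hypothesis hs : star_preserving h.

(** The relation d^2 + z^2 = 1 is algebraic, so [h] preserves it, and in the target it bounds the
    norm by [selfadj_circle]. *)
Lemma hom_selfadj_bound (z : calg A) : star z = z -> nrm z <= 2^-1 -> nrm (h z) <= 1.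
Proof.
move=> zs /(sqrt_near1 zs)[d [ds dz e]].
apply: (@selfadj_circle _ _ _ (h d)); first by rewrite -hs zs.
- by rewrite -hs ds.
- by rewrite -!rmorphM dz.
- by rewrite -!rmorphM -rmorphD addrC e rmorph1.
Qed.

(** Scaling to norm 1/2 gives the factor 2 on self-adjoint elements, and the split into real and
    imaginary parts another 2; the constant 8 is generous. *)
Lemma hom_bounded (x : calg A) : nrm (h x) <= 8 * nrm x.
Proof.
have nR (r : R) : 0 <= r -> normc r%:C%C = r by move=> r0; rewrite normcR ger0_norm.
have sb z : star z = z -> nrm (h z) <= 2 * nrm z.
  move=> zs; have [z0|z0] := eqVneq (nrm z) 0.
    by rewrite (nrm_eq0 z0) raddf0 !nrm0 mulr0.
  have zp : 0 < nrm z by rewrite lt_neqAle eq_sym z0 nrm_ge0.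
  pose c : R := (2 * nrm z)^-1.
  have cp : 0 < c by rewrite invr_gt0; lra.
  have : nrm (h (c%:C%C *: z)) <= 1.
    apply: hom_selfadj_bound.
      by rewrite starZ zs conjcR.
    by rewrite nrmZ nR ?(ltW cp) // /c invfM -mulrA mulVf // mulr1.
  rewrite linearZ /= nrmZ nR ?(ltW cp) // /c mulrC ler_pdivrMr ?mul1r //; lra.
pose c : R[i] := (2^-1 : R)%:C%C.
have nc : normc c = 2^-1 by rewrite nR // invr_ge0.
have cs : c^* = c by exact: conjcR.
pose re := c *: (x + star x); pose im := (- ('i * c)) *: (x - star x).
have h1 : star re = re by rewrite starZ cs starD starK addrC.
have h2 : star im = im.
  have ce : (- ('i * c))^* = 'i * c by rewrite rmorphN rmorphM /= conjCi cs mulNr opprK.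
  rewrite starZ ce starB starK.
  by rewrite -[star x - x]opprB scalerN -scaleNr.
have e : x = re + 'i *: im.
  rewrite /re /im scalerA mulrN mulrA -expr2 sqrCi mulN1r opprK -scalerDr.
  rewrite addrACA subrr addr0 -[x in x + x]scale1r -scalerDl scalerA.
  have -> : c * (1 + 1) = 1; last by rewrite scale1r.
  by apply/eqP; rewrite eq_complex /=; apply/andP; split; apply/eqP; lra.
have n1 : nrm re <= nrm x.
  by rewrite nrmZ nc; have := nrmD x (star x); rewrite nrm_star; lra.
have ni := normci R.
have n2 : nrm im <= nrm x.
  rewrite /im scaleNr nrmN nrmZ normcM ni mul1r nc.
  by have := nrmB_le x (star x); rewrite nrm_star; lra.
move: re im h1 h2 e n1 n2 => re im h1 h2 e n1 n2.
rewrite [in h _]e raddfD /= linearZ /=; apply: le_trans (nrmD _ _) _.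
rewrite nrmZ ni mul1r; have := sb _ h1; have := sb _ h2.
have := nrm_ge0 x; lra.
Qed.

End HomBounded.

Section PresentedCompletion.
Variables (R : realType) (s : nat -> R) (Hs : cstar_seminorm s).

Definition compl_alg : cstarType R := completion Hs.
Definition compl_gen (n : nat) : compl_alg := ipoly Hs (encode_poly (PVar n)).

Lemma pval_compl p : pval compl_gen p = ipoly Hs p.
Proof.
rewrite /pval -[in RHS](pdecK p); elim: (pdec p) => [m n|n|q IH|q IHq q' IHq'|q IHq q' IHq'] //=.
- rewrite cstE -[RHS]/(ipoly Hs (pconst m n)) -ccst_cst.
  exact: (@cmulqx1 _ _ Hs (ccst Hs (cst R m n))).
- by rewrite IH; apply: (conv_inj (conv_star (conv_ipoly _ _)) (conv_ipoly _ _)).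
- by rewrite IHq IHq'; apply: (conv_inj (conv_add (conv_ipoly _ _) (conv_ipoly _ _)) (conv_ipoly _ _)).
- by rewrite IHq IHq'; apply: (conv_inj (conv_mul (conv_ipoly _ _) (conv_ipoly _ _)) (conv_ipoly _ _)).
Qed.

Lemma nrm_compl p : nrm (pval compl_gen p) = s p.
Proof. rewrite pval_compl; exact: (esym (sE Hs p)). Qed.

Lemma compl_presentation : is_presentation compl_gen.
Proof.
apply/presentation_pval => x e e0; have [p hp] := @cdist_approx _ _ Hs x (e / 2) ltac:(lra).
exists p; rewrite pval_compl; apply: (@le_lt_trans _ _ (x p)); last by lra.
by rewrite -cnorm_sub_ipoly.
Qed.

End PresentedCompletion.

(** * Inductive limits of matrix algebras *)

(** If a > b, Bernoulli's inequality makes the powers of a / b exceed [C]. *)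
Lemma pow2_le (R : realType) (a b C : R) : 0 <= a -> 0 <= b -> 0 <= C ->
  (forall k, a ^+ (2 ^ k)%N <= C * b ^+ (2 ^ k)%N) -> a <= b.
Proof.
move=> a0 b0 C0 h; rewrite leNgt; apply/negP => ba.
have bp : 0 < b.
  rewrite lt_neqAle b0 andbT; apply/eqP => bz.
  by have := h 0%N; rewrite expn0 !expr1 -bz mulr0; move: ba; rewrite -bz; lra.
pose q := a / b.
have q1 : 0 < q - 1 by rewrite subr_gt0 ltr_pdivlMr // mul1r.
have bern m : 1 + m%:R * (q - 1) <= q ^+ m.
  elim: m => [|m IH]; first by rewrite mul0r addr0 expr0.
  rewrite exprS; have m0 : 0 <= m%:R :> R by exact: ler0n.
  have : q * (1 + m%:R * (q - 1)) <= q * q ^+ m by rewrite ler_pM2l //; lra.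
  have : 0 <= m%:R * (q - 1) * (q - 1) by rewrite !mulr_ge0 // ltW.
  by rewrite -natr1; move: (q ^+ m) (m%:R) (q) => *; nra.
have qC k : q ^+ (2 ^ k)%N <= C.
  by rewrite /q expr_div_n ler_pdivrMr ?exprn_gt0.
pose k := Num.bound (C / (q - 1)).
have hk : C / (q - 1) < k%:R by apply: archi_boundP; rewrite divr_ge0 // ltW.
have := le_trans (bern _) (qC k).
have le2 : k%:R <= (2 ^ k)%N%:R :> R by rewrite ler_nat ltnW // ltn_expl.
have := ler_wpM2r (ltW q1) le2; move: hk; rewrite ltr_pdivrMr //.
by move: (k%:R * _) ((2 ^ k)%N%:R * _) => u v; lra.
Qed.

Section MatrixNorm.
Variables (R : realType) (n : nat) (A : cstarType R).
Local Notation M := 'M[R[i]]_n.+1.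
Variable mu : {lrmorphism M -> calg A}.
Hypothesis mus : star_preserving mu.

Lemma star_delta (i j : 'I_n.+1) : star (delta_mx i j : M) = delta_mx j i.
Proof.
rewrite -[star _]/(mxstar _); apply/matrixP => k l; rewrite !mxE andbC.
by case: (_ && _); rewrite ?rmorph1 ?rmorph0.
Qed.

Lemma mul_delta (i j k l : 'I_n.+1) :
  (delta_mx i j : M) * delta_mx k l = if j == k then delta_mx i l else 0.
Proof. by rewrite -mulmxE mul_delta_mx_cond; case: (j == k). Qed.

Lemma sum_delta : \sum_i (delta_mx i i : M) = 1.
Proof.
rewrite (_ : 1 = 1%:M :> M) // [1%:M]matrix_sum_delta; apply: eq_bigr => i _.
rewrite (bigD1 i) //= big1 => [|j ji]; first by rewrite mxE eqxx scale1r addr0.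
by rewrite mxE eq_sym (negbTE ji) scale0r.
Qed.

Lemma nrm_delta i j : nrm (mu (delta_mx i j)) <= 1.
Proof.
have h k : nrm (mu (delta_mx k k)) <= 1.
  have := nrm_sqr (mu (delta_mx k k)); rewrite -mus -rmorphM star_delta mul_delta eqxx => h.
  have [->|n0] := eqVneq (nrm (mu (delta_mx k k))) 0; first by [].
  have p : 0 < nrm (mu (delta_mx k k)) by rewrite lt_neqAle eq_sym n0 nrm_ge0.
  have /eqP := h; rewrite expr2 -{1}[nrm _]mul1r -subr_eq0 -mulrBl mulf_eq0 (negbTE n0) orbF.
  by rewrite subr_eq0 => /eqP <-.
rewrite -(ler_pXn2r (n := 2)) ?nnegrE ?nrm_ge0 // expr1n.
by rewrite -nrm_sqr -mus -rmorphM star_delta mul_delta eqxx h.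
Qed.

(** The scalar matrix x_ij 1 is the sum over k of e_ki x e_jk, and matrix units have norm at most
    1. *)
Lemma entry_le (x : M) i j : normc (x i j) <= n.+1%:R * nrm (mu x).
Proof.
have e : (x i j)%:A = \sum_k delta_mx k i * x * delta_mx j k :> M.
  rewrite -sum_delta scaler_sumr; apply: eq_bigr => k _.
  apply/matrixP => a b; rewrite !mxE (bigD1 j) //= big1 => [|l lj].
    rewrite !mxE (bigD1 i) //= big1 => [|l li].
      rewrite !mxE !eqxx !andbT addr0 addr0.
      by case: (a == k); case: (b == k); rewrite ?mul1r ?mulr1 ?mul0r ?mulr0.
    by rewrite !mxE (negbTE li) andbF mul0r.
  by rewrite !mxE (negbTE lj) /= mulr0.
have -> : normc (x i j) = nrm (mu (x i j)%:A) by rewrite linearZ /= rmorph1 nrm_scalar.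
rewrite e raddf_sum; apply: le_trans (nrm_sum _ _ _) _.
have -> : n.+1%:R * nrm (mu x) = \sum_(k < n.+1) nrm (mu x).
  by rewrite sumr_const card_ord mulr_natl.
apply: ler_sum => k _; rewrite /= !rmorphM.
apply: le_trans (nrmM _ _) _; have h1 := nrm_delta j k.
apply: le_trans (ler_wpM2l (nrm_ge0 _) h1) _; rewrite mulr1.
apply: le_trans (nrmM _ _) _; have h2 := nrm_delta k i.
by apply: le_trans (ler_wpM2r (nrm_ge0 _) h2) _; rewrite mul1r.
Qed.

Lemma nrm_le_entries (x : M) : nrm (mu x) <= \sum_i \sum_j normc (x i j).
Proof.
rewrite {1}[x]matrix_sum_delta raddf_sum; apply: le_trans (nrm_sum _ _ _) _.
apply: ler_sum => i _; rewrite raddf_sum; apply: le_trans (nrm_sum _ _ _) _.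
apply: ler_sum => j _; rewrite /= linearZ /= nrmZ.
by rewrite ler_piMr ?normc_ge0 ?nrm_delta.
Qed.

End MatrixNorm.

Section NormUnique.
Variables (R : realType) (n : nat).
Local Notation M := 'M[R[i]]_n.+1.

Lemma nrm_pow2 (A : cstarType R) (x : calg A) k : star x = x ->
  nrm (x ^+ (2 ^ k)%N) = nrm x ^+ (2 ^ k)%N.
Proof.
move=> xs; have xsk m : star (x ^+ m) = x ^+ m.
  by elim: m => [|m IH]; rewrite ?expr0 ?star1 // exprS starM IH xs -exprSr exprS.
elim: k => [|k IH]; first by rewrite expn0 !expr1.
by rewrite expnSr !exprM expr2 -{1}[x ^+ _]xsk nrm_sqr IH.
Qed.

(* Both norms are dominated by each other up to a constant, which disappears
   on applying this to the powers of a self-adjoint matrix. *)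
Lemma mx_nrm_unique (A B : cstarType R) (mu : {lrmorphism M -> calg A})
    (nu : {lrmorphism M -> calg B}) : star_preserving mu -> star_preserving nu ->
  forall x, nrm (mu x) = nrm (nu x).
Proof.
suff H (A' B' : cstarType R) (f : {lrmorphism M -> calg A'}) (g : {lrmorphism M -> calg B'}) :
    star_preserving f -> star_preserving g -> forall x, nrm (f x) <= nrm (g x).
  by move=> h1 h2 x; apply/le_anti; rewrite !H.
move=> hf hg x; pose C : R := n.+1%:R * (n.+1%:R * n.+1%:R).
have C0 : 0 <= C by rewrite !mulr_ge0.
have dom y : nrm (f y) <= C * nrm (g y).
  apply: le_trans (nrm_le_entries hf y) _.
  have -> : C * nrm (g y) = \sum_(i < n.+1) \sum_(j < n.+1) (n.+1%:R * nrm (g y)).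
    have sc (c : R) : \sum_(i < n.+1) c = n.+1%:R * c.
      by rewrite sumr_const card_ord mulr_natl.
    by rewrite !sc /C !mulrA.
  by apply: ler_sum => i _; apply: ler_sum => j _; exact: entry_le.
have sa y : star y = y -> nrm (f y) <= nrm (g y).
  move=> ys; apply: (pow2_le (nrm_ge0 _) (nrm_ge0 _) C0) => k.
  have fs : star (f y) = f y by rewrite -hf ys.
  have gs : star (g y) = g y by rewrite -hg ys.
  by rewrite -(nrm_pow2 k fs) -(nrm_pow2 k gs) -!rmorphXn dom.
rewrite -(ler_pXn2r (n := 2)) ?nnegrE ?nrm_ge0 //.
rewrite -!nrm_sqr -hf -hg -!rmorphM; apply: sa.
by rewrite starM starK.
Qed.

End NormUnique.

(** * The universal property and density of the union *)

Section InductiveLimit.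
Variables (R : realType) (n : nat -> nat).
Local Notation M := (fun s : nat => ('M[R[i]]_((n s).+1) : starAlgType R[i])).
Variable phi : forall s, {lrmorphism M s -> M s.+1}.

(** Replaces the composite bonding map from stage [s] to stage [t] by the mere existence of an
    element with the right images under both cocones, which spares transports between matrix
    sizes. *)
Lemma push (A B : cstarType R) (mu : forall s, {lrmorphism M s -> calg A})
    (nu : forall s, {lrmorphism M s -> calg B}) :
  cocone (M := M) phi mu -> cocone (M := M) phi nu ->
  forall s t (z : M s), (s <= t)%N -> exists z' : M t, mu t z' = mu s z /\ nu t z' = nu s z.
Proof.
move=> [_ hmu] [_ hnu] s t z; elim: t => [|t IH].
  by rewrite leqn0 => /eqP e; move: z; rewrite e => z; exists z.
rewrite leq_eqVlt => /orP[/eqP e|le]; first by move: z IH; rewrite e => z _; exists z.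
have [z' [h1 h2]] := IH le; exists (phi t z').
by rewrite (hmu t) (hnu t).
Qed.

Lemma push2 (A B : cstarType R) (mu : forall s, {lrmorphism M s -> calg A})
    (nu : forall s, {lrmorphism M s -> calg B}) :
  cocone (M := M) phi mu -> cocone (M := M) phi nu ->
  forall s t (z : M s) (w : M t), exists u (z' w' : M u),
    [/\ mu u z' = mu s z, nu u z' = nu s z, mu u w' = mu t w & nu u w' = nu t w].
Proof.
move=> hmu hnu s t z w; exists (maxn s t).
have [z' [h1 h2]] := push hmu hnu z (leq_maxl s t).
have [w' [h3 h4]] := push hmu hnu w (leq_maxr s t).
by exists z', w'.
Qed.

(** The map [mu s z] |-> [nu s z] on the union is isometric because a matrix algebra has only one
    C*-norm, so it extends; the extension is unique by automatic continuity and density. *)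
Lemma dense_inductive_limit (A : cstarType R) (mu : forall s, {lrmorphism M s -> calg A}) :
  cocone (M := M) phi mu ->
  (forall (x : calg A) e, 0 < e -> exists s (z : M s), nrm (x - mu s z) < e) ->
  is_inductive_limit (M := M) phi A.
Proof.
move=> hmu dmu; exists mu => // B nu hnu; split; last first.
  move=> h h' hs hE hs' hE' x; apply/eqP; rewrite -subr_eq0; apply/eqP/nrm_eq0/le_anti.
  rewrite nrm_ge0 andbT; apply/ler_addgt0Pr => e e0; rewrite add0r.
  (* 16 = 8 + 8, the bounds of [hom_bounded] for [h] and [h']. *)
  have [s [z hz]] := dmu x (e / 16) ltac:(lra).
  apply: le_trans (nrm_triangle (nu s z) _ _) _.
  have e1 : h x - nu s z = h (x - mu s z) by rewrite raddfB /= hE.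
  have e2 : nrm (nu s z - h' x) = nrm (h' (x - mu s z)) by rewrite nrmBC raddfB /= hE'.
  rewrite e1 e2; have := hom_bounded hs (x - mu s z); have := hom_bounded hs' (x - mu s z); lra.
pose G (x : calg A) (y : calg B) := exists s (z : M s), x = mu s z /\ y = nu s z.
have [||||||h [hs hG _]] := @extend_hom R A B G.
- move=> _ _ _ _ [s [z [-> ->]]] [t [w [-> ->]]].
  have [u [z' [w' [<- <- <- <-]]]] := push2 hmu hnu z w.
  by exists u, (z' - w'); rewrite !raddfB.
- move=> _ _ _ _ [s [z [-> ->]]] [t [w [-> ->]]].
  have [u [z' [w' [<- <- <- <-]]]] := push2 hmu hnu z w.
  by exists u, (z' * w'); rewrite !rmorphM.
- move=> _ _ [s [z [-> ->]]]; exists s, (star z).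
  by rewrite (proj1 hmu) (proj1 hnu).
- move=> c e e0; exists c%:A, c%:A; rewrite !subrr !nrm0; split=> //.
  by exists 0%N, c%:A; rewrite !linearZ /= !rmorph1.
- move=> _ _ [s [z [-> ->]]].
  by rewrite (mx_nrm_unique (proj1 hmu s) (proj1 hnu s)).
- move=> x e e0; have [s [z hz]] := dmu x e e0.
  by exists (mu s z), (nu s z); split=> //; exists s, z.
by exists h; split=> // s z; apply: hG; exists s, z.
Qed.

Lemma pval_union (A : cstarType R) (mu : forall s, {lrmorphism M s -> calg A})
    (a : nat -> A) : cocone (M := M) phi mu ->
  (forall k, exists s (z : M s), (a k : calg A) = mu s z) ->
  forall p, exists s (z : M s), pval a p = mu s z.
Proof.
move=> hmu ha p; rewrite /pval.
elim: (pdec p) => [m k|k|q [s [z IH]]|q [s [z IH]] q' [t [w IH']]|q [s [z IH]] q' [t [w IH']]] /=.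
- by exists 0%N, (ratr (rat_of_code m) + 'i * ratr (rat_of_code k))%:A; rewrite linearZ /= rmorph1.
- exact: ha.
- by exists s, (star z); rewrite IH (proj1 hmu).
- have [u [z' [w' [e1 _ e2 _]]]] := push2 hmu hmu z w.
  by exists u, (z' + w'); rewrite IH IH' -e1 -e2 raddfD.
- have [u [z' [w' [e1 _ e2 _]]]] := push2 hmu hmu z w.
  by exists u, (z' * w'); rewrite IH IH' -e1 -e2 rmorphM.
Qed.

(* The universal property maps [A] to the completion of the union of the
   [mu s (M s)]; composed with the inclusion this is the identity of [A]. *)
Lemma inductive_limit_dense (A : cstarType R) : is_inductive_limit (M := M) phi A ->
  exists2 mu : forall s, {lrmorphism M s -> calg A}, cocone (M := M) phi mu &
    forall (x : calg A) e, 0 < e -> exists s (z : M s), nrm (x - mu s z) < e.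
Proof.
move=> [mu hmu univ]; exists mu => //.
(* The images of all matrix units of all stages serve as special points; [inord] sends indices out
   of range to 0. *)
pose a (k : nat) : A := mu (nfst k) (delta_mx (inord (nfst (nsnd k))) (inord (nsnd (nsnd k)))).
pose Hs := calg_seminorm a; pose C := compl_alg Hs.
pose G (x : calg C) (y : calg A) := exists p, x = pval (compl_gen Hs) p /\ y = pval a p.
have Gn x y : G x y -> nrm y = nrm x by move=> [p [-> ->]]; rewrite nrm_compl.
have [||||||iota [is_ iG ile]] := @extend_hom R C A G.
- by move=> _ _ _ _ [p [-> ->]] [q [-> ->]]; exists (psub p q); rewrite !pval_sub.
- by move=> _ _ _ _ [p [-> ->]] [q [-> ->]]; exists (pmul p q); rewrite !pval_mul.
- by move=> _ _ [p [-> ->]]; exists (pstar p); rewrite !pval_star.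
- move=> c e e0; have [m [k hmk]] := cst_approx c e0.
  exists (pval (compl_gen Hs) (pconst m k)), (pval a (pconst m k)).
  by rewrite !pval_const -!scalerBl !nrm_scalar; split=> //; exists (pconst m k); rewrite !pval_const.
- by move=> x y /Gn ->.
- move=> x e e0; have [p hp] := proj1 (presentation_pval _) (@compl_presentation _ _ Hs) x e e0.
  by exists (pval (compl_gen Hs) p), (pval a p); split=> //; exists p.
(* [iota] preserves the norm of generated points, which are dense in [C]; being isometric, it allows
   identities in [C] to be checked in [A]. *)
have iiso x : nrm (iota x) = nrm x.
  apply/le_anti; rewrite ile /=; apply/ler_addgt0Pr => e e0.
  have [p hp] := proj1 (presentation_pval _) (@compl_presentation _ _ Hs) x (e / 2) ltac:(lra).
  set y := pval _ p in hp; have gy : G y (pval a p) by exists p.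
  have h1 := nrm_le_dist x y; have h2 := nrm_le_dist (iota y) (iota x).
  rewrite nrmBC -raddfB /= in h2; have h3 := ile (x - y).
  by move: h2; rewrite (iG _ _ gy) (Gn _ _ gy); lra.
have iinj x y : iota x = iota y -> x = y.
  move=> e; apply/eqP; rewrite -subr_eq0; apply/eqP/nrm_eq0.
  by rewrite -iiso raddfB /= e subrr nrm0.
pose idx s (i j : 'I_(n s).+1) := npair s (npair i j).
pose f s (z : M s) : calg C := \sum_i \sum_j z i j *: (compl_gen Hs (idx s i j) : calg C).
have ifE s (z : M s) : iota (f s z) = mu s z.
  rewrite /f raddf_sum [z in RHS]matrix_sum_delta raddf_sum; apply: eq_bigr => i _.
  rewrite /= !raddf_sum; apply: eq_bigr => j _; rewrite /= !linearZ /=; congr (_ *: _).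
  have -> : (compl_gen Hs (idx s i j) : calg C) = pval (compl_gen Hs) (encode_poly (PVar (idx s i j))).
    by rewrite pval_encode.
  rewrite (iG _ _ (ex_intro _ _ (conj erefl erefl))) pval_encode /= /a /idx !npE.
  by rewrite !inord_val.
have nu_ex s : exists nu : {lrmorphism M s -> calg C}, nu =1 f s.
  apply: lrmorphism_pack => [x y||x y|c x]; apply: iinj.
  - by rewrite [RHS]raddfB /= !ifE raddfB.
  - by rewrite ifE !rmorph1 //.
  - by rewrite [RHS]rmorphM /= !ifE rmorphM.
  - by rewrite [RHS]linearZ /= !ifE linearZ.
pose nu s := projT1 (cid (nu_ex s)).
have nuE s z : iota (nu s z) = mu s z by rewrite /nu (projT2 (cid (nu_ex s))) ifE.
have hnu : cocone (M := M) phi nu.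
  split=> [s z|s z]; apply: iinj; first by rewrite is_ !nuE (proj1 hmu).
  by rewrite !nuE (proj2 hmu).
have [[h [hs hE]] _] := univ C nu hnu.
have [_ uniq] := univ A mu hmu.
have key : iota \o h =1 idfun.
  apply: uniq => //.
  - by move=> x; rewrite /= hs is_.
  - by move=> s z; rewrite /= hE nuE.
move=> x e e0.
have [p hp] := proj1 (presentation_pval _) (@compl_presentation _ _ Hs) (h x) e e0.
have [s [z hz]] : exists s (z : M s), pval a p = mu s z.
  by apply: (pval_union hmu) => k; exists (nfst k); eexists; reflexivity.
exists s, z; rewrite -hz -[x]key /= -(iG _ _ (ex_intro _ p (conj erefl erefl))) -raddfB.
exact: le_lt_trans (ile _) hp.
Qed.

End InductiveLimit.

(** * Approximate matrix units *)

Section ApproxUnits.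
Variables (R : realType) (A : cstarType R).

Definition approx_units (n : nat) (x : nat -> nat -> calg A) (e : R) : Prop :=
  [/\ forall i j, (i < n)%N -> (j < n)%N -> nrm (star (x i j) - x j i) <= e,
      forall i j k l, (i < n)%N -> (j < n)%N -> (k < n)%N -> (l < n)%N ->
        nrm (x i j * x k l - (if j == k then x i l else 0)) <= e &
      nrm (\sum_(i < n) x i i - 1) <= e].

Lemma nrm_swap (a b c : calg A) (e f : R) : nrm (a - b) <= e -> nrm (b - c) <= f ->
  nrm (a - c) <= e + f.
Proof. by move=> h1 h2; apply: le_trans (nrm_triangle b _ _) _; exact: lerD. Qed.

Lemma nrm_mul_near (a a' b b' : calg A) (e f p q : R) : nrm (a - a') <= e ->
  nrm (b - b') <= f -> nrm b <= p -> nrm a' <= q -> nrm (a * b - a' * b') <= e * p + q * f.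
Proof.
move=> h1 h2 h3 h4; apply: le_trans (nrmM_dist _ _ _ _) _.
by apply: lerD; apply: ler_pM => //; exact: nrm_ge0.
Qed.

Variables (n : nat) (x : nat -> nat -> calg A) (e : R).
Hypothesis n0 : (0 < n)%N.
Hypothesis hx : approx_units n x e.
Hypothesis e0 : 0 <= e.
Hypothesis en : 3000 * (n%:R * n%:R) * e <= 1.

Let n1 : 1 <= n%:R :> R. Proof. by rewrite ler1n. Qed.
Let nn : n%:R <= n%:R * n%:R :> R. Proof. by rewrite ler_peMl // ler0n. Qed.
Let ne : n%:R * e <= n%:R * n%:R * e. Proof. exact: ler_wpM2r. Qed.
Let e_ne : e <= n%:R * e. Proof. by rewrite ler_peMl. Qed.
Let en1 : 3000 * (n%:R * e) <= 1.
Proof. by move: en ne; rewrite -mulrA; move: (n%:R * n%:R * e) (n%:R * e) => a b; lra. Qed.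
Let e_small : 3000 * e <= 1.
Proof. by move: en1 e_ne; move: (n%:R * e) => a; lra. Qed.

Local Notation v i := (x i 0).

Let x_star i j : (i < n)%N -> (j < n)%N -> nrm (star (x i j) - x j i) <= e.
Proof. by case: hx => h _ _; exact: h. Qed.
Let x_mul i j k l : (i < n)%N -> (j < n)%N -> (k < n)%N -> (l < n)%N ->
  nrm (x i j * x k l - (if j == k then x i l else 0)) <= e.
Proof. by case: hx => _ h _; exact: h. Qed.

Let v_sqr i : (i < n)%N -> nrm (star (v i) * v i - v 0%N) <= e * nrm (v i) + e.
Proof.
move=> hi; have := x_mul n0 hi hi n0; rewrite eqxx => h.
apply: nrm_swap h; rewrite -mulrBl; apply: le_trans (nrmM _ _) _.
by rewrite ler_wpM2r ?nrm_ge0 // x_star.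
Qed.

(** The square of the norm of v_i is near the norm of v_0. For i = 0 this is a quadratic inequality
    that yields 3/2, which then controls all other i. *)
Lemma v_le i : (i < n)%N -> nrm (v i) <= 2.
Proof.
have key j b : (j < n)%N -> nrm (v 0%N) <= b -> nrm (v j) ^+ 2 <= b + (e * nrm (v j) + e).
  move=> hj hb; rewrite -nrm_sqr; apply: le_trans (nrm_le_dist _ (v 0%N)) _.
  by apply: lerD => //; exact: v_sqr.
have h0 : nrm (v 0%N) <= 3 / 2.
  rewrite leNgt; apply/negP => h; have := key 0%N _ n0 (lexx _); have := e_small.
  by move: (nrm _) h => a h h1 h2; nra.
move=> hi; rewrite leNgt; apply/negP => h; have := key i _ hi h0; have := e_small.
by move: (nrm _) h => a h h1 h2; nra.
Qed.

Lemma v_star_mul i j : (i < n)%N -> (j < n)%N ->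
  nrm (star (v i) * v j - (if i == j then v 0%N else 0)) <= 3 * e.
Proof.
move=> hi hj; have h := x_mul n0 hi hj n0.
have -> : 3 * e = e * 2 + e by ring.
apply: nrm_swap h; rewrite -mulrBl; apply: le_trans (nrmM _ _) _.
by apply: ler_pM; rewrite ?nrm_ge0 ?x_star ?v_le.
Qed.

Lemma v_mul_star i j : (i < n)%N -> (j < n)%N -> nrm (v i * star (v j) - x i j) <= 3 * e.
Proof.
move=> hi hj; have := x_mul hi n0 n0 hj; rewrite eqxx => h.
have -> : 3 * e = 2 * e + e by ring.
apply: nrm_swap h; rewrite -mulrBr; apply: le_trans (nrmM _ _) _.
by apply: ler_pM; rewrite ?nrm_ge0 ?x_star ?v_le.
Qed.

Definition half_re (z : calg A) : calg A := (2^-1 : R)%:C%C *: (z + star z).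

Lemma half_re_dist z : nrm (half_re z - z) <= nrm (star z - z).
Proof.
have -> : half_re z - z = (2^-1 : R)%:C%C *: (star z - z).
  have hz : z = (2^-1 : R)%:C%C *: (z + z).
    rewrite -{2 3}[z]scale1r -scalerDl scalerA.
    have -> : ((2^-1 : R)%:C * (1 + 1))%C = 1 :> R[i]; last by rewrite scale1r.
    by apply/eqP; rewrite eq_complex /=; apply/andP; split; apply/eqP; lra.
  rewrite {2}hz -scalerBr; congr (_ *: _).
  by rewrite opprD addrACA subrr add0r.
rewrite nrmZ normcR ger0_norm ?invr_ge0 //.
by rewrite ler_piMl ?nrm_ge0 //; lra.
Qed.

Local Notation h := (half_re (v 0%N)).

Lemma half_re_v : nrm (h - v 0%N) <= e.
Proof. by apply: le_trans (half_re_dist _) _; exact: x_star. Qed.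

Lemma half_re_sqr : nrm (h * h - h) <= 6 * e.
Proof.
have hv := half_re_v; have v0 := v_le n0.
have hh : nrm h <= 2.
  have : nrm h <= nrm (v 0%N).
    rewrite /half_re nrmZ normcR ger0_norm ?invr_ge0 //.
    by have := nrmD (v 0%N) (star (v 0%N)); rewrite nrm_star; lra.
  by move=> h1; apply: le_trans v0.
have h1 : nrm (h * h - v 0%N * v 0%N) <= 4 * e.
  have -> : 4 * e = e * 2 + 2 * e by ring.
  exact: nrm_mul_near.
have h2 := x_mul n0 n0 n0 n0; rewrite eqxx in h2.
have h3 : nrm (v 0%N - h) <= e by rewrite nrmBC.
by have := nrm_swap (nrm_swap h1 h2) h3; lra.
Qed.

Variable P : calg A.
Hypothesis Ps : star P = P.
Hypothesis PP : P * P = P.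
Hypothesis vP : nrm (v 0%N - P) <= 13 * e.

Let P1 : nrm P <= 1.
Proof.
have := nrm_sqr P; rewrite Ps PP => hP.
by have := nrm_ge0 P; nra.
Qed.

Lemma vP_dist i : (i < n)%N -> nrm (v i * P - v i) <= 27 * e.
Proof.
move=> hi; have := x_mul hi n0 n0 n0; rewrite eqxx => h1.
have -> : 27 * e = 26 * e + e by ring.
apply: nrm_swap h1; rewrite -mulrBr; apply: le_trans (nrmM _ _) _.
have -> : 26 * e = 2 * (13 * e) by ring.
by apply: ler_pM; rewrite ?nrm_ge0 ?v_le // nrmBC.
Qed.

Lemma vP_le i : (i < n)%N -> nrm (v i * P) <= 2.
Proof.
move=> hi; apply: le_trans (nrmM _ _) _; have := v_le hi; have := P1; have := nrm_ge0 P.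
have := nrm_ge0 (v i); nra.
Qed.

(** The frame operator of the vectors [v i * P]. It is near the sum of the x_ii and hence near 1, so
    that it has an inverse square root. *)
Definition gram : calg A := \sum_(i < n) (v i * P) * star (v i * P).

Lemma gram_dist : nrm (gram - 1) <= 112 * (n%:R * e).
Proof.
have sumle (F : 'I_n -> calg A) c : (forall i, nrm (F i) <= c) ->
    nrm (\sum_(i < n) F i) <= n%:R * c.
  move=> hF; apply: le_trans (nrm_sum _ _ _) _.
  by apply: le_trans (ler_sum _ (fun i _ => hF i)) _; rewrite sumr_const card_ord mulr_natl.
have h1 : nrm (gram - \sum_(i < n) x i i) <= n%:R * (111 * e).
  rewrite /gram -sumrB; apply: sumle => i.
  (* Each of the two factors moves by 27 e against a partner of norm at most 2; 3 e comes from
     [v_mul_star]. *)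
  have -> : 111 * e = 27 * e * 2 + 2 * (27 * e) + 3 * e by ring.
  apply: nrm_swap (v_mul_star (ltn_ord i) (ltn_ord i)).
  apply: nrm_mul_near; rewrite ?nrm_star ?v_le ?vP_le ?vP_dist //.
  by rewrite nrm_starB vP_dist.
have h2 : nrm (\sum_(i < n) x i i - 1) <= e by case: hx.
apply: le_trans (nrm_swap h1 h2) _; have := e_ne.
by move: e_ne; rewrite mulrCA; move: (n%:R * e) => a; lra.
Qed.

Variable T : calg A.
Hypothesis Ts : star T = T.
Hypothesis T1 : nrm (T - 1) <= 112 * (n%:R * e).
Hypothesis TST : T * gram * T = 1.

(** Normalised vectors: as [T] is an inverse square root of [gram], the sum of the
    [w i * star (w i)] is exactly 1. *)
Definition wvec i : calg A := T * (v i * P).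
Local Notation w := wvec.

Lemma w_dist i : (i < n)%N -> nrm (w i - v i) <= 251 * (n%:R * e).
Proof.
move=> hi; have h1 : nrm (w i - v i * P) <= 112 * (n%:R * e) * 2.
  rewrite /w -{2}[v i * P]mul1r -mulrBl; apply: le_trans (nrmM _ _) _.
  by apply: ler_pM; rewrite ?nrm_ge0 ?vP_le.
by have := nrm_swap h1 (vP_dist hi); have := e_ne; lra.
Qed.

Lemma w_le i : (i < n)%N -> nrm (w i) <= 3.
Proof.
move=> hi; apply: le_trans (nrm_le_dist _ (v i)) _.
by have := w_dist hi; have := v_le hi; have := en1; lra.
Qed.

Lemma w_units i j : (i < n)%N -> (j < n)%N -> nrm (x i j - w i * star (w j)) <= 1300 * (n%:R * e).
Proof.
move=> hi hj; rewrite nrmBC.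
(* 251 * 3 + 2 * 251 + 3 = 1258, rounded up to 1300. *)
have h1 : nrm (w i * star (w j) - v i * star (v j)) <=
    251 * (n%:R * e) * 3 + 2 * (251 * (n%:R * e)).
  apply: nrm_mul_near; rewrite ?nrm_star ?w_le ?v_le ?w_dist //.
  by rewrite nrm_starB w_dist.
by apply: le_trans (nrm_swap h1 (v_mul_star hi hj)) _; move: e0 e_ne; lra.
Qed.

Lemma sum_w : \sum_(i < n) w i * star (w i) = 1.
Proof.
rewrite -TST /gram mulr_sumr mulr_suml; apply: eq_bigr => i _.
by rewrite /w [star (T * _)]starM Ts !mulrA.
Qed.

Let wP i : w i * P = w i. Proof. by rewrite /w -!mulrA PP. Qed.
Let Pw i : P * star (w i) = star (w i). Proof. by rewrite -{1}Ps -starM wP. Qed.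

Let H (i j : nat) : calg A := (if i == j then P else 0) - star (w i) * w j.

(* [H] is an idempotent matrix with small entries, hence zero. *)
Let H_idem i k : (i < n)%N -> (k < n)%N -> H i k = \sum_(j < n) H i j * H j k.
Proof.
move=> hi hk.
have e1 : \sum_(j < n) (if i == j then P else 0) * (if (j : nat) == k then P else 0) =
    if i == k then P else 0.
  rewrite (bigD1 (Ordinal hi)) //= eqxx big1 => [|j /eqP ji].
    by rewrite addr0; case: eqP => _; rewrite ?PP ?mulr0.
  case: eqP => [e1|_]; last by rewrite mul0r.
  by case: ji; apply/val_inj.
have e2 : \sum_(j < n) (if i == j then P else 0) * (star (w j) * w k) = star (w i) * w k.
  rewrite (bigD1 (Ordinal hi)) //= eqxx big1 => [|j /eqP ji].
    by rewrite addr0 mulrA Pw.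
  case: eqP => [e2|_]; last by rewrite mul0r.
  by case: ji; apply/val_inj.
have e3 : \sum_(j < n) (star (w i) * w j) * (if (j : nat) == k then P else 0) = star (w i) * w k.
  rewrite (bigD1 (Ordinal hk)) //= eqxx big1 => [|j /eqP jk].
    by rewrite addr0 -mulrA wP.
  case: eqP => [e3|_]; last by rewrite mulr0.
  by case: jk; apply/val_inj.
have e4 : \sum_(j < n) (star (w i) * w j) * (star (w j) * w k) = star (w i) * w k.
  rewrite -[in RHS](mulr1 (star (w i))) -sum_w mulr_sumr mulr_suml.
  by apply: eq_bigr => j _; rewrite !mulrA.
transitivity (\sum_(j < n) ((if i == j then P else 0) * (if (j : nat) == k then P else 0) -
    (if i == j then P else 0) * (star (w j) * w k) -
    ((star (w i) * w j) * (if (j : nat) == k then P else 0) -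
    (star (w i) * w j) * (star (w j) * w k)))).
  by rewrite !sumrB e1 e2 e3 e4 subrr subr0.
by apply: eq_bigr => j _; rewrite /H mulrBl !mulrBr.
Qed.

Lemma w_orth i j : (i < n)%N -> (j < n)%N -> star (w i) * w j = if i == j then P else 0.
Proof.
(* 1271 = 251 * 3 + 2 * 251 + 3 + 13: the two replacements of [w] by [v], then [v_star_mul], then
   [vP]. *)
pose c : R := 1271 * (n%:R * e).
have c0 : 0 <= c by rewrite /c; move: e0 e_ne; lra.
(* Here 3000 >= 2 * 1271 is used. *)
have nc : n%:R * c <= 2^-1.
  have -> : n%:R * c = 1271 * (n%:R * n%:R * e) by rewrite /c; ring.
  have : 0 <= n%:R * n%:R * e by rewrite !mulr_ge0.
  by move: en; rewrite -mulrA; move: (n%:R * n%:R * e) => a; lra.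
have Hc k l : (k < n)%N -> (l < n)%N -> nrm (H k l) <= c.
  move=> hk hl; rewrite /H nrmBC.
  have h1 : nrm (star (w k) * w l - star (v k) * v l) <=
      251 * (n%:R * e) * 3 + 2 * (251 * (n%:R * e)).
    apply: nrm_mul_near; rewrite ?nrm_star ?w_le ?v_le ?w_dist //.
    by rewrite nrm_starB w_dist.
  have h2 : nrm ((if k == l then v 0%N else 0) - (if k == l then P else 0)) <= 13 * e.
    by case: eqP => // _; rewrite subrr nrm0 mulr_ge0.
  apply: le_trans (nrm_swap (nrm_swap h1 (v_star_mul hk hl)) h2) _.
  by rewrite /c; move: e0 e_ne; lra.
(* Each use of H = H^2 multiplies the bound on the entries by n c, which is at most 1/2. *)
have Ht t : forall k l, (k < n)%N -> (l < n)%N -> nrm (H k l) <= c * 2 ^- t.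
  elim: t => [|t IH] k l hk hl; first by rewrite expr0 invr1 mulr1 Hc.
  rewrite H_idem //; apply: le_trans (nrm_sum _ _ _) _.
  have p : 0 <= c * 2 ^- t by rewrite mulr_ge0 // invr_ge0 exprn_ge0.
  apply: (@le_trans _ _ (\sum_(j < n) c * (c * 2 ^- t))).
    apply: ler_sum => r _; apply: le_trans (nrmM _ _) _.
    by apply: ler_pM; rewrite ?nrm_ge0 ?Hc ?IH.
  rewrite sumr_const card_ord -[_ *+ n]mulr_natl [n%:R * _]mulrA.
  apply: (@le_trans _ _ (2^-1 * (c * 2 ^- t))); first exact: ler_wpM2r.
  by rewrite exprS invfM mulrCA.
move=> hi hj; apply/esym/eqP; rewrite -subr_eq0 -/(H i j); apply/eqP/nrm_eq0/le_anti.
rewrite nrm_ge0 andbT; apply: (@null_cst0 R).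
apply: (@null_le _ _ (fun t => c * 2 ^- t)) => [|t]; last exact: Ht.
by apply: null_scale => // d /exp2_lt[K HK]; exists K => k /HK/ltW.
Qed.

End ApproxUnits.

Section Adjoint.
Variable C : numClosedFieldType.

Definition adj (p q : nat) (X : 'M[C]_(p, q)) : 'M[C]_(q, p) := map_mx Num.conj X^T.

Lemma adjM p q r (X : 'M[C]_(p, q)) (Y : 'M[C]_(q, r)) : adj (X *m Y) = adj Y *m adj X.
Proof. by rewrite /adj trmx_mul map_mxM. Qed.

Lemma adjK p q (X : 'M[C]_(p, q)) : adj (adj X) = X.
Proof. by apply/matrixP => i j; rewrite !mxE conjCK. Qed.

Lemma adj_star n (X : 'M[C]_n.+1) : adj X = star X.
Proof. by []. Qed.

End Adjoint.

Lemma sum_divmod (V : nmodType) (n m : nat) (G : nat -> nat -> V) :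
  \sum_(a < n * m) G (a %/ m)%N (a %% m)%N = \sum_(i < n) \sum_(l < m) G i l.
Proof.
elim: n => [|n IH]; first by rewrite !big_ord0.
rewrite mulSnr big_split_ord big_ord_recr /= IH; congr (_ + _).
apply: eq_bigr => l _ /=; have lt := ltn_ord l.
by rewrite divnMDl ?(leq_ltn_trans _ lt) // divn_small // addn0 modnMDl modn_small.
Qed.

(** * Functional calculus of Hermitian matrices *)

Section Calculus.
Variables (R : realType) (N : nat).
Local Notation C := R[i].
Local Notation M := 'M[C]_N.+1.

Lemma hermitian_diag (h : M) : star h = h ->
  exists (Q : M) (d : 'I_N.+1 -> R), [/\ star Q * Q = 1, Q * star Q = 1 &
    h = star Q * diag_mx (\row_k (d k)%:C%C) * Q].
Proof.
move=> hs.
have herm : h \is hermsymmx by apply/is_hermitianmxP; rewrite expr0 scale1r.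
have /orthomx_spectralP e := hermitian_normalmx herm.
have uni := spectral_unitarymx h.
have re := hermitian_spectral_diag_real herm.
have hQ : spectralmx h *m star (spectralmx h) = 1%:M by apply/unitarymxP.
exists (spectralmx h), (fun k => complex.Re (spectral_diag h 0 k)); split=> //.
  by rewrite -mulmxE; apply: mulmx1C.
move: e; rewrite invmx_unitary // => e; apply: (eq_trans e); congr (_ *m diag_mx _ *m _).
apply/rowP => k; rewrite !mxE; have /mxOverP/(_ 0 k) := re.
rewrite realE !lecE; case: (spectral_diag h 0 k) => x y /=.
by rewrite [0 == y]eq_sym -andb_orr => /andP[/eqP ->].
Qed.

Variables (Q : M) (d : 'I_N.+1 -> R).
Hypothesis hQ1 : star Q * Q = 1.
Hypothesis hQ2 : Q * star Q = 1.

Definition rdiag (f : R -> R) : M := diag_mx (\row_k (f (d k))%:C%C).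

Lemma rdiag_ext f g : (forall k, f (d k) = g (d k)) -> rdiag f = rdiag g.
Proof. by move=> e; rewrite /rdiag; congr diag_mx; apply/rowP => k; rewrite !mxE e. Qed.

Lemma rdiagM f g : rdiag f * rdiag g = rdiag (fun x => f x * g x).
Proof.
rewrite /rdiag -mulmxE mulmx_diag; congr diag_mx.
by apply/rowP => k; rewrite !mxE rmorphM.
Qed.

Lemma rdiagB f g : rdiag f - rdiag g = rdiag (fun x => f x - g x).
Proof.
rewrite /rdiag -raddfB; congr diag_mx.
by apply/rowP => k; rewrite !mxE rmorphB.
Qed.

Lemma rdiagZ c f : rdiag (fun x => c * f x) = c%:C%C *: rdiag f.
Proof.
rewrite /rdiag -linearZ; congr diag_mx.
by apply/rowP => k; rewrite !mxE rmorphM.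
Qed.

Lemma rdiag1 : rdiag (fun=> 1) = 1.
Proof.
by apply/matrixP => i j; rewrite !mxE rmorph1.
Qed.

Lemma rdiag_star f : star (rdiag f) = rdiag f.
Proof.
rewrite -adj_star /adj /rdiag tr_diag_mx map_diag_mx; congr diag_mx.
by apply/rowP => k; rewrite !mxE; exact: conjcR.
Qed.

(** The matrix f(h) for h = Q^* diag(d) Q. *)
Definition fcalc (f : R -> R) : M := star Q * rdiag f * Q.

Lemma fcalc_ext f g : (forall k, f (d k) = g (d k)) -> fcalc f = fcalc g.
Proof. by move=> /rdiag_ext e; rewrite /fcalc e. Qed.

Lemma fcalcM f g : fcalc f * fcalc g = fcalc (fun x => f x * g x).
Proof.
by rewrite /fcalc -rdiagM -!mulrA [Q * (star Q * _)]mulrA hQ2 mul1r.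
Qed.

Lemma fcalcB f g : fcalc f - fcalc g = fcalc (fun x => f x - g x).
Proof. by rewrite /fcalc -rdiagB mulrBr mulrBl. Qed.

Lemma fcalcZ c f : fcalc (fun x => c * f x) = c%:C%C *: fcalc f.
Proof. by rewrite /fcalc rdiagZ -scalerAr -scalerAl. Qed.

Lemma fcalc1 : fcalc (fun=> 1) = 1.
Proof. by rewrite /fcalc rdiag1 mulr1. Qed.

Lemma fcalc_star f : star (fcalc f) = fcalc f.
Proof. by rewrite /fcalc !starM starK rdiag_star mulrA. Qed.

Lemma fcalc_conj f : Q * fcalc f * star Q = rdiag f.
Proof. by rewrite /fcalc !mulrA hQ2 mul1r -mulrA hQ2 mulr1. Qed.

(** The vectors are the columns of Q^* whose eigenvalues satisfy [p]: an orthonormal basis of the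
    range of a spectral projection. *)
Lemma fcalc_proj (p : R -> bool) : exists m (b : nat -> 'cV[C]_N.+1),
  (forall l l', (l < m)%N -> (l' < m)%N -> adj (b l) *m b l' = (l == l')%:R%:M) /\
  \sum_(l < m) b l *m adj (b l) = fcalc (fun x => if p x then 1 else 0).
Proof.
pose s := enum [pred k | p (d k)].
pose b l : 'cV[C]_N.+1 := col (nth ord0 s l) (star Q).
have bE k : adj (col k (star Q)) = row k Q.
  by apply/matrixP => i j; rewrite !mxE conjCK.
exists (size s), b; split=> [l l' hl hl'|].
  rewrite bE.
  apply/matrixP => i j; rewrite !mxE.
  have := congr1 (fun X : M => X (nth ord0 s l) (nth ord0 s l')) hQ2.
  rewrite -mulmxE !mxE (nth_uniq ord0 hl hl' (enum_uniq _)) => <-.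
  by rewrite (ord1 i) (ord1 j) eqxx mulr1n; apply: eq_bigr => k _; rewrite /b !mxE.
transitivity (\sum_(k <- s) col k (star Q) *m row k Q).
  by rewrite (big_nth ord0) big_mkord; apply: eq_bigr => l _; rewrite bE.
rewrite big_enum /=.
rewrite /fcalc -!mulmxE; apply/matrixP => i j; rewrite summxE !mxE.
rewrite big_mkcond /=; apply: eq_bigr => k _.
rewrite mul_mx_diag !mxE inE /=; case: (p (d k)); last first.
  by rewrite (_ : 0%:C%C = 0 :> C) // mulr0 mul0r.
by rewrite (_ : 1%:C%C = 1 :> C) // mulr1 big_ord1 !mxE.
Qed.

Opaque fcalc rdiag.

Section FcalcNorm.
Variables (A : cstarType R) (mu : {lrmorphism M -> calg A}).
Hypothesis mus : star_preserving mu.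

Let muM X Y : mu (X * Y) = mu X * mu Y. Proof. exact: rmorphM. Qed.

(** With r = sqrt(1 - g^2), the matrices g(h) and r(h) satisfy the circle relation, so the bound
    holds in every C*-algebra that receives the matrices. *)
Lemma fcalc_le1 g : (forall k, `|g (d k)| <= 1) -> nrm (mu (fcalc g)) <= 1.
Proof.
move=> g1.
have [r hr] : exists r : R -> R, forall k, r (d k) * r (d k) = 1 - g (d k) * g (d k).
  exists (fun x => Num.sqrt (1 - g x * g x)) => k; rewrite -expr2 sqr_sqrtr //.
  by move: (g1 k); rewrite ler_norml => /andP[]; move: (g (d k)) => t; nra.
have ss f : star (mu (fcalc f)) = mu (fcalc f) by rewrite -mus fcalc_star.
have c1 : fcalc r * fcalc g = fcalc g * fcalc r.
  by rewrite !fcalcM; apply: fcalc_ext => k; rewrite mulrC.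
have c2 : fcalc g * fcalc g + fcalc r * fcalc r = 1.
  have -> : fcalc r * fcalc r = 1 - fcalc g * fcalc g.
    by rewrite !fcalcM -fcalc1 fcalcB; exact: fcalc_ext.
  by rewrite addrC subrK.
apply: (selfadj_circle (ss g) (ss r)).
  exact: (etrans (esym (muM _ _)) (etrans (congr1 mu c1) (muM _ _))).
have c3 := etrans (congr1 mu c2) (rmorph1 mu).
exact: (etrans (congr2 +%R (esym (muM _ _)) (esym (muM _ _))) (etrans (esym (raddfD mu _ _)) c3)).
Qed.

Lemma fcalc_le f c : 0 <= c -> (forall k, `|f (d k)| <= c) -> nrm (mu (fcalc f)) <= c.
Proof.
(* Division is by c + e, since [c] may vanish. *)
move=> c0 fc; apply/ler_addgt0Pr => e e0; have ce : 0 < c + e by lra.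
have [g gE] : exists g : R -> R, forall x, g x = (c + e)^-1 * f x by eexists.
have g1 k : `|g (d k)| <= 1.
  rewrite gE normrM gtr0_norm ?invr_gt0 // mulrC ler_pdivrMr // mul1r.
  by apply: le_trans (fc k) _; lra.
have -> : fcalc f = (c + e)%:C%C *: fcalc g.
  by rewrite -fcalcZ; apply: fcalc_ext => k; rewrite gE mulrA mulfV ?mul1r // gt_eqF.
rewrite linearZ /= nrmZ normcR gtr0_norm //.
by rewrite ler_piMr ?fcalc_le1 // ltW.
Qed.

(** After conjugation by the unitary [Q], the matrix unit e_kk is an eigenvector for left
    multiplication, with eigenvalue f(d_k). *)
Lemma fcalc_ge f k : `|f (d k)| <= nrm (mu (fcalc f)).
Proof.
have nQ : nrm (mu Q) = 1.
  have := nrm_sqr (mu Q); rewrite -mus -rmorphM hQ1 rmorph1 nrm1 => /esym/eqP.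
  by rewrite sqrf_eq1 => /orP[/eqP //|/eqP hm]; have := nrm_ge0 (mu Q); rewrite hm; lra.
have h1 : nrm (mu (rdiag f)) <= nrm (mu (fcalc f)).
  rewrite -fcalc_conj (muM (Q * fcalc f)) (muM Q) mus.
  apply: le_trans (nrmM _ _) _; rewrite nrm_star nQ mulr1.
  by apply: le_trans (nrmM _ _) _; rewrite nQ mul1r.
have e2 : rdiag f * delta_mx k k = (f (d k))%:C%C *: delta_mx k k :> M.
  by rewrite -mulmxE; apply/matrixP => a b; rewrite mul_diag_mx !mxE;
     case: (eqVneq a k) => [->|_]; rewrite ?mulr0.
have dn : 0 < nrm (mu (delta_mx k k)).
  rewrite lt_neqAle nrm_ge0 andbT eq_sym; apply/eqP => h.
  have := entry_le mus (delta_mx k k) k k; rewrite h mulr0 mxE !eqxx /= expr1n expr0n /= addr0 sqrtr1.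
  by rewrite ler10.
rewrite -(ler_pM2r dn); have := congr1 (fun z => nrm (mu z)) e2.
rewrite linearZ /= nrmZ normcR => <-; rewrite muM.
apply: le_trans (nrmM _ _) _; exact: ler_wpM2r (ltW dn) _ _ h1.
Qed.

End FcalcNorm.

End Calculus.

(** The interface of [fcalc] without the diagonalising unitary. [calc_le] and [calc_ge] together say
    that the image of f(h) has norm equal to the largest |f(d_k)|. *)
Record calculus (R : realType) (N : nat) (h : 'M[R[i]]_N.+1) (d : 'I_N.+1 -> R)
    (F : (R -> R) -> 'M[R[i]]_N.+1) : Prop := {
  calcM : forall f g, F f * F g = F (fun x => f x * g x);
  calcB : forall f g, F f - F g = F (fun x => f x - g x);
  calc1 : F (fun=> 1) = 1;
  calc_id : F (fun x => x) = h;
  calc_star : forall f, star (F f) = F f;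
  calc_ext : forall f g, (forall k, f (d k) = g (d k)) -> F f = F g;
  calc_le : forall (A : cstarType R) (mu : {lrmorphism 'M[R[i]]_N.+1 -> calg A}),
    star_preserving mu -> forall f c, 0 <= c -> (forall k, `|f (d k)| <= c) ->
    nrm (mu (F f)) <= c;
  calc_ge : forall (A : cstarType R) (mu : {lrmorphism 'M[R[i]]_N.+1 -> calg A}),
    star_preserving mu -> forall f k, `|f (d k)| <= nrm (mu (F f));
  calc_proj : forall p : R -> bool, exists m (b : nat -> 'cV[R[i]]_N.+1),
    (forall l l', (l < m)%N -> (l' < m)%N -> adj (b l) *m b l' = (l == l')%:R%:M) /\
    \sum_(l < m) b l *m adj (b l) = F (fun x => if p x then 1 else 0)
}.

Lemma spectral_calculus (R : realType) (N : nat) (h : 'M[R[i]]_N.+1) : star h = h ->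
  exists d F, calculus h d F.
Proof.
move=> /hermitian_diag[Q [d [q1 q2 hd]]]; exists d, (fcalc Q d); split.
- exact: fcalcM.
- exact: fcalcB.
- exact: fcalc1.
- by rewrite hd.
- exact: fcalc_star.
- exact: fcalc_ext.
- by move=> A mu mus f c c0; exact: fcalc_le.
- by move=> A mu mus f k; exact: fcalc_ge.
- exact: fcalc_proj.
Qed.

(** 1 / sqrt t - 1 = - (t - 1) / (sqrt t (sqrt t + 1)), and the denominator is at least 3/4 * 7/4 >
    1 because t >= 3/4. *)
Lemma inv_sqrt_near (R : realType) (t c : R) : 4 * c <= 1 -> `|t - 1| <= c ->
  (Num.sqrt t)^-1 * t * (Num.sqrt t)^-1 = 1 /\ `|(Num.sqrt t)^-1 - 1| <= c.
Proof.
move=> c1 tc; have t0 : 3 / 4 <= t by move: tc; rewrite ler_norml => /andP[]; lra.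
have : Num.sqrt t * Num.sqrt t = t by rewrite -expr2 sqr_sqrtr //; lra.
have := sqrtr_ge0 t; move: (Num.sqrt t) => s s0 ss.
have s1 : 3 / 4 <= s by nra.
have sn : s != 0 by apply/eqP; lra.
have s1n : s + 1 != 0 by apply/eqP; lra.
have ip : 0 < s^-1 by rewrite invr_gt0; lra.
have jp : 0 < (s + 1)^-1 by rewrite invr_gt0; lra.
have is1 := mulVf sn; have js1 := mulVf s1n.
split; first by rewrite -ss mulrA is1 mul1r mulfV.
have -> : s^-1 - 1 = - ((t - 1) * (s^-1 * (s + 1)^-1)).
  by rewrite -ss; field; rewrite sn s1n.
rewrite normrN normrM; apply: le_trans tc; rewrite ler_piMr // gtr0_norm ?mulr_gt0 //.
move: (s^-1) (s + 1)^-1 ip jp is1 js1 => u v u0 v0 us vs.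
have u1 : u <= 4 / 3 by nra.
have v1 : v <= 4 / 7 by nra.
by nra.
Qed.

(** * Stability of matrix units inside a matrix algebra *)

Section MatrixStability.
Variables (R : realType) (N : nat).
Local Notation C := R[i].
Local Notation M := 'M[C]_N.+1.
Variables (A : cstarType R) (mu : {lrmorphism M -> calg A}).
Hypothesis mus : star_preserving mu.

Let muM X Y : mu (X * Y) = mu X * mu Y. Proof. exact: rmorphM. Qed.

(** Lets relations between matrices be verified in [A], where the norm estimates live, and then be
    pulled back. *)
Lemma mx_hom_inj (X Y : M) : mu X = mu Y -> X = Y.
Proof.
move=> e; have e0 : mu (X - Y) = 0 by rewrite raddfB /= e subrr.
apply/matrixP => i j; apply/eqP; rewrite -subr_eq0; apply/eqP/eq0_normc/le_anti.
rewrite normc_ge0 andbT; have := entry_le mus (X - Y) i j.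
by rewrite e0 nrm0 mulr0 !mxE.
Qed.

Definition full_units (k : nat) (u : nat -> nat -> M) : Prop :=
  [/\ forall a b, star (u a b) = u b a,
      forall a b c d, (a < k)%N -> (b < k)%N -> (c < k)%N -> (d < k)%N ->
        u a b * u c d = if b == c then u a d else 0,
      \sum_(a < k) u a a = 1 &
      forall X, exists f : nat -> nat -> C,
        X = \sum_(a < k) \sum_(b < k) f a b *: u a b].

(** [P] is the spectral projection of the real part of [v] for the interval above 1/2. An eigenvalue
    t has |t| |t - 1| <= 6 e with one factor at least 1/2, so it lies within 12 e of 0 or 1; the
    distance of [v] from its real part adds e. *)
Lemma near_projection (v : M) (e : R) : 0 <= e -> 300 * e <= 1 ->
  nrm (half_re (mu v) - mu v) <= e ->
  nrm (half_re (mu v) * half_re (mu v) - half_re (mu v)) <= 6 * e ->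
  exists (P : M) (m : nat) (b : nat -> 'cV[C]_N.+1),
  [/\ star P = P, P * P = P, nrm (mu v - mu P) <= 13 * e,
      forall l l', (l < m)%N -> (l' < m)%N -> adj (b l) *m b l' = (l == l')%:R%:M &
      \sum_(l < m) b l *m adj (b l) = P].
Proof.
move=> e0 e1 hv hsq.
have [h [hs hE]] : exists h : M, star h = h /\ mu h = half_re (mu v).
  exists ((2^-1 : R)%:C%C *: (v + star v)); split.
    by rewrite starZ conjcR starD starK addrC.
  by rewrite /half_re linearZ /= raddfD /= mus.
have [d [F cF]] := spectral_calculus hs.
pose chi (x : R) : R := if 2^-1 < x then 1 else 0.
have hh : h * h = F (fun x => x * x) by rewrite -[in LHS](calc_id cF) (calcM cF).
have dd k : `|d k * d k - d k| <= 6 * e.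
  have e2 : F (fun x => x * x - x) = h * h - h.
    by rewrite hh -[in RHS](calc_id cF) (calcB cF).
  have := calc_ge cF mus (fun x => x * x - x) k; rewrite e2 raddfB /= muM hE.
  by move=> le; apply: le_trans hsq.
have dchi k : `|d k - chi (d k)| <= 12 * e.
  have := dd k; rewrite /chi; case: ltP => hk; rewrite !ler_norml => /andP[];
  move: (d k) hk => t *; apply/andP; split; nra.
have [m [b [hb sb]]] := calc_proj cF (fun x => 2^-1 < x).
exists (F chi), m, b; split=> //.
- exact: calc_star cF _.
- rewrite (calcM cF); apply: (calc_ext cF) => k; rewrite /chi.
  by case: ifP => _; rewrite ?mulr1 ?mulr0.
- have -> : 13 * e = e + 12 * e by ring.
  have e2 : F (fun x => x - chi x) = h - F chi.
    by rewrite -[in RHS](calc_id cF) (calcB cF).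
  have e3 : nrm (mu h - mu (F chi)) <= 12 * e.
    by rewrite -raddfB -e2; apply: (calc_le cF) => //; rewrite mulr_ge0.
  by apply: (nrm_swap _ e3); rewrite hE nrmBC.
Qed.

Lemma near_inv_sqrt (S : M) (c : R) : star S = S -> 4 * c <= 1 -> nrm (mu S - 1) <= c ->
  exists T : M, [/\ star T = T, T * S * T = 1 & nrm (mu T - 1) <= c].
Proof.
move=> Ss c1 hS; have c0 := le_trans (nrm_ge0 _) hS.
have [d [F cF]] := spectral_calculus Ss.
have d1 k : `|d k - 1| <= c.
  have e2 : F (fun x => x - 1) = S - 1.
    by rewrite -(calc1 cF) -[in RHS](calc_id cF) (calcB cF).
  have := calc_ge cF mus (fun x => x - 1) k; rewrite e2 raddfB /= rmorph1.
  by move=> le; apply: le_trans hS.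
exists (F (fun x => (Num.sqrt x)^-1)); split.
- exact: calc_star cF _.
- rewrite -[in LHS](calc_id cF) !(calcM cF) -(calc1 cF); apply: (calc_ext cF) => k.
  exact: (inv_sqrt_near c1 (d1 k)).1.
- have e2 : F (fun x => (Num.sqrt x)^-1) - 1 = F (fun x => (Num.sqrt x)^-1 - 1).
    by rewrite -(calc1 cF) (calcB cF).
  have e3 : nrm (mu (F (fun x => (Num.sqrt x)^-1 - 1))) <= c; last first.
    by move: e3; rewrite -e2 raddfB /= rmorph1.
  by apply: (calc_le cF) => // k; exact: (inv_sqrt_near c1 (d1 k)).2.
Qed.

Section Basis.
Variables (n m : nat) (P : M) (W : nat -> M) (b : nat -> 'cV[C]_N.+1).
Hypothesis hb : forall l l', (l < m)%N -> (l' < m)%N -> adj (b l) *m b l' = (l == l')%:R%:M.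
Hypothesis sb : \sum_(l < m) b l *m adj (b l) = P.
Hypothesis hW : forall i j, (i < n)%N -> (j < n)%N ->
  star (W i) *m W j = if i == j then P else 0.
Hypothesis sW : \sum_(i < n) W i *m star (W i) = 1.
Hypothesis WP : forall i, W i *m P = W i.

Let c a : 'cV[C]_N.+1 := W (a %/ m) *m b (a %% m).
Let u a a' : M := c a *m adj (c a').

Let Pb l : (l < m)%N -> P *m b l = b l.
Proof.
move=> hl; rewrite -sb mulmx_suml (bigD1 (Ordinal hl)) //= big1 => [|k kl].
  by rewrite addr0 -mulmxA hb // eqxx mulmx1.
rewrite -mulmxA hb // (_ : (k == l :> nat) = false) ?mulmx0 //; last first.
  by apply: contraNF kl => /eqP e; apply/eqP/val_inj.
by rewrite mul_mx_scalar scale0r.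
Qed.

Let c_orth a a' : (a < n * m)%N -> (a' < n * m)%N -> adj (c a) *m c a' = (a == a')%:R%:M.
Proof.
move=> ha ha'.
have m0 : (0 < m)%N by case: (m) ha; rewrite ?muln0.
have hi : (a %/ m < n)%N by rewrite ltn_divLR.
have hi' : (a' %/ m < n)%N by rewrite ltn_divLR.
have hl : (a %% m < m)%N by rewrite ltn_mod.
have hl' : (a' %% m < m)%N by rewrite ltn_mod.
rewrite /c adjM -mulmxA [adj (W _) *m _]mulmxA adj_star hW //.
have -> : (a == a') = (a %/ m == a' %/ m)%N && (a %% m == a' %% m)%N.
  apply/eqP/andP => [->|[/eqP e1 /eqP e2]] //.
  by rewrite (divn_eq a m) (divn_eq a' m) e1 e2.
case: eqP => _ /=; first by rewrite Pb ?hb.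
rewrite mul0mx mulmx0; apply/matrixP => i j; by rewrite !mxE mul0rn.
Qed.

Let sum_c : \sum_(a < n * m) u a a = 1.
Proof.
have -> : \sum_(a < n * m) u a a = \sum_(i < n) \sum_(l < m)
    (W i *m b l *m adj (W i *m b l))  by
  exact: (sum_divmod n m (fun i l => W i *m b l *m adj (W i *m b l))).
rewrite -sW; apply: eq_bigr => i _.
under eq_bigr do rewrite adjM adj_star mulmxA -[W i *m b _ *m adj _]mulmxA.
by rewrite -mulmx_suml -mulmx_sumr sb WP.
Qed.

Lemma basis_full_units : full_units (n * m) u.
Proof.
split=> [a a'|a a' d d' ha ha' hd hd'||X].
- by rewrite -adj_star /u adjM adjK.
- rewrite -mulmxE /u mulmxA -[c a *m adj (c a') *m c d]mulmxA c_orth //.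
  case: eqP => _; first by rewrite mulmx1.
  by rewrite mul_mx_scalar scale0r mul0mx.
- exact: sum_c.
(* The coefficients come from X = 1 X 1, with both units expanded in the basis. *)
- exists (fun a a' => (adj (c a) *m X *m c a') 0 0).
  have e1 : X = (\sum_(a < n * m) u a a) *m X *m (\sum_(a < n * m) u a a).
    by rewrite sum_c !mulmxE mul1r mulr1.
  rewrite {1}e1 !mulmx_suml; apply: eq_bigr => a _; rewrite mulmx_sumr; apply: eq_bigr => a' _.
  have e2 (p q : nat) (Y : 'M[C]_(p, 1)) (Z : 'M[C]_1) (V : 'M[C]_(1, q)) :
      Y *m Z *m V = Z 0 0 *: (Y *m V).
    by rewrite {1}[Z]mx11_scalar mul_mx_scalar scalemxAl.
  rewrite /u -e2 !mulmxA //.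
Qed.

Lemma basis_refine i j : (i < n)%N -> (j < n)%N -> (0 < m)%N ->
  \sum_(l < m) u (i * m + l) (j * m + l) = W i *m star (W j).
Proof.
move=> hi hj m0.
have e k (l : 'I_m) : c (k * m + l) = W k *m b l.
  by rewrite /c divnMDl // divn_small // addn0 modnMDl modn_small.
under eq_bigr do rewrite /u !e adjM adj_star mulmxA -[W i *m b _ *m adj _]mulmxA.
by rewrite -mulmx_suml -mulmx_sumr sb WP.
Qed.

(** Each [u a a] has trace 1, and they sum to the identity. *)
Lemma basis_size : (n * m)%N = N.+1.
Proof.
have tr1 (a : 'I_(n * m)) : \tr (u a a) = 1.
  by rewrite /u mxtrace_mulC c_orth // eqxx mxtrace1.
have := congr1 mxtrace sum_c; rewrite raddf_sum /= (eq_bigr _ (fun a _ => tr1 a)).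
rewrite sumr_const card_ord (mxtrace1 _ N.+1) => /eqP.
by rewrite eqr_nat => /eqP.
Qed.

End Basis.

(* A projection [P] near x_00 and the vectors w_i = T x_i0 P, with T an inverse square root of
   the sum of the x_i0 P x_i0^*, give exact units w_i w_j^*; an orthonormal basis b_l of the range of
   [P] refines them to the rank one units of the basis w_i b_l. *)
Lemma matrix_stability (n : nat) (x : nat -> nat -> M) (e : R) : (0 < n)%N -> 0 <= e ->
  3000 * (n%:R * n%:R) * e <= 1 -> approx_units n (fun i j => mu (x i j)) e ->
  exists (m : nat) (u : nat -> nat -> M), [/\ (n * m)%N = N.+1, full_units (n * m) u &
    forall i j, (i < n)%N -> (j < n)%N ->
      nrm (mu (x i j) - mu (\sum_(l < m) u (i * m + l)%N (j * m + l)%N)) <= 1300 * (n%:R * e)].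
Proof.
move=> n0 e0 en hx.
have n1 : 1 <= n%:R :> R by rewrite ler1n.
have ne : n%:R * e <= n%:R * n%:R * e by rewrite ler_wpM2r // ler_peMl.
have e_ne : e <= n%:R * e by rewrite ler_peMl.
have en1 : 3000 * (n%:R * e) <= 1.
  by move: en ne; rewrite -mulrA; move: (n%:R * n%:R * e) (n%:R * e) => a b; lra.
have [P [m [b [Ps PP vP hb sb]]]] := near_projection e0 ltac:(move: en1 e_ne; lra)
  (half_re_v n0 hx) (half_re_sqr n0 hx e0 en).
have Ps' : star (mu P) = mu P by rewrite -mus Ps.
have PP' : mu P * mu P = mu P by rewrite -muM PP.
have hg := gram_dist n0 hx e0 en Ps' PP' vP.
(* The frame operator is formed inside the matrix algebra, where its inverse square root exists by
   diagonalisation. *)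
pose S : M := \sum_(i < n) (x i 0%N * P) * star (x i 0%N * P).
have SE : mu S = gram n (fun i j => mu (x i j)) (mu P).
  by rewrite /S raddf_sum; apply: eq_bigr => i _ /=; rewrite muM mus !muM.
have Ss : star S = S.
  apply: mx_hom_inj; rewrite mus SE /gram star_sum; apply: eq_bigr => i _.
  by rewrite starM starK.
have [T [Ts TST T1]] := near_inv_sqrt Ss (c := 112 * (n%:R * e)) ltac:(lra) ltac:(by rewrite SE).
have Ts' : star (mu T) = mu T by rewrite -mus Ts.
have TST' : mu T * gram n (fun i j => mu (x i j)) (mu P) * mu T = 1.
  by rewrite -SE -!muM TST rmorph1.
pose W i : M := T * (x i 0%N * P).
have WE i : mu (W i) = wvec (fun i j => mu (x i j)) (mu P) (mu T) i by rewrite /W !muM.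
have hW i j : (i < n)%N -> (j < n)%N -> star (W i) *m W j = if i == j then P else 0.
  move=> hi hj; apply: mx_hom_inj; rewrite mulmxE muM mus !WE.
  rewrite (w_orth n0 hx e0 en Ps' PP' vP Ts' T1 TST' hi hj).
  by case: eqP => // _; rewrite raddf0.
have sW : \sum_(i < n) W i *m star (W i) = 1.
  apply: mx_hom_inj; rewrite rmorph1 -(sum_w Ts' TST') raddf_sum; apply: eq_bigr => i _ /=.
  by rewrite mulmxE muM mus WE.
have WP i : W i *m P = W i by rewrite mulmxE /W -!mulrA PP.
have nm := basis_size hb sb hW sW WP.
have m0 : (0 < m)%N by case: (m) nm; rewrite ?muln0.
exists m, (fun a a' => W (a %/ m)%N *m b (a %% m)%N *m adj (W (a' %/ m)%N *m b (a' %% m)%N)).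
split=> //; first exact: (basis_full_units hb sb hW sW WP).
move=> i j hi hj; rewrite (basis_refine sb WP hi hj m0) mulmxE muM mus !WE.
exact: (w_units n0 hx e0 en Ps' PP' vP T1).
Qed.

End MatrixStability.

Lemma choice2 (X Y Z : Type) (P : X -> Y -> Z -> Prop) : (forall x y, exists z, P x y z) ->
  exists f, forall x y, P x y (f x y).
Proof.
move=> h; have [f hf] := choice (fun p : X * Y => h p.1 p.2).
by exists (fun x y => f (x, y)) => x y; exact: (hf (x, y)).
Qed.

Lemma ltn_mul_add n m i l : (i < n)%N -> (l < m)%N -> (i * m + l < n * m)%N.
Proof.
move=> hi hl; apply: (@leq_trans (i.+1 * m)); first by rewrite mulSnr ltn_add2l.
by rewrite leq_mul2r hi orbT.
Qed.

Lemma ment_ex (g : nat -> nat -> nat) k :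
  exists L, forall a b, (a < k)%N -> (b < k)%N -> ment L a b = g a b.
Proof.
have [L HL] := lnth_ex (fun p => g (nfst p) (nsnd p))
  (\max_(a < k) \max_(b < k) npair a b).+1.
exists L => a b ha hb; rewrite /ment HL ?npE // ltnS.
apply: leq_trans (leq_bigmax (Ordinal ha)).
exact: (leq_bigmax (F := fun b : 'I_k => npair a b) (Ordinal hb)).
Qed.

Lemma small_ex (R : realType) (B g : R) : 0 <= B -> 0 < g ->
  exists d, [/\ 0 < d, d <= 1 & B * d < g].
Proof.
move=> B0 g0; have B1 : 0 < B + 1 by lra.
have m0 : 0 < Order.min g 1 by rewrite lt_min g0 ltr01.
have mg : Order.min g 1 <= g by rewrite ge_min lexx.
have m1 : Order.min g 1 <= 1 by rewrite ge_min lexx orbT.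
move: (Order.min g 1) m0 mg m1 => c c0 cg c1.
have e : c / (B + 1) * (B + 1) = c by rewrite divfK //; apply/eqP; lra.
have d0 : 0 < c / (B + 1) by rewrite divr_gt0.
exists (c / (B + 1)); move: (c / (B + 1)) e d0 => d e d0; split=> //; nra.
Qed.

Section ApproxUnitsNear.
Variables (R : realType) (A : cstarType R).

(** The adjoint relation costs 2 f, the product relation B f + (B + f) f + f, and the sum n f; the
    coefficient covers all three. *)
Lemma approx_units_dist n (x x' : nat -> nat -> calg A) e f B : 0 <= f -> f <= 1 -> 0 <= B ->
  approx_units n x e -> (forall i j, (i < n)%N -> (j < n)%N -> nrm (x' i j) <= B) ->
  (forall i j, (i < n)%N -> (j < n)%N -> nrm (x i j - x' i j) <= f) ->
  approx_units n x' (e + (2 * B + 3 + n%:R) * f).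
Proof.
move=> f0 f1 B0 [hs hm h1] x'B hx'.
have Bf : 0 <= B * f by rewrite mulr_ge0.
have ff : f * f <= f by rewrite ler_piMr.
have nf : 0 <= n%:R * f by rewrite mulr_ge0.
have -> : (2 * B + 3 + n%:R) * f = 2 * (B * f) + 3 * f + n%:R * f by ring.
have hx'C i j : (i < n)%N -> (j < n)%N -> nrm (x' i j - x i j) <= f.
  by move=> hi hj; rewrite nrmBC hx'.
set d := _ + _ * f; have dE : 2 * (B * f) + 3 * f + n%:R * f <= d by [].
clearbody d; split.
- move=> i j hi hj; have -> : e + d = (d - f) + (e + f) by ring.
  apply: (nrm_swap (b := star (x i j))).
    by rewrite nrm_starB; apply: le_trans (hx'C _ _ hi hj) _; lra.
  by apply: (nrm_swap (hs i j hi hj)); exact: hx'.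
- move=> i j k l hi hj hk hl; have -> : e + d = (d - f) + (e + f) by ring.
  apply: (nrm_swap (b := x i j * x k l)).
    have xB : nrm (x i j) <= B + f.
      by apply: le_trans (nrm_le_dist _ (x' i j)) _; apply: lerD; auto.
    apply: le_trans (nrm_mul_near (hx'C _ _ hi hj) (hx'C _ _ hk hl) (x'B _ _ hk hl) xB) _.
    by lra.
  apply: (nrm_swap (hm i j k l hi hj hk hl)); case: eqP => _; first exact: hx'.
  by rewrite subrr nrm0.
- rewrite [e + d]addrC; apply: nrm_swap h1; rewrite -sumrB; apply: le_trans (nrm_sum _ _ _) _.
  apply: (@le_trans _ _ (\sum_(i < n) f)); first by apply: ler_sum => i _; exact: hx'C.
  by rewrite sumr_const card_ord -[f *+ n]mulr_natl; lra.
Qed.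

Lemma family_bound n (x : nat -> nat -> calg A) : exists2 B, 0 <= B &
  forall i j, (i < n)%N -> (j < n)%N -> nrm (x i j) <= B.
Proof.
exists (\sum_(i < n) \sum_(j < n) nrm (x i j)).
  by apply: sumr_ge0 => i _; apply: sumr_ge0 => j _; exact: nrm_ge0.
move=> i j hi hj; rewrite (bigD1 (Ordinal hi)) //= (bigD1 (Ordinal hj)) //=.
rewrite -addrA lerDl addr_ge0 //; apply: sumr_ge0 => k _; first exact: nrm_ge0.
by apply: sumr_ge0 => l _; exact: nrm_ge0.
Qed.

Lemma approx_units_mono n (x : nat -> nat -> calg A) e e' : e <= e' ->
  approx_units n x e -> approx_units n x e'.
Proof.
move=> ee [h1 h2 h3]; split.
- by move=> i j hi hj; apply: le_trans ee; exact: h1.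
- by move=> i j k l hi hj hk hl; apply: le_trans ee; exact: h2.
- exact: le_trans ee.
Qed.

Lemma approx_units_near n (x : nat -> nat -> calg A) e d : approx_units n x e -> 0 < d ->
  exists2 f, 0 < f & forall x' : nat -> nat -> calg A,
    (forall i j, (i < n)%N -> (j < n)%N -> nrm (x i j - x' i j) <= f) ->
    approx_units n x' (e + d).
Proof.
move=> hx d0; have [B B0 xB] := family_bound n x; have n0 : 0 <= n%:R :> R by [].
have [f [f0 f1 fd]] := small_ex (B := 2 * (B + 1) + 3 + n%:R) ltac:(move: B0 n0; lra) d0.
exists f => // x' hx'.
apply: (@approx_units_mono _ _ (e + (2 * (B + 1) + 3 + n%:R) * f)); first by rewrite lerD2l ltW.
apply: (approx_units_dist (ltW f0) f1 _ hx _ hx'); first by lra.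
move=> i j hi hj; apply: le_trans (nrm_le_dist _ (x i j)) _.
by apply: lerD; [exact: xB | rewrite nrmBC; apply: le_trans f1; exact: hx'].
Qed.

Lemma approx_units_lim n (x : nat -> nat -> calg A) :
  (forall d, 0 < d -> exists x' : nat -> nat -> calg A, approx_units n x' d /\
    forall i j, (i < n)%N -> (j < n)%N -> nrm (x' i j - x i j) <= d) ->
  approx_units n x 0.
Proof.
move=> h; have [B B0 xB] := family_bound n x; have n0 : 0 <= n%:R :> R by [].
have H d : 0 < d -> approx_units n x d.
  move=> d0; have [f [f0 f1 fd]] := small_ex (B := 2 * B + 4 + n%:R) ltac:(move: B0 n0; lra) d0.
  have [x' [hx' xx']] := h f f0.
  apply: (@approx_units_mono _ _ (f + (2 * B + 3 + n%:R) * f)); first by move: fd; lra.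
  exact: (approx_units_dist (ltW f0) f1 B0 hx' xB xx').
split.
- by move=> i j hi hj; apply/ler_addgt0Pr => d /H[h1 _ _]; rewrite add0r h1.
- by move=> i j k l hi hj hk hl; apply/ler_addgt0Pr => d /H[_ h2 _]; rewrite add0r h2.
- by apply/ler_addgt0Pr => d /H[_ _]; rewrite add0r.
Qed.

Variables (a : nat -> A) (U : nat -> nat -> nat -> Prop) (e : nat).
Hypothesis hU : cuts U e (fun p => nrm (pval a p)).

Lemma pval_if (b : bool) p q : pval a (if b then p else q) = if b then pval a p else pval a q.
Proof. by case: b. Qed.

Lemma good_approx L n K : good U e L n K ->
  approx_units n (fun i j => pval a (ment L i j)) K.+1%:R^-1.
Proof.
move=> [h1 [h2 h3]]; split.
- move=> i j hi hj; have /hU := h1 i hi j hj.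
  by rewrite pval_sub pval_star qr_rinv => /ltW.
- move=> i j k l hi hj hk hl; have /hU := h2 i hi j hj k hk l hl.
  by rewrite pval_sub pval_mul pval_if pval0 qr_rinv => /ltW.
- by have /hU := h3; rewrite pval_sub pval1 pval_sum qr_rinv => /ltW.
Qed.

Lemma approx_good L n K d : d < K.+1%:R^-1 ->
  approx_units n (fun i j => pval a (ment L i j)) d -> good U e L n K.
Proof.
move=> dK [h1 h2 h3]; split; [|split].
- move=> i hi j hj; apply/hU; rewrite pval_sub pval_star qr_rinv.
  by apply: le_lt_trans dK; exact: h1.
- move=> i hi j hj k hk l hl; apply/hU; rewrite pval_sub pval_mul pval_if pval0 qr_rinv.
  by apply: le_lt_trans dK; exact: h2.
- by apply/hU; rewrite pval_sub pval1 pval_sum qr_rinv; apply: le_lt_trans dK.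
Qed.

End ApproxUnitsNear.

(** * Simultaneous approximation at one stage of the system *)

Section CommonStage.
Variables (R : realType) (n : nat -> nat).
Local Notation M := (fun s : nat => ('M[R[i]]_((n s).+1) : starAlgType R[i])).
Variable phi : forall s, {lrmorphism M s -> M s.+1}.
Variables (A B : cstarType R) (mu : forall s, {lrmorphism M s -> calg A})
  (nu : forall s, {lrmorphism M s -> calg B}).
Hypotheses (hmu : cocone (M := M) phi mu) (hnu : cocone (M := M) phi nu).

Lemma common_stage (Q : nat -> calg A -> calg B -> Prop) K :
  (forall k, (k < K)%N -> exists s (z : M s), Q k (mu s z) (nu s z)) ->
  exists s, forall t, (s <= t)%N -> forall k, (k < K)%N ->
    exists z : M t, Q k (mu t z) (nu t z).
Proof.
elim: K => [|K IH] h; first by exists 0%N.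
have [s hs] := IH (fun k hk => h k (ltnW hk)).
have [s' [z hz]] := h K (ltnSn K).
exists (maxn s s') => t; rewrite geq_max => /andP[st s't] k.
rewrite ltnS leq_eqVlt => /orP[/eqP ->|kK]; last exact: hs.
by have [z' [e1 e2]] := push hmu hnu z s't; exists z'; rewrite e1 e2.
Qed.

Lemma common_stage2 (Q : nat -> nat -> calg A -> calg B -> Prop) K :
  (forall i j, (i < K)%N -> (j < K)%N -> exists s (z : M s), Q i j (mu s z) (nu s z)) ->
  exists s, forall t, (s <= t)%N -> exists z : nat -> nat -> M t,
    forall i j, (i < K)%N -> (j < K)%N -> Q i j (mu t (z i j)) (nu t (z i j)).
Proof.
move=> h; have [|s hs] := @common_stage (fun k => Q (k %/ K)%N (k %% K)%N) (K * K).
  move=> k hk; have K0 : (0 < K)%N by case: (K) hk.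
  by apply: h; rewrite ?ltn_divLR ?ltn_mod.
exists s => t /hs ht.
have H i j : exists z : M t, (i < K)%N -> (j < K)%N -> Q i j (mu t z) (nu t z).
  case: (ltnP i K) => hi; last by exists 0.
  case: (ltnP j K) => hj; last by exists 0.
  have [z] := ht _ (ltn_mul_add hi hj); rewrite divnMDl ?(leq_ltn_trans _ hj) // divn_small // addn0.
  by rewrite modnMDl modn_small // => hz; exists z.
have [f hf] := choice2 H.
by exists f.
Qed.

End CommonStage.

Section Forward.
Variables (R : realType) (A : cstarType R) (a : nat -> A) (U : nat -> nat -> nat -> Prop) (e : nat).
Hypothesis hU : cuts U e (fun p => nrm (pval a p)).
Hypothesis ha : is_presentation a.
Variables (N : nat) (mu : {lrmorphism 'M[R[i]]_N.+1 -> calg A}).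
Hypothesis mus : star_preserving mu.

Lemma full_units_approx k u : full_units k u -> approx_units k (fun i j => mu (u i j)) 0.
Proof.
move=> [h1 h2 h3 _]; split.
- by move=> i j hi hj; rewrite -mus h1 subrr nrm0.
- by move=> i j p l hi hj hp hl; rewrite -rmorphM h2 //; case: eqP => _;
    [rewrite subrr nrm0 | rewrite subr0 raddf0 nrm0].
- by have := congr1 mu h3; rewrite raddf_sum rmorph1 /= => ->; rewrite subrr nrm0.
Qed.

Lemma full_units_le1 k u i j : full_units k u -> (i < k)%N -> (j < k)%N -> nrm (mu (u i j)) <= 1.
Proof.
move=> [h1 h2 _ _] hi hj.
have sq i' j' : (i' < k)%N -> (j' < k)%N -> nrm (mu (u i' j')) ^+ 2 = nrm (mu (u j' j')).
  by move=> hi' hj'; rewrite -nrm_sqr -mus -rmorphM h1 h2 // eqxx.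
have := sq j j hj hj; have := sq i j hi hj; move: (nrm_ge0 (mu (u i j))).
move: (nrm (mu (u i j))) (nrm (mu (u j j))) => s t s0 st tt.
have t1 : t <= 1 by nra.
by nra.
Qed.

(** The order of quantifiers matters: [c] is read off from the exact units [u], so [T'] may be any
    larger number, and [L'] is chosen last, as close to [u] as [T'] demands. *)
Lemma extn_ex n T L T0 j m u h : full_units (n * m) u -> h < (tol n T).+1%:R^-1 ->
  (forall i i', (i < n)%N -> (i' < n)%N ->
     nrm (pval a (ment L i i') - mu (\sum_(l < m) u (i * m + l)%N (i' * m + l)%N)) <= h) ->
  (exists z, nrm (pval a j - mu z) < T0.+1%:R^-1) ->
  exists c, forall T', (c <= T')%N -> exists L', extn U e n T L T0 j m T' L' c.
Proof.
move=> hu ht hL [z hz]; have [_ _ _ /(_ z)[f zE]] := hu; move: hz; rewrite zE.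
set k := (n * m)%N => hz.
have ule a' b : (a' < k)%N -> (b < k)%N -> nrm (mu (u a' b)) <= 1 by exact: full_units_le1.
pose g := T0.+1%:R^-1 - nrm (pval a j - mu (\sum_(a < k) \sum_(b < k) f a b *: u a b)).
have g0 : 0 < g by rewrite subr_gt0.
have [d [d0 _ dg]] := small_ex (B := k%:R * k%:R) (mulr_ge0 (ler0n _ _) (ler0n _ _)) g0.
have [q hq] : exists q : nat -> nat -> nat, forall a b,
    normc (f a b - cst R (nfst (q a b)) (nsnd (q a b))) < d.
  have H a' b : exists p, normc (f a' b - cst R (nfst p) (nsnd p)) < d.
    have [p1 [p2 hp]] := cst_approx (f a' b) d0.
    by exists (npair p1 p2); rewrite !npE.
  by have [q hq] := choice2 H; exists q.
have [c hc] := ment_ex q k; exists c => T' cT.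
pose cf a b : R[i] := cst R (nfst (q a b)) (nsnd (q a b)).
pose z' := \sum_(a < k) \sum_(b < k) cf a b *: u a b.
have hz' : nrm (pval a j - mu z') < T0.+1%:R^-1.
  apply: le_lt_trans (_ : _ <= nrm (pval a j - mu (\sum_(a < k) \sum_(b < k) f a b *: u a b))
    + k%:R * k%:R * d) _; last by rewrite -ltrBrDl.
  apply: nrm_swap (lexx _) _; rewrite -raddfB /z' -sumrB raddf_sum.
  apply: le_trans (nrm_sum _ _ _) _.
  apply: (@le_trans _ _ (\sum_(i < k) k%:R * d)); last first.
    by rewrite sumr_const card_ord -[_ * d *+ _]mulr_natl mulrA.
  apply: ler_sum => i _ /=; rewrite -sumrB raddf_sum; apply: le_trans (nrm_sum _ _ _) _.
  apply: (@le_trans _ _ (\sum_(i < k) d)); last by rewrite sumr_const card_ord mulr_natl.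
  apply: ler_sum => b _ /=; rewrite -scalerBl linearZ /= nrmZ.
  rewrite -[d]mulr1; apply: ler_pM; rewrite ?normc_ge0 ?nrm_ge0 ?ule //.
  exact/ltW/hq.
(* [.+2] leaves room below 1 / (kap + 1) for the strict inequality in [good]. *)
have K0 : 0 < (kap (n * m) T').+2%:R^-1 :> R by rewrite invr_gt0 ltr0n.
have [f1 f10 hf1] := approx_units_near (full_units_approx hu) K0.
pose C : R := \sum_(a < k) \sum_(b < k) normc (cf a b).
have C0 : 0 <= C by apply: sumr_ge0 => i _; apply: sumr_ge0 => b _; exact: normc_ge0.
have [f2 [f20 _ hf2]] := small_ex (B := m%:R) (ler0n _ _) (g := (tol n T).+1%:R^-1 - h)
  ltac:(by rewrite subr_gt0).
have [f3 [f30 _ hf3]] := small_ex C0 (g := T0.+1%:R^-1 - nrm (pval a j - mu z'))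
  ltac:(by rewrite subr_gt0).
(* One distance for three purposes: the matrix unit relations, the comparison with [L], and the
   approximation of the [j]-th polynomial. *)
have [eta [eta0 e1 e2 e3]] : exists eta, [/\ 0 < eta, eta <= f1, eta <= f2 & eta <= f3].
  exists (Order.min f1 (Order.min f2 f3)).
  by rewrite !lt_min f10 f20 f30 !ge_min !lexx !orbT.
have [r hr] : exists r : nat -> nat -> nat, forall a' b, nrm (mu (u a' b) - pval a (r a' b)) <= eta.
  have H a' b : exists p, nrm (mu (u a' b) - pval a p) <= eta.
    have [p hp] := (presentation_pval a).1 ha (mu (u a' b)) eta eta0.
    by exists p; exact: ltW.
  by have [r hr] := choice2 H; exists r.
have [L' hL'] := ment_ex r k; exists L'.
have hL'' a' b : (a' < k)%N -> (b < k)%N -> nrm (mu (u a' b) - pval a (ment L' a' b)) <= eta.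
  by move=> ha' hb; rewrite hL'.
split=> //; split; [|split].
- apply: (approx_good hU (d := 0 + (kap (n * m) T').+2%:R^-1)).
    by rewrite add0r ltf_pV2 ?posrE ?ltr0n // ltr_nat.
  by apply: hf1 => i b hi hb; apply: le_trans e1; exact: hL''.
- move=> i hi i' hi'; apply/hU; rewrite pval_sub pval_sum qr_rinv.
  apply: (@le_lt_trans _ _ (h + m%:R * f2)); last by rewrite -ltrBrDl.
  apply: nrm_swap (hL i i' hi hi') _; rewrite raddf_sum -sumrB.
  apply: le_trans (nrm_sum _ _ _) _; apply: (@le_trans _ _ (\sum_(l < m) f2)).
    apply: ler_sum => l _; apply: le_trans e2; by apply: hL''; exact: ltn_mul_add.
  by rewrite sumr_const card_ord mulr_natl.
- apply/hU; rewrite pval_sub pval_sum qr_rinv.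
  apply: (@le_lt_trans _ _ (nrm (pval a j - mu z') + C * f3)); last by rewrite -ltrBrDl.
  apply: nrm_swap (lexx _) _; rewrite /z' raddf_sum -sumrB.
  apply: le_trans (nrm_sum _ _ _) _; rewrite /C mulr_suml; apply: ler_sum => i _ /=.
  rewrite pval_sum raddf_sum -sumrB; apply: le_trans (nrm_sum _ _ _) _.
  rewrite mulr_suml; apply: ler_sum => b _ /=.
  rewrite hc // pval_mul pval_const linearZ /= -scalerAl mul1r -scalerBr nrmZ.
  by rewrite ler_wpM2l ?normc_ge0 //; apply: le_trans e3; exact: hL''.
Qed.

End Forward.

(** The two demands on [kap], with k = 1 / (kap + 1): [matrix_stability] must apply at precision 2
    k, and its error 1300 n (2 k), together with the initial distance k, must stay below the
    tolerance; 2601 = 2 * 1300 + 1. *)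
Lemma kap_tol (R : realType) n T : (0 < n)%N ->
  2601 * (n%:R * (kap n T).+1%:R^-1) < (tol n T).+1%:R^-1 :> R /\
  3000 * (n%:R * n%:R) * (2 * (kap n T).+1%:R^-1) <= 1 :> R.
Proof.
move=> n0; have n1 : 1 <= n%:R :> R by rewrite ler1n.
have [P [P1 tE kE]] : exists P : R, [/\ 1 <= P, (tol n T).+1%:R = P + 1 :> R &
    (kap n T).+1%:R = 100 * 1000 * (n%:R * (n%:R * n%:R) * P) + 1 :> R].
  exists (n%:R ^+ 3 * T.+1%:R ^+ 2); split.
  - by rewrite -!natrX -natrM ler1n muln_gt0 !expn_gt0 n0.
  - by rewrite -natr1 /tol natrM !natrX.
  - rewrite -[LHS]natr1 /kap natrM natrX [X in _ * X]natrM !natrX.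
    by move: (T.+1%:R : R) (n%:R : R) => t N; ring.
rewrite tE kE; move: (n%:R : R) n1 => N n1.
have NP : 1 <= N * P by nra.
have NN : 1 <= N * N by nra.
have big : N * P <= N * (N * N) * P.
  by rewrite -mulrA [N * N * P]mulrC mulrA ler_peMr //; lra.
have big2 : N * N <= N * (N * N) * P.
  have -> : N * (N * N) * P = N * P * (N * N) by ring.
  by rewrite ler_peMl //; lra.
have bigN : N <= N * P by rewrite ler_peMr //; lra.
move: (N * (N * N) * P) big big2 => Q big big2.
have Q0 : 0 < 100 * 1000 * Q + 1 by lra.
have P0 : 0 < P + 1 by lra.
have inv_lt (c p q : R) : 0 < p -> 0 < q -> c * q < p -> c * p^-1 < q^-1.
  by move=> p0 q0 h; rewrite ltr_pdivrMr // mulrC ltr_pdivlMr.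
have inv_le (c p : R) : 0 < p -> c <= p -> c * p^-1 <= 1.
  by move=> p0 h; rewrite ler_pdivrMr // mul1r.
split.
  rewrite mulrA; apply: inv_lt => //; rewrite -[2601 * N * _]mulrA mulrDr mulr1.
  move: (N * P) NP big bigN => X *; lra.
rewrite mulrA; apply: inv_le => //; move: (N * N) NN big2 => X *; lra.
Qed.

Lemma stage_units (R : realType) (A : cstarType R) N (mu : {lrmorphism 'M[R[i]]_N.+1 -> calg A})
    (x : nat -> nat -> calg A) (z : nat -> nat -> 'M[R[i]]_N.+1) n T :
  star_preserving mu -> (0 < n)%N ->
  (forall i j, (i < n)%N -> (j < n)%N -> nrm (x i j - mu (z i j)) <= (kap n T).+1%:R^-1) ->
  approx_units n (fun i j => mu (z i j)) (2 * (kap n T).+1%:R^-1) ->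
  exists m u h, [/\ (n * m)%N = N.+1, full_units (n * m) u, h < (tol n T).+1%:R^-1 &
    forall i j, (i < n)%N -> (j < n)%N ->
      nrm (x i j - mu (\sum_(l < m) u (i * m + l)%N (j * m + l)%N)) <= h].
Proof.
move=> mus n0 xz hz; have [h1 h2] := kap_tol R T n0.
have k0 : 0 <= (kap n T).+1%:R^-1 :> R by rewrite invr_ge0.
have [m [u [nm hu hx]]] := matrix_stability mus n0 (mulr_ge0 (ler0n R 2) k0) h2 hz.
exists m, u, (2601 * (n%:R * (kap n T).+1%:R^-1)); split=> // i j hi hj.
have n1 : 1 <= n%:R :> R by rewrite ler1n.
apply: le_trans (nrm_swap (xz i j hi hj) (hx i j hi hj)) _.
by move: ((kap n T).+1%:R^-1 : R) (n%:R : R) k0 n1 => k r k0 n1; nra.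
Qed.

(* Both pairs of families are perturbed to exact units inside the same matrix algebra, so that they
   are refined by the same factor. *)
Lemma forward_ext (R : realType) (A B : cstarType R) (a : nat -> A) (b : nat -> B) U e e' :
  cuts U e (fun p => nrm (pval a p)) -> cuts U e' (fun p => nrm (pval b p)) ->
  is_presentation a -> is_presentation b -> is_UHF A -> star_isomorphic A B ->
  ext_cond U e e'.
Proof.
move=> ha hb pa pb [ns [phi [_ hlim]]] [theta thetas [theta' thK thK']].
have [mu hmu dmu] := inductive_limit_dense hlim.
pose nu s : {lrmorphism 'M[R[i]]_((ns s).+1) -> calg B} := theta \o mu s.
have hnu : cocone (M := fun s => ('M[R[i]]_((ns s).+1) : starAlgType R[i])) phi nu.
  split=> [s x|s x]; first by rewrite /nu /= hmu.1 thetas.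
  by rewrite /nu /= hmu.2.
have dnu (x : calg B) d : 0 < d -> exists s z, nrm (x - nu s z) < d.
  (* 8 is the bound of [hom_bounded] for [theta]. *)
  move=> d0; have [|s [z hz]] := dmu (theta' x) (d / 8); first by rewrite divr_gt0.
  exists s, z; rewrite -(thK' x) /nu /= -raddfB.
  apply: le_lt_trans (hom_bounded thetas _) _.
  by move: hz; move: (nrm _) => t; lra.
move=> n T L1 L2 T0 j n0 g1 g2.
have au1 := good_approx ha g1; have au2 := good_approx hb g2.
set k := (kap n T).+1%:R^-1 in au1 au2; have k0 : 0 < k :> R by rewrite invr_gt0.
have [f1 f10 hf1] := approx_units_near au1 k0.
have [f2 f20 hf2] := approx_units_near au2 k0.
have T0p : 0 < T0.+1%:R^-1 :> R by rewrite invr_gt0.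
have [d [d0 df1 df2 dk]] : exists d, [/\ 0 < d, d <= f1, d <= f2 & d <= k].
  exists (Order.min f1 (Order.min f2 k)).
  by rewrite !lt_min f10 f20 k0 !ge_min !lexx !orbT.
have [|s1 hs1] := @common_stage2 _ _ _ _ _ _ _ hmu hnu
  (fun i j x _ => nrm (pval a (ment L1 i j) - x) <= d) n.
  by move=> i l _ _; have [s [z hz]] := dmu (pval a (ment L1 i l)) d d0; exists s, z; exact: ltW.
have [|s2 hs2] := @common_stage2 _ _ _ _ _ _ _ hmu hnu
  (fun i j _ x => nrm (pval b (ment L2 i j) - x) <= d) n.
  by move=> i l _ _; have [s [z hz]] := dnu (pval b (ment L2 i l)) d d0; exists s, z; exact: ltW.
have [|s3 hs3] := @common_stage2 _ _ _ _ _ _ _ hmu hnu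
  (fun _ _ x _ => nrm (pval a j - x) < T0.+1%:R^-1) 1.
  by move=> _ _ _ _; exact: dmu.
have [|s4 hs4] := @common_stage2 _ _ _ _ _ _ _ hmu hnu
  (fun _ _ _ x => nrm (pval b j - x) < T0.+1%:R^-1) 1.
  by move=> _ _ _ _; exact: dnu.
pose t := maxn (maxn s1 s2) (maxn s3 s4).
have [z1 hz1] := hs1 t ltac:(by rewrite /t !leq_max leqnn).
have [z2 hz2] := hs2 t ltac:(by rewrite /t !leq_max leqnn orbT).
have [z3 hz3] := hs3 t ltac:(by rewrite /t !leq_max leqnn !orbT).
have [z4 hz4] := hs4 t ltac:(by rewrite /t !leq_max leqnn !orbT).
have kk : 2 * k = k + k by ring.
have [||m [u [h [nm hu hh hx]]]] := stage_units (x := fun i j => pval a (ment L1 i j))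
  (z := z1) (T := T) (hmu.1 t) n0.
- by move=> i l hi hl; apply: le_trans dk; exact: hz1.
- by rewrite -/k kk; apply: hf1 => i l hi hl; apply: le_trans df1; exact: hz1.
have [||m' [u' [h' [nm' hu' hh' hx']]]] := stage_units (x := fun i j => pval b (ment L2 i j))
  (z := z2) (T := T) (hnu.1 t) n0.
- by move=> i l hi hl; apply: le_trans dk; exact: hz2.
- by rewrite -/k kk; apply: hf2 => i l hi hl; apply: le_trans df2; exact: hz2.
have mm : m' = m by apply/eqP; rewrite -(eqn_pmul2l n0) nm nm'.
rewrite mm in u' hu' hx'.
have [|c1 hc1] := extn_ex ha pa (hmu.1 t) (T0 := T0) (j := j) hu hh hx.
  by exists (z3 0%N 0%N); exact: hz3.
have [|c2 hc2] := extn_ex hb pb (hnu.1 t) (T0 := T0) (j := j) hu' hh' hx'.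
  by exists (z4 0%N 0%N); exact: hz4.
(* [T'] has to dominate the coefficient codes of both sides as well as [T0]. *)
exists m, (maxn T0 (maxn c1 c2)); split; first by case: (m) nm; rewrite ?muln0.
split; first by rewrite leq_max leqnn.
have [|L1' h1] := hc1 (maxn T0 (maxn c1 c2)); first by rewrite !leq_max leqnn orbT.
have [|L2' h2] := hc2 (maxn T0 (maxn c1 c2)); first by rewrite !leq_max leqnn !orbT.
by split; [exists L1', c1 | exists L2', c2].
Qed.

Lemma exists_lim2 (R : realType) (A : cstarType R) (u : nat -> nat -> nat -> calg A) n c : 0 <= c ->
  (forall i j k, (i < n)%N -> (j < n)%N -> nrm (u i j k.+1 - u i j k) <= c * 2 ^- k) ->
  exists l : nat -> nat -> calg A, forall i j k, (i < n)%N -> (j < n)%N ->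
    nrm (l i j - u i j k) <= 2 * c * 2 ^- k.
Proof.
move=> c0 h.
have H i j : exists l, (i < n)%N -> (j < n)%N -> forall k, nrm (l - u i j k) <= 2 * c * 2 ^- k.
  case: (ltnP i n) => hi; last by exists 0.
  case: (ltnP j n) => hj; last by exists 0.
  have [l hl] := geometric_lim c0 (fun k => h i j k hi hj).
  by exists l.
by have [l hl] := choice2 H; exists l => *; exact: hl.
Qed.

(** * Refinement of matrix units *)

Section Refine.
Variable V : pzRingType.

Definition refine m (x : nat -> nat -> V) i j := \sum_(l < m) x (i * m + l)%N (j * m + l)%N.

Lemma refine_comp q m x i j : refine q (refine m x) i j = refine (q * m) x i j.
Proof.
rewrite /refine -(sum_divmod q m (fun l l' => x ((i * q + l) * m + l')%N ((j * q + l) * m + l')%N)).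
by apply: eq_bigr => a _; rewrite !mulnDl -!addnA -!divn_eq !mulnA.
Qed.

(** An identity valid for arbitrary families, whose last sum collects the defects of the product
    relations: it vanishes for exact units and is at most m^2 e for approximate ones. *)
Lemma refine_mul m x i j k l : refine m x i j * refine m x k l =
  (if j == k then refine m x i l else 0) + \sum_(p < m) \sum_(q < m)
    (x (i * m + p)%N (j * m + p)%N * x (k * m + q)%N (l * m + q)%N -
     (if (j * m + p == k * m + q)%N then x (i * m + p)%N (l * m + q)%N else 0)).
Proof.
have -> : (if j == k then refine m x i l else 0) = \sum_(p < m) \sum_(q < m)
    (if (j * m + p == k * m + q)%N then x (i * m + p)%N (l * m + q)%N else 0).
  have e (p q : 'I_m) : (j * m + p == k * m + q)%N = (j == k) && (p == q).
    have m0 : (0 < m)%N by apply: leq_ltn_trans (ltn_ord p).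
    apply/eqP/andP => [h|[/eqP -> /eqP -> //]].
    have := congr1 (divn^~ m) h; have := congr1 (modn^~ m) h.
    rewrite !modnMDl !modn_small ?ltn_ord // !divnMDl // !divn_small ?ltn_ord // !addn0.
    by move=> h1 ->; split=> //; apply/eqP/val_inj.
  under [RHS]eq_bigr do under eq_bigr do rewrite e.
  case: (j == k) => /=; last by rewrite big1 // => p _; rewrite big1.
  apply: eq_bigr => p _; rewrite (bigD1 p) //= eqxx big1 ?addr0 // => q /negbTE.
  by rewrite eq_sym => ->.
rewrite -big_split /= /refine mulr_suml; apply: eq_bigr => p _.
by rewrite -big_split /= mulr_sumr; apply: eq_bigr => q _; rewrite addrC subrK.
Qed.

Lemma sum_refine n m x : \sum_(i < n) refine m x i i = \sum_(a < n * m) x a a.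
Proof.
rewrite /refine -(sum_divmod n m (fun i l => x (i * m + l)%N (i * m + l)%N)).
by apply: eq_bigr => a _; rewrite -divn_eq.
Qed.

End Refine.

Section ExactUnits.
Variables (K : numClosedFieldType) (V : starAlgType K).

Definition munits n (x : nat -> nat -> V) : Prop :=
  [/\ forall i j, (i < n)%N -> (j < n)%N -> star (x i j) = x j i,
      forall i j k l, (i < n)%N -> (j < n)%N -> (k < n)%N -> (l < n)%N ->
        x i j * x k l = (if j == k then x i l else 0) &
      \sum_(i < n) x i i = 1].

Lemma star_sum_alg I (r : seq I) (P : pred I) (F : I -> V) :
  star (\sum_(i <- r | P i) F i) = \sum_(i <- r | P i) star (F i).
Proof.
have star0' : star (0 : V) = 0.
  by have := starZ (0 : K) (0 : V); rewrite rmorph0 !scale0r.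
exact: (big_morph _ (@starD _ _) star0').
Qed.

Lemma munits_refine n m x : munits (n * m) x -> munits n (refine m x).
Proof.
move=> [h1 h2 h3]; split.
- move=> i j hi hj; rewrite star_sum_alg; apply: eq_bigr => l _.
  by rewrite h1 ?ltn_mul_add.
- move=> i j k l hi hj hk hl; rewrite refine_mul [X in _ + X]big1 ?addr0 // => p _.
  by rewrite big1 // => q _; rewrite h2 ?ltn_mul_add ?subrr.
- by rewrite sum_refine.
Qed.

Lemma units_hom N (x : nat -> nat -> V) : munits N.+1 x ->
  exists f : {lrmorphism 'M[K]_N.+1 -> V}, star_preserving f /\
    forall z, f z = \sum_(a < N.+1) \sum_(b < N.+1) z a b *: x a b.
Proof.
move=> [h1 h2 h3].
have [||||f fE] := @lrmorphism_pack _ 'M[K]_N.+1 V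
  (fun z => \sum_(a < N.+1) \sum_(b < N.+1) z a b *: x a b).
- move=> z w; rewrite -sumrB; apply: eq_bigr => a _; rewrite -sumrB; apply: eq_bigr => b _.
  by rewrite !mxE scalerBl.
- rewrite -h3; apply: eq_bigr => a _; rewrite (bigD1 a) //= mxE eqxx scale1r big1 ?addr0 // => b.
  by rewrite eq_sym mxE => /negbTE ->; rewrite scale0r.
- move=> z w; rewrite mulr_suml; apply: eq_bigr => a _; rewrite mulr_suml.
  have e (b : 'I_N.+1) : z a b *: x a b * (\sum_(c < N.+1) \sum_(d < N.+1) w c d *: x c d) =
      \sum_(d < N.+1) (z a b * w b d) *: x a d.
    rewrite mulr_sumr (bigD1 b) //= [X in _ + X]big1 ?addr0 => [|c cb]; rewrite mulr_sumr.
      apply: eq_bigr => d _; rewrite -scalerAl -scalerAr h2 ?ltn_ord // eqxx.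
      by rewrite scalerA.
    rewrite big1 // => d _; rewrite -scalerAl -scalerAr h2 ?ltn_ord //.
    by rewrite (_ : (b == c :> nat) = false) ?scaler0 // eq_sym; exact: negbTE.
  under [RHS]eq_bigr do rewrite e; rewrite exchange_big; apply: eq_bigr => d _ /=.
  by rewrite -scaler_suml -mulmxE mxE.
- move=> c z; rewrite scaler_sumr; apply: eq_bigr => a _; rewrite scaler_sumr.
  by apply: eq_bigr => b _; rewrite mxE scalerA.
exists f; split=> // z; rewrite !fE star_sum_alg exchange_big; apply: eq_bigr => a _ /=.
rewrite star_sum_alg; apply: eq_bigr => b _.
by rewrite starZ h1 ?ltn_ord // !mxE.
Qed.

End ExactUnits.

Lemma munits_delta (R : realType) N :
  munits N.+1 (fun i j => delta_mx (inord i) (inord j) : 'M[R[i]]_N.+1).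
Proof.
split.
- by move=> i j _ _; exact: star_delta.
- move=> i j k l hi hj hk hl; rewrite mul_delta; congr (if _ then _ else _).
  by apply/eqP/eqP => [/(congr1 val) /=|->//]; rewrite !inordK.
- by rewrite -(sum_delta R N); apply: eq_bigr => i _; rewrite inord_val.
Qed.

(* The embedding x |-> x (x) 1_m of matrix algebras. *)
Lemma standard_embedding (R : realType) N N' m : (N.+1 * m = N'.+1)%N ->
  exists f : {lrmorphism 'M[R[i]]_N.+1 -> 'M[R[i]]_N'.+1}, star_preserving f /\
    forall z, f z = \sum_(a < N.+1) \sum_(b < N.+1)
      z a b *: refine m (fun i j => delta_mx (inord i) (inord j)) a b.
Proof.
by move=> e; apply: units_hom; apply: munits_refine; rewrite e; exact: munits_delta.
Qed.

Section ApproxRefine.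
Variables (R : realType) (A : cstarType R).

Lemma approx_units_munits n (x : nat -> nat -> calg A) : approx_units n x 0 -> munits n x.
Proof.
have z (y : calg A) : nrm y <= 0 -> y = 0.
  by move=> h; apply/nrm_eq0/le_anti; rewrite h nrm_ge0.
move=> [h1 h2 h3]; split.
- by move=> i j hi hj; apply/subr0_eq/z/h1.
- by move=> i j k l hi hj hk hl; apply/subr0_eq/z/h2.
- exact/subr0_eq/z.
Qed.

Lemma approx_units_refine n m (x : nat -> nat -> calg A) e : (0 < m)%N ->
  approx_units (n * m) x e -> approx_units n (refine m x) (m%:R * m%:R * e).
Proof.
move=> m0 [h1 h2 h3]; have m1 : 1 <= m%:R :> R by rewrite ler1n.
have e0 : 0 <= e by apply: le_trans (nrm_ge0 _) h3.
have me : m%:R * e <= m%:R * m%:R * e by rewrite ler_wpM2r // ler_peMr.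
have e_me : e <= m%:R * e by rewrite ler_peMl.
split.
- move=> i j hi hj; rewrite star_sum_alg -sumrB; apply: le_trans (nrm_sum _ _ _) _.
  apply: le_trans me; apply: (@le_trans _ _ (\sum_(l < m) e)).
    by apply: ler_sum => l _; apply: h1; rewrite ltn_mul_add.
  by rewrite sumr_const card_ord mulr_natl.
- move=> i j k l hi hj hk hl; rewrite refine_mul [X in X - _]addrC addrK.
  apply: le_trans (nrm_sum _ _ _) _; apply: (@le_trans _ _ (\sum_(p < m) m%:R * e)); last first.
    by rewrite sumr_const card_ord -[_ * e *+ _]mulr_natl mulrA.
  apply: ler_sum => p _; apply: le_trans (nrm_sum _ _ _) _.
  apply: (@le_trans _ _ (\sum_(q < m) e)); last by rewrite sumr_const card_ord mulr_natl.
  by apply: ler_sum => q _; apply: h2; rewrite ltn_mul_add.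
- by rewrite sum_refine; apply: le_trans h3 _; apply: le_trans me.
Qed.

Lemma refine_dist m (x y : nat -> nat -> calg A) i j e :
  (forall l, (l < m)%N -> nrm (x (i * m + l)%N (j * m + l)%N - y (i * m + l)%N (j * m + l)%N) <= e) ->
  nrm (refine m x i j - refine m y i j) <= m%:R * e.
Proof.
move=> h; rewrite -sumrB; apply: le_trans (nrm_sum _ _ _) _.
apply: (@le_trans _ _ (\sum_(l < m) e)); first by apply: ler_sum => l _; exact: h.
by rewrite sumr_const card_ord mulr_natl.
Qed.

End ApproxRefine.

(** A common bound for both errors of one stage after summing over blocks ([tol_rad]). It at least
    halves from stage to stage, which makes the errors summable, and absorbs n^2 coefficients of
    size 2 T. *)
Definition rad (R : realType) (n T : nat) : R := (n%:R * n%:R * (T.+1%:R * T.+1%:R))^-1.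

Lemma rad_ge0 (R : realType) n T : 0 <= rad R n T.
Proof. by rewrite invr_ge0 !mulr_ge0. Qed.

Lemma rad_half (R : realType) n T n' T' : (0 < n)%N -> (n <= n')%N -> (2 * T.+1 <= T'.+1)%N ->
  rad R n' T' <= rad R n T * 2^-1.
Proof.
move=> n0 nn TT; rewrite /rad -invfM lef_pV2 ?posrE; last 2 first.
- by rewrite !mulr_gt0 // ltr0n (leq_trans n0 nn).
- by rewrite !mulr_gt0 // ltr0n.
have e1 : n%:R <= n'%:R :> R by rewrite ler_nat.
have e2 : 2 * T.+1%:R <= T'.+1%:R :> R by rewrite -natrM ler_nat.
have e3 : 1 <= T.+1%:R :> R by rewrite ler1n.
have e4 : 1 <= n%:R :> R by rewrite ler1n.
have h1 : n%:R * n%:R <= n'%:R * n'%:R :> R by apply: ler_pM.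
have h2 : T.+1%:R * T.+1%:R * 2 <= T'.+1%:R * T'.+1%:R :> R by nra.
by rewrite -[_ * 2]mulrA; apply: ler_pM => //; rewrite !mulr_ge0.
Qed.

Lemma tol_rad (R : realType) n T q : (0 < n)%N -> (q <= n)%N ->
  q%:R * (tol n T).+1%:R^-1 <= rad R n T /\ q%:R * q%:R * (kap n T).+1%:R^-1 <= rad R n T.
Proof.
move=> n0 qn; have n1 : (0 < n * n * (T.+1 * T.+1))%N by rewrite !muln_gt0 n0.
have H (x y : nat) : (x * (n * n * (T.+1 * T.+1)) <= y)%N -> x%:R * y.+1%:R^-1 <= rad R n T.
  move=> le; rewrite ler_pdivrMr ?ltr0n // /rad mulrC ler_pdivlMr; last first.
    by rewrite -!natrM ltr0n.
  by rewrite -!natrM ler_nat (leq_trans le).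
split; last rewrite -natrM; apply: H.
  rewrite /tol (_ : n ^ 3 = n * (n * n))%N; last by rewrite !expnS expn0 muln1.
  by rewrite expnS expn1 -[(n * (n * n) * _)%N]mulnA leq_mul2r qn orbT.
rewrite /kap; apply: (@leq_trans (n ^ 6 * T.+1 ^ 2)); last by rewrite leq_pmull // expn_gt0.
rewrite [in X in (_ <= _ * X)%N]expnS expn1 mulnA leq_mul2r; apply/orP; right.
apply: (@leq_trans (n * n * (n * n))); first by rewrite leq_mul2r leq_mul ?orbT.
rewrite (_ : n * n * (n * n) = n ^ 4)%N ?leq_pexp2l //.
by rewrite !expnS expn0 muln1 !mulnA.
Qed.

Lemma geometric_le0 (R : realType) (x c : R) : (forall t, x <= c * 2 ^- t) -> x <= 0.
Proof.
move=> h; rewrite leNgt; apply/negP => x0.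
have c0 : 0 < c by have := h 0%N; rewrite expr0 invr1 mulr1; exact: lt_le_trans.
have [t ht] := exp2_lt (divr_gt0 x0 c0); have := ht t (leqnn t).
by rewrite ltr_pdivlMr // mulrC => lt; have := h t; rewrite leNgt lt.
Qed.

(** * Exact matrix units as limits of a tower of approximate ones *)

Section Tower.
Variables (R : realType) (ns m T : nat -> nat).
Local Notation n k := ((ns k).+1).
Hypothesis hm : forall k, (n k * m k)%N = n k.+1.
Hypothesis hT : forall k, (2 * (T k).+1 <= (T k.+1).+1)%N.
Local Notation M := (fun s : nat => ('M[R[i]]_((ns s).+1) : starAlgType R[i])).
Variable phi : forall s, {lrmorphism M s -> M s.+1}.
Hypothesis hphi : forall s z, phi s z = \sum_(a < n s) \sum_(b < n s)
  z a b *: refine (m s) (fun i j => delta_mx (inord i) (inord j)) a b.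
Variables (A : cstarType R) (a : nat -> A) (ha : is_presentation a).
Variables (E : nat -> nat -> nat -> calg A) (C : nat -> nat -> nat -> R[i]).
Hypothesis hE : forall k, approx_units (n k) (E k) (kap (n k) (T k)).+1%:R^-1.
Hypothesis hstep : forall k i j, (i < n k)%N -> (j < n k)%N ->
  nrm (E k i j - refine (m k) (E k.+1) i j) <= (tol (n k) (T k)).+1%:R^-1.
Hypothesis hC : forall k, nrm (pval a (nfst k) -
  \sum_(i < n k.+1) \sum_(j < n k.+1) C k i j *: E k.+1 i j) <= (T k).+1%:R^-1.
Hypothesis hC_le : forall k i j, (i < n k.+1)%N -> (j < n k.+1)%N ->
  normc (C k i j) <= 2 * (T k.+1)%:R.

Let m0 k : (0 < m k)%N.
Proof. by have := hm k; case: (m k) => //; rewrite muln0. Qed.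

Let r k : R := rad R (n k) (T k).
Let r0 k : 0 <= r k. Proof. exact: rad_ge0. Qed.

Let r_decr k t : r (k + t) <= r k * 2 ^- t.
Proof.
elim: t => [|t IH]; first by rewrite addn0 expr0 invr1 mulr1.
rewrite addnS exprS invfM [2^-1 * _]mulrC mulrA.
apply: le_trans (_ : _ <= r (k + t) * 2^-1) _.
  by apply: rad_half => //; rewrite -hm leq_pmulr.
by rewrite ler_wpM2r // invr_ge0.
Qed.

Let T_grow k : (2 ^ k <= (T k).+1)%N.
Proof.
by elim: k => [|k IH] //; apply: leq_trans (hT k); rewrite expnS leq_mul2l IH.
Qed.

(** The quotient n(k + t) / n(k). *)
Fixpoint quot k t := if t is t'.+1 then (quot k t' * m (k + t'))%N else 1%N.

Let quotE k t : (n k * quot k t)%N = n (k + t).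
Proof. by elim: t => [|t IH] /=; rewrite ?addn0 ?muln1 // mulnA IH hm addnS. Qed.

Let quot_gt0 k t : (0 < quot k t)%N.
Proof. by have := quotE k t; case: (quot k t) => //; rewrite muln0. Qed.

Let quot_le k t : (quot k t <= n (k + t))%N.
Proof. by rewrite -quotE leq_pmull. Qed.

Let quotS k t : quot k t.+1 = (m k * quot k.+1 t)%N.
Proof.
by elim: t => [|t IH]; rewrite /= ?addn0 ?mul1n ?muln1 // mulnA -IH /= addSnnS.
Qed.

(** The units of stage k + t, summed over blocks to a system of size n(k). *)
Let X k t := refine (quot k t) (E (k + t)).

Let X_step k i j t : (i < n k)%N -> (j < n k)%N ->
  nrm (X k t.+1 i j - X k t i j) <= r k * 2 ^- t.
Proof.
move=> hi hj; rewrite nrmBC /X /= addnS -refine_comp.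
apply: le_trans (r_decr k t).
apply: le_trans (tol_rad R (T (k + t)) _ (quot_le k t)).1 => //.
by apply: refine_dist => l hl; apply: hstep; rewrite -quotE ltn_mul_add.
Qed.

Let X_units k t : approx_units (n k) (X k t) (r k * 2 ^- t).
Proof.
apply: approx_units_mono (r_decr k t) _.
apply: approx_units_mono (tol_rad R (T (k + t)) _ (quot_le k t)).2 _ => //.
by apply: approx_units_refine => //; rewrite quotE; exact: hE.
Qed.

Let X0 k i j : X k 0 i j = E k i j.
Proof. by rewrite /X /refine /= big_ord1 !muln1 !addn0. Qed.

Let X_refine k t i j : X k t.+1 i j = refine (m k) (X k.+1 t) i j.
Proof. by rewrite /X refine_comp quotS addSnnS. Qed.

Let lim_ex : exists F : nat -> nat -> nat -> calg A, forall k i j t, (i < n k)%N -> (j < n k)%N ->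
  nrm (F k i j - X k t i j) <= 2 * r k * 2 ^- t.
Proof.
have H k := exists_lim2 (u := fun i j t => X k t i j) (r0 k) (fun i j t hi hj => X_step t hi hj).
by have [F hF] := choice H; exists F => k; exact: hF.
Qed.

(* The units of size [n k] obtained from stage k + t form a Cauchy sequence in t; the limits are
   exact matrix units, compatible for varying k. *)
Lemma tower_limit : exists mu : forall s, {lrmorphism M s -> calg A}, cocone (M := M) phi mu /\
  forall (x : calg A) e, 0 < e -> exists s (z : M s), nrm (x - mu s z) < e.
Proof.
have [F hF] := lim_ex.
have F_units k : munits (n k) (F k).
  apply: approx_units_munits; apply: approx_units_lim => d d0.
  have [t ht] : exists t, 2 * r k * 2 ^- t <= d.
    have h0 : 0 <= 2 * r k by rewrite mulr_ge0.
    have [g [g0 _ gd]] := small_ex h0 d0; have [t ht] := exp2_lt g0.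
    by exists t; apply/ltW/(le_lt_trans _ gd)/ler_wpM2l => //; exact/ltW/ht.
  exists (X k t); split.
    apply: approx_units_mono (X_units k t); apply: le_trans ht.
    by rewrite ler_wpM2r ?invr_ge0 ?exprn_ge0 //; have := r0 k; lra.
  by move=> i j hi hj; rewrite nrmBC; apply: le_trans ht; exact: hF.
have F_refine k i j : (i < n k)%N -> (j < n k)%N -> F k i j = refine (m k) (F k.+1) i j.
  move=> hi hj; apply/subr0_eq/nrm_eq0/le_anti; rewrite nrm_ge0 andbT.
  apply: (@geometric_le0 _ _ (2 * r k + (m k)%:R * (2 * r k.+1))) => t.
  rewrite mulrDl; apply: (nrm_swap (b := X k t.+1 i j)).
    apply: le_trans (hF k i j t.+1 hi hj) _; rewrite ler_wpM2l ?mulr_ge0 //.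
    by rewrite lef_pV2 ?posrE ?exprn_gt0 // exprS ler_peMl ?exprn_ge0 //; lra.
  rewrite X_refine -mulrA; apply: refine_dist => l hl; rewrite nrmBC.
  by apply: hF; rewrite -hm ltn_mul_add.
have H k := units_hom (F_units k).
pose mu k : {lrmorphism M k -> calg A} := projT1 (cid (H k)).
have mus k : star_preserving (mu k) := (projT2 (cid (H k))).1.
have muE k z : mu k z = \sum_(a < n k) \sum_(b < n k) z a b *: F k a b := (projT2 (cid (H k))).2 z.
have mu_delta k (i j : 'I_(n k)) : mu k (delta_mx i j) = F k i j.
  rewrite muE (bigD1 i) //= (bigD1 j) //= mxE !eqxx scale1r !big1 ?addr0 //.
    move=> i' ii'; rewrite big1 // => j' _.
    by rewrite mxE (negbTE ii') scale0r.
  by move=> j' jj'; rewrite mxE (negbTE jj') andbF scale0r.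
exists mu; split.
  split=> // k z; rewrite hphi [RHS]muE raddf_sum; apply: eq_bigr => i _ /=.
  rewrite raddf_sum; apply: eq_bigr => j _ /=; rewrite linearZ /=; congr (_ *: _).
  rewrite F_refine // raddf_sum; apply: eq_bigr => l _ /=.
  by rewrite mu_delta !inordK // -hm ltn_mul_add.
move=> x e e0; have [p hp] := (presentation_pval a).1 ha x _ (divr_gt0 e0 (ltr0n R 2)).
(* 5 = 1 + 4: the approximation of the polynomial by the span of [E], and the passage from [E] to
   [F]. *)
have [g [g0 _ ge]] := small_ex (ler0n R 5) (divr_gt0 e0 (ltr0n R 2)).
(* Stage [k] treats the polynomial [nfst k = p] and is as late as wanted, since k >= K. *)
have [K hK] := exp2_lt g0; pose k := npair p K.
have snd_le p' K' : (K' <= npair p' K')%N by have := nsnd_le (npair p' K'); rewrite npE.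
exists k.+1, (\matrix_(i, j) C k i j); rewrite muE.
have TK : (T k).+1%:R^-1 <= g.
  apply/ltW/(le_lt_trans _ (hK k (snd_le p K))); rewrite lef_pV2 ?posrE ?exprn_gt0 ?ltr0n //.
  by rewrite -natrX ler_nat T_grow.
have h1 := hC k; rewrite /k npE -/k in h1.
have TS : (T k.+1).+1%:R^-1 <= (T k).+1%:R^-1 :> R.
  rewrite lef_pV2 ?posrE ?ltr0n // ler_nat; apply: leq_trans (hT k).
  by rewrite leq_pmull.
(* There are n^2 terms of size at most 2 T * 2 rad with rad = 1 / (n^2 (T + 1)^2), together at most
   4 T / (T + 1)^2. *)
have h2 : nrm (\sum_(i < n k.+1) \sum_(j < n k.+1) C k i j *: E k.+1 i j -
    \sum_(i < n k.+1) \sum_(j < n k.+1) (\matrix_(i, j) C k i j : M k.+1) i j *: F k.+1 i j) <=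
    4 * (T k.+1).+1%:R^-1.
  have e1 (i j : 'I_(n k.+1)) : nrm (C k i j *: E k.+1 i j - (\matrix_(i, j) C k i j : M k.+1) i j *: F k.+1 i j) <=
      2 * (T k.+1)%:R * (2 * r k.+1).
    rewrite mxE -scalerBr nrmZ; apply: ler_pM; rewrite ?normc_ge0 ?nrm_ge0 ?hC_le //.
    by have := hF k.+1 i j 0%N (ltn_ord i) (ltn_ord j); rewrite X0 nrmBC expr0 invr1 mulr1.
  rewrite -sumrB; apply: le_trans (nrm_sum _ _ _) _.
  apply: (@le_trans _ _ (\sum_(i < n k.+1) (n k.+1)%:R * (2 * (T k.+1)%:R * (2 * r k.+1)))).
    apply: ler_sum => i _; rewrite -sumrB; apply: le_trans (nrm_sum _ _ _) _.
    apply: (@le_trans _ _ (\sum_(j < n k.+1) (2 * (T k.+1)%:R * (2 * r k.+1)))).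
      by apply: ler_sum => j _; exact: e1.
    by rewrite sumr_const card_ord -[leLHS]mulr_natl.
  rewrite sumr_const card_ord -[leLHS]mulr_natl /r /rad.
  have nn : (n k.+1)%:R != 0 :> R by rewrite pnatr_eq0.
  rewrite !invfM; move: ((n k.+1)%:R : R) nn => N N0.
  have tt : (T k.+1).+1%:R != 0 :> R by rewrite pnatr_eq0.
  have tE : (T k.+1).+1%:R^-1 * (T k.+1).+1%:R = 1 :> R by rewrite mulVf.
  have t0 : 0 < (T k.+1).+1%:R^-1 :> R by rewrite invr_gt0 ltr0n.
  have T0 : 0 <= (T k.+1)%:R :> R by [].
  have tS : (T k.+1).+1%:R = (T k.+1)%:R + 1 :> R by rewrite natr1.
  rewrite tS in tE t0 *; move: ((T k.+1)%:R : R) ((T k.+1)%:R + 1)^-1 tE t0 T0 => t u tu u0 t0.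
  have -> : N * (N * (2 * t * (2 * (N^-1 * N^-1 * (u * u))))) = 4 * (u * (u * t)) by field.
  by nra.
apply: le_lt_trans (_ : _ <= nrm (x - pval a p) + 5 * g) _; last by move: hp ge; lra.
apply: (nrm_swap (lexx _)).
apply: le_trans (nrm_swap h1 h2) _.
by move: ((T k).+1%:R^-1 : R) ((T k.+1).+1%:R^-1 : R) TK TS => u v *; lra.
Qed.

End Tower.

Lemma inductive_limit_unique (R : realType) (M : nat -> starAlgType R[i])
    (phi : forall s, {lrmorphism M s -> M s.+1}) (A B : cstarType R) :
  is_inductive_limit phi A -> is_inductive_limit phi B -> star_isomorphic A B.
Proof.
move=> [mu cmu umu] [nu cnu unu].
have [[h [hs hE]] _] := umu B nu cnu; have [[g [gs gE]] _] := unu A mu cmu.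
have [_ uA] := umu A mu cmu; have [_ uB] := unu B nu cnu.
exists h => //; exists g => x.
- have := @uA (g \o h : {lrmorphism calg A -> calg A}) (idfun : {lrmorphism calg A -> calg A}).
  apply=> //; first by move=> y /=; rewrite hs gs.
  by move=> s y /=; rewrite hE gE.
- have := @uB (h \o g : {lrmorphism calg B -> calg B}) (idfun : {lrmorphism calg B -> calg B}).
  apply=> //; first by move=> y /=; rewrite gs hs.
  by move=> s y /=; rewrite gE hE.
Qed.

(** The two numerators in a rational code are components of that code, hence at most [c], and the
    denominator is at least 1. *)
Lemma cst_le (R : realType) p q c : (p <= c)%N -> (q <= c)%N -> normc (cst R p q) <= 2 * c%:R.
Proof.
have H r : (r <= c)%N -> `|qr R r| <= c%:R.
  move=> rc; have uc : (nfst (nfst r) <= c)%N.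
    by apply: leq_trans rc; apply: leq_trans (nfst_le _) (nfst_le _).
  have vc : (nsnd (nfst r) <= c)%N.
    by apply: leq_trans rc; apply: leq_trans (nsnd_le _) (nfst_le _).
  rewrite qrE normrM [X in _ * X]gtr0_norm ?invr_gt0 ?ltr0n //.
  rewrite ler_pdivrMr ?ltr0n //; apply: (@le_trans _ _ c%:R); last first.
    by rewrite ler_peMr // ler1n.
  have {}uc : (nfst (nfst r))%:R <= c%:R :> R by rewrite ler_nat.
  have {}vc : (nsnd (nfst r))%:R <= c%:R :> R by rewrite ler_nat.
  have u0 : 0 <= (nfst (nfst r))%:R :> R by [].
  have v0 : 0 <= (nsnd (nfst r))%:R :> R by [].
  by rewrite ler_norml; apply/andP; split; lra.
move=> /H pc /H qc; apply: le_trans (normc_le _ _) _.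
by move: pc qc; move: (`|_|) (`|_|) => x y; lra.
Qed.

Section Side.
Variables (R : realType) (ns m T : nat -> nat).
Local Notation n k := ((ns k).+1).
Hypothesis hm : forall k, (n k * m k)%N = n k.+1.
Hypothesis hT : forall k, (2 * (T k).+1 <= (T k.+1).+1)%N.
Local Notation M := (fun s : nat => ('M[R[i]]_((ns s).+1) : starAlgType R[i])).
Variable phi : forall s, {lrmorphism M s -> M s.+1}.
Hypothesis hphi : forall s z, phi s z = \sum_(a < n s) \sum_(b < n s)
  z a b *: refine (m s) (fun i j => delta_mx (inord i) (inord j)) a b.
Variables (A : cstarType R) (a : nat -> A) (U : nat -> nat -> nat -> Prop) (e : nat).
Hypothesis hU : cuts U e (fun p => nrm (pval a p)).
Hypothesis ha : is_presentation a.
Variables (L c : nat -> nat).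
Hypothesis hL : forall k, good U e (L k) (n k) (kap (n k) (T k)).
Hypothesis hx : forall k, extn U e (n k) (T k) (L k) (T k) (nfst k) (m k) (T k.+1) (L k.+1) (c k).

Lemma tower_side : is_inductive_limit (M := M) phi A.
Proof.
have [||||mu [cmu dmu]] := tower_limit hm hT hphi ha (E := fun k i j => pval a (ment (L k) i j))
  (C := fun k i j => cst R (nfst (ment (c k) i j)) (nsnd (ment (c k) i j))).
- by move=> k; exact: (good_approx hU (hL k)).
- move=> k i j hi hj; have [_ [_ [h _]]] := hx k; have /hU := h i hi j hj.
  by rewrite pval_sub pval_sum qr_rinv => /ltW.
- move=> k; have [_ [_ [_ h]]] := hx k; move/hU: h.
  rewrite hm pval_sub pval_sum qr_rinv => /ltW; apply: le_trans.
  rewrite le_eqVlt; apply/orP; left; apply/eqP; congr (nrm (_ - _)).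
  apply: eq_bigr => i _; rewrite pval_sum; apply: eq_bigr => j _.
  by rewrite pval_mul pval_const -scalerAl mul1r.
- move=> k i j hi hj; have [h _] := hx k.
  by apply: cst_le; apply: leq_trans h; rewrite (leq_trans _ (lnth_le _ (npair i j))) //;
    rewrite ?nfst_le ?nsnd_le.
exact: (dense_inductive_limit cmu dmu).
Qed.

End Side.

Opaque kap tol.

(** A state holds a size, a bound and one family for each side; stage [k] treats the polynomial
    [nfst k], so every polynomial recurs at arbitrarily late stages. The bonding maps are standard
    embeddings, determined by the sizes alone: both algebras are limits of one and the same
    system. *)
Lemma backward (R : realType) (A B : cstarType R) (a : nat -> A) (b : nat -> B) U e e' :
  cuts U e (fun p => nrm (pval a p)) -> cuts U e' (fun p => nrm (pval b p)) ->
  is_presentation a -> is_presentation b -> ext_cond U e e' ->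
  [/\ is_UHF A, is_UHF B & star_isomorphic A B].
Proof.
move=> ha hb pa pb ext.
pose P (s : nat * nat * nat * nat) := let: (N, T, L1, L2) := s in
  good U e L1 N.+1 (kap N.+1 T) /\ good U e' L2 N.+1 (kap N.+1 T).
pose S k (s s' : nat * nat * nat * nat) (w : nat * nat * nat) :=
  let: (N, T, L1, L2) := s in let: (N', T', L1', L2') := s' in let: (m, c1, c2) := w in
  [/\ (N.+1 * m)%N = N'.+1, (2 * T.+1 <= T'.+1)%N,
      extn U e N.+1 T L1 T (nfst k) m T' L1' c1 & extn U e' N.+1 T L2 T (nfst k) m T' L2' c2].
have mono (V : cstarType R) (v : nat -> V) f n T L T0 T1 j m T' L' c :
    cuts U f (fun p => nrm (pval v p)) -> (T1 <= T0)%N ->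
    extn U f n T L T0 j m T' L' c -> extn U f n T L T1 j m T' L' c.
  move=> hv TT [h1 [h2 [h3 h4]]]; split=> //; split=> //; split=> //.
  apply/hv; move/hv: h4 => h4; apply: lt_le_trans h4 _.
  by rewrite !qr_rinv lef_pV2 ?posrE ?ltr0n // ler_nat.
have step k s : exists s', P s -> P s' /\ exists w, S k s s' w.
  case: s => [[[N T] L1] L2]; case: (pselect (P (N, T, L1, L2))) => [[g1 g2]|nP]; last first.
    (* An arbitrary state: nothing is claimed outside [P]. *)
    by exists (0%N, 0%N, 0%N, 0%N).
  (* The parameter [T0] is set to 2 (T + 1) because [T0 <= T'] then forces [T] to double; [mono]
     afterwards relaxes the approximation to [T]. *)
  have [m [T' [m0 [TT [[L1' [c1 x1]] [L2' [c2 x2]]]]]]] :=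
    ext N.+1 T L1 L2 (2 * T.+1)%N (nfst k) isT g1 g2.
  have nm : (N.+1 * m)%N = (N.+1 * m).-1.+1 by rewrite prednK // muln_gt0.
  exists ((N.+1 * m).-1, T', L1', L2') => _; split.
    by rewrite /P -nm; split; [exact: x1.2.1 | exact: x2.2.1].
  have le2 : (T <= 2 * T.+1)%N by rewrite mul2n -addnn addSn ltnW // ltnS leq_addr.
  exists (m, c1, c2); split=> //; first exact: leqW.
    exact: (mono _ _ _ _ _ _ _ _ _ _ _ _ _ ha le2 x1).
  exact: (mono _ _ _ _ _ _ _ _ _ _ _ _ _ hb le2 x2).
(* The tower starts with the unit as an exact 1 x 1 system in both algebras. *)
have [L0 hL0] := ment_ex (fun _ _ => pone) 1.
have P0 : P (0%N, 0%N, L0, L0).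
  have au (V : cstarType R) (v : nat -> V) : approx_units 1 (fun i j => pval v (ment L0 i j)) 0.
    split=> [i j hi hj|i j k l hi hj hk hl|].
    - by rewrite !hL0 // pval1 star1 subrr nrm0.
    - rewrite !hL0 // pval1 mulr1; move: hj hk; rewrite !ltnS !leqn0 => /eqP -> /eqP ->.
      by rewrite eqxx subrr nrm0.
    - by rewrite big_ord1 hL0 // pval1 subrr nrm0.
  by split; [apply: (approx_good ha _ (au A a)) | apply: (approx_good hb _ (au B b))];
    rewrite invr_gt0 ltr0n.
have [f hf] := choice2 step.
pose st := fix st k := if k is k'.+1 then f k' (st k') else (0%N, 0%N, L0, L0).
have Pst k : P (st k) by elim: k => [|k IH] //; exact: (hf k (st k) IH).1.
have [w hw] := choice (fun k => (hf k (st k) (Pst k)).2).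
pose ns k := (st k).1.1.1; pose T k := (st k).1.1.2.
have hm k : ((ns k).+1 * (w k).1.1)%N = (ns k.+1).+1.
  have := hw k; rewrite /ns /S /=; case: (st k) => [[[? ?] ?] ?]; case: (f _ _) => [[[? ?] ?] ?].
  by case: (w k) => [[? ?] ?] [].
have hT k : (2 * (T k).+1 <= (T k.+1).+1)%N.
  have := hw k; rewrite /T /S /=; case: (st k) => [[[? ?] ?] ?]; case: (f _ _) => [[[? ?] ?] ?].
  by case: (w k) => [[? ?] ?] [].
have H s := standard_embedding R (hm s).
pose phi s : {lrmorphism 'M[R[i]]_((ns s).+1) -> 'M[R[i]]_((ns s.+1).+1)} := projT1 (cid (H s)).
have phis s : star_preserving (phi s) := (projT2 (cid (H s))).1.
have phiE s := (projT2 (cid (H s))).2.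
have limA : is_inductive_limit (M := fun s => 'M[R[i]]_((ns s).+1)) phi A.
  apply: (tower_side hm hT (phi := phi) phiE ha pa (L := fun k => (st k).1.2) (c := fun k => (w k).1.2)) => k.
    by have := Pst k; rewrite /ns /T /P; case: (st k) => [[[? ?] ?] ?] [h _]; exact: h.
  have := hw k; rewrite /ns /T /S /=; case: (st k) => [[[? ?] ?] ?]; case: (f _ _) => [[[? ?] ?] ?].
  by case: (w k) => [[? ?] ?] [_ _ h _]; exact: h.
have limB : is_inductive_limit (M := fun s => 'M[R[i]]_((ns s).+1)) phi B.
  apply: (tower_side hm hT (phi := phi) phiE hb pb (L := fun k => (st k).2) (c := fun k => (w k).2)) => k.
    by have := Pst k; rewrite /ns /T /P; case: (st k) => [[[? ?] ?] ?] [_ h]; exact: h.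
  have := hw k; rewrite /ns /T /S /=; case: (st k) => [[[? ?] ?] ?]; case: (f _ _) => [[[? ?] ?] ?].
  by case: (w k) => [[? ?] ?] [_ _ _ h]; exact: h.
by split; [exists ns, phi | exists ns, phi | exact: (inductive_limit_unique limA limB)].
Qed.

Lemma normcD (R : realType) (x y : R[i]) : normc (x + y) <= normc x + normc y.
Proof. by have := ler_normD x y; rewrite -lecR rmorphD. Qed.

Lemma normcN (R : realType) (x : R[i]) : normc (- x) = normc x.
Proof. by case: x => a b; rewrite /= !sqrrN. Qed.

Lemma normc_conj (R : realType) (x : R[i]) : normc x^* = normc x.
Proof. by case: x => a b; rewrite /= sqrrN. Qed.

(** * Completeness *)

Section ValueNorm.
Variable R : realType.

Definition cvalue (p : nat) : R[i] := cst R (nfst (value p)) (nsnd (value p)).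

Lemma cvalue_const m n : cvalue (pconst m n) = cst R m n.
Proof. by rewrite /cvalue value_const !npE. Qed.

Lemma cvalue_star p : cvalue (pstar p) = (cvalue p)^*.
Proof. by rewrite /cvalue value_star !npE /cst qr_rneg. Qed.

Lemma cvalue_add p q : cvalue (padd p q) = cvalue p + cvalue q.
Proof. by rewrite /cvalue value_add !npE /cst !qr_radd. Qed.

Lemma cvalue_mul p q : cvalue (pmul p q) = cvalue p * cvalue q.
Proof. by rewrite /cvalue value_mul !npE /cst !qr_radd qr_rneg !qr_rmul. Qed.

Lemma cvalue_sub p q : cvalue (psub p q) = cvalue p - cvalue q.
Proof. by rewrite cvalue_add cvalue_mul cvalue_const cstm10 mulN1r. Qed.

Lemma cvalue0 : cvalue p0 = 0. Proof. by rewrite cvalue_const cst00. Qed.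
Lemma cvalue1 : cvalue pone = 1. Proof. by rewrite cvalue_const cst10. Qed.

Definition value_norm p : R := normc (cvalue p).

Lemma value_seminorm : cstar_seminorm value_norm.
Proof.
have nc (x y : R) : normc (x +i* y)%C ^+ 2 <= x ^+ 2 + y ^+ 2 by rewrite normc_sqr.
have n0 : normc 0 = 0 :> R by exact: normc0.
have cC m n : (cst R m n)^* = cst R m (rneg n) by rewrite /cst qr_rneg.
have cD p q r t : cst R (radd p r) (radd q t) = cst R p q + cst R r t by rewrite /cst !qr_radd.
have cM p q r t : cst R (radd (rmul p r) (rneg (rmul q t))) (radd (rmul p t) (rmul q r)) =
    cst R p q * cst R r t by rewrite /cst !qr_radd qr_rneg !qr_rmul.
have tri (x y z : R[i]) : normc (x - z) <= normc (x - y) + normc (y - z).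
  by rewrite -[x - z](subrKA y); exact: normcD.
have dist (x y : R[i]) : normc x <= normc y + normc (x - y).
  by rewrite -{1}[x](subrKC y); exact: normcD.
split=> *; rewrite /value_norm
  ?(cvalue_sub, cvalue_add, cvalue_mul, cvalue_star, cvalue0, cvalue1, cvalue_const).
- exact: normc_ge0.
- by rewrite normc1.
- exact: normcD.
- by rewrite normcM.
- by rewrite normc_conj.
- by rewrite normcM normc_conj.
- exact: nc.
- by rewrite subrr.
- by rewrite -normcN opprB.
- exact: tri.
- exact: dist.
- by rewrite subr0.
- rewrite opprD addrACA; exact: normcD.
- by rewrite -mulrBr normcM.
- by rewrite -mulrBl normcM.
- by rewrite -rmorphB normc_conj.
- exact: nc.
- by rewrite addrA subrr.
- by rewrite [X in X - _]addrC subrr.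
- by rewrite add0r subrr.
- by rewrite cstm10 mulN1r addNr subr0.
- by rewrite mulrA subrr.
- by rewrite mul1r subrr.
- by rewrite mulr1 subrr.
- by rewrite mulrDl subrr.
- by rewrite mulrDr subrr.
- by rewrite cD subrr.
- by rewrite cM subrr.
- by rewrite [X in X - _]mulrC subrr.
- by rewrite cC subrr.
- by rewrite conjCK subrr.
- by rewrite rmorphD subrr.
- by rewrite rmorphM mulrC subrr.
Qed.

(** The complex numbers with all special points equal to 0, obtained by completing the *-polynomials
    in the seminorm |p(0)|; this yields the presentation and its norms at once. *)
Definition scalar_alg : cstarType R := compl_alg value_seminorm.
Definition scalar_gen : nat -> scalar_alg := compl_gen value_seminorm.

Lemma scalar_alg_UHF : is_UHF scalar_alg.
Proof.
have u1 : munits 1 (fun _ _ => 1 : calg scalar_alg).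
  split=> [i j _ _|i j k l _ hj hk _|]; first exact: star1.
    by move: hj hk; rewrite !ltnS !leqn0 mulr1 => /eqP -> /eqP ->.
  by rewrite big_ord1.
have [f [fs fE]] := units_hom u1.
(* The constant system of 1 x 1 matrices; sizes are shifted by one. *)
exists (fun=> 0%N), (fun=> idfun); split=> //.
apply: (dense_inductive_limit (mu := fun=> f)); first by [].
move=> x e e0; have [p hp] := (presentation_pval _).1 (@compl_presentation _ _ value_seminorm) x e e0.
exists 0%N, (const_mx (cvalue p)); rewrite fE !big_ord1 mxE -(pval_const scalar_gen).
suff -> : pval scalar_gen (pconst (nfst (value p)) (nsnd (value p))) = pval scalar_gen p by [].
apply/subr0_eq/nrm_eq0; rewrite -pval_sub nrm_compl /value_norm cvalue_sub cvalue_const.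
by rewrite subrr normc0.
Qed.

Lemma qr_dyadic j y : qr R (dyadic j y) = y%:R / 2 ^+ j.
Proof. by rewrite qrE /dyadic !npE subr0 prednK ?expn_gt0 // natrX. Qed.

Lemma aboveE x y : above x y = (value_norm (nfst x) < y%:R / 2 ^+ (nsnd x).+1).
Proof.
have y0 : 0 <= y%:R / 2 ^+ (nsnd x).+1 :> R by rewrite divr_ge0 // exprn_ge0.
rewrite /above (rltE R) !qr_rmul qr_dyadic /value_sqr qr_radd !qr_rmul -!expr2.
by rewrite -normc_sqr ltr_pXn2r // ?nnegrE ?normc_ge0.
Qed.

Lemma above_ex x : exists y, above x y.
Proof.
have p2 : 0 < 2 ^+ (nsnd x).+1 :> R by rewrite exprn_gt0.
have n0 : 0 <= value_norm (nfst x) * 2 ^+ (nsnd x).+1 by rewrite mulr_ge0 ?normc_ge0 // ltW.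
exists (Num.bound (value_norm (nfst x) * 2 ^+ (nsnd x).+1)).
by rewrite aboveE ltr_pdivlMr // archi_boundP.
Qed.

(** The least multiple of 2^-(j+1) above the norm. These approximations decrease in j and have a
    known error, so the same program is an index in both senses. *)
Definition value_above x : nat := dyadic (nsnd x).+1 (ex_minn (above_ex x)).

Lemma comp_value_above : comp value_above.
Proof.
apply: comp_pair; last by apply: comp_pred; comp_tac2.
apply: comp_pair; last exact: comp_const.
apply: (comp_search dec_above) => x; case: ex_minnP => y hy ymin; split=> // m.
by apply: contraTN => /ymin; rewrite -leqNgt.
Qed.

Lemma value_above_gt x : value_norm (nfst x) < qr R (value_above x).
Proof. by rewrite /value_above qr_dyadic; case: ex_minnP => y; rewrite aboveE. Qed.

Lemma value_above_le x : qr R (value_above x) <= value_norm (nfst x) + 2 ^- (nsnd x).+1.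
Proof.
rewrite /value_above qr_dyadic; case: ex_minnP => -[|y] hy ymin.
  by rewrite mul0r addr_ge0 ?normc_ge0 // invr_ge0 exprn_ge0.
have := contraNN (ymin y); rewrite aboveE -ltnNge ltnSn -leNgt => /(_ isT) h.
by rewrite -natr1 mulrDl mul1r lerD2r.
Qed.

(** A numerator admissible at level j becomes admissible at level j + 1 when doubled; this is why
    the bounds are dyadic. *)
Lemma value_above_decr p j : qr R (value_above (npair p j.+1)) <= qr R (value_above (npair p j)).
Proof.
rewrite /value_above !qr_dyadic !npE; case: ex_minnP => y hy ymin; case: ex_minnP => z hz _.
have /ymin : above (npair p j.+1) (2 * z).
  move: hz; rewrite !aboveE !npE natrM [2 ^+ j.+2]exprS invfM mulrACA divff ?mul1r //.
rewrite -(ler_nat R) natrM => yz; rewrite [2 ^+ j.+2]exprS invfM mulrA ler_wpM2r //.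
by rewrite ler_pdivrMr // mulrC.
Qed.

Section ScalarIndex.
Variable e : nat.
Hypothesis he : forall x, phi_eval e x (value_above x).

Let gen_norm p : rnorm (peval scalar_gen p) = value_norm (encode_poly p).
Proof. by rewrite -[LHS]/(nrm (peval scalar_gen p)) -pval_encode nrm_compl. Qed.

Let close p j : `|value_norm p - qr R (value_above (npair p j))| <= 2 ^- j.+1.
Proof.
have := value_above_gt (npair p j); have := value_above_le (npair p j); rewrite !npE => h1 h2.
rewrite distrC ger0_norm; first by rewrite lerBlDl.
by rewrite subr_ge0 ltW.
Qed.

Lemma scalar_computable_index : computable_index e scalar_gen.
Proof.
split; first exact: compl_presentation.
move=> p k; exists (value_above (npair (encode_poly p) k)); first exact: he.
rewrite -/(qr R _) gen_norm distrC; apply: le_lt_trans (close _ _) _.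
by rewrite ltf_pV2 ?posrE ?exprn_gt0 // exprS ltr_pMl ?exprn_gt0 // ltr1n.
Qed.

Lemma scalar_ce_index : ce_index e scalar_gen.
Proof.
split; first exact: compl_presentation.
move=> p; exists (fun j => value_above (npair (encode_poly p) j)); split.
- by move=> j; exact: he.
- move=> i j /subnK <-; elim: (j - i)%N => // k IH; apply: le_trans IH.
  by rewrite -(ler_rat R); exact: value_above_decr.
- rewrite gen_norm; apply/(null_cvg (fun j => qr R (value_above (npair (encode_poly p) j)))).
  move=> d d0; have [K hK] := exp2_lt d0; exists K => n Kn.
  by apply: le_trans (close _ _) _; apply/ltW/hK/leqW.
Qed.

End ScalarIndex.

End ValueNorm.

(* One index is that of the complex numbers, the other one is a copy of it that diverges at [i] if
   no [z] satisfies [r x i z]: it is an index of a presentation if and only if [x] is in [T]. *)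
Lemma UHF_hardness (R : realType) (index : nat -> forall A : cstarType R, (nat -> A) -> Prop) :
  (forall e, (forall x, phi_eval e x (value_above R x)) -> index e _ (@scalar_gen R)) ->
  (forall e A a, index e A a -> forall x, exists n, phi_eval e x n) ->
  forall T, Pi02 T ->
    many_one_reducible T [set Cantor.to_nat p | p in UHF_isomorphism_problem index].
Proof.
move=> hgood htot T [r hr hT].
have [f hf fE] := guarded_index hr (comp_value_above R).
have [c hc] := comp_value_above R.
have h0 x : phi_eval (encode_code c) x (value_above R x) by apply/phi_evalE.
exists (fun x => npair (encode_code c) (f x)) => [|x].
  by apply: comp_computable; comp_tac2.
split=> [/hT Tx|].
  exists (encode_code c, f x) => //.
  exists (scalar_alg R), (scalar_alg R), (@scalar_gen R), (@scalar_gen R); split.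
  - exact: scalar_alg_UHF.
  - exact: scalar_alg_UHF.
  - exact: hgood.
  - by apply: hgood => i; apply/fE.
  - by exists idfun => //; exists idfun.
move=> [[e1 e2] [A [B [a [b [_ _ _ hb _]]]]] e12].
have [_ e2E] : e1 = encode_code c /\ e2 = f x by exact: npair_inj.
apply/hT => i; have [n] := htot _ _ _ hb i; rewrite /= e2E => /fE[ez _].
exact: ez.
Qed.

(** A kind of index enters only through its upper cuts [U] and the condition [I]. Numbers satisfying
    [pair_cond] are realised by completions of the *-polynomials, to which [backward] applies;
    conversely, the norms of given algebras satisfy [norm_cond] and [forward_ext]. *)
Lemma UHF_membership (R : realType) (index : nat -> forall A : cstarType R, (nat -> A) -> Prop) U I :
  (forall f g h, comp f -> comp g -> comp h -> Sig (fun x => U (f x) (g x) (h x))) -> Pi2 I ->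
  (forall e A a, index e A a -> is_presentation a) ->
  (forall e A a, index e A a -> I e /\ cuts U e (fun p => nrm (pval a p))) ->
  (forall e, I e -> exists s : nat -> R, cuts U e s /\
    forall (A : cstarType R) (a : nat -> A), is_presentation a ->
      (forall p, nrm (pval a p) = s p) -> index e A a) ->
  Pi02 [set Cantor.to_nat p | p in UHF_isomorphism_problem index].
Proof.
move=> hU hI hp hcut hcompl; apply: Pi2_Pi02.
apply: Pi2_ext (Pi2_pair_cond hU hI) => x; split.
  move=> [[/hcompl[s0 [c0 i0]] /hcompl[s1 [c1 i1]]] [[n0 n1] ext]].
  have H0 := norm_cond_seminorm c0 n0; have H1 := norm_cond_seminorm c1 n1.
  have p0 := @compl_presentation _ _ H0; have p1 := @compl_presentation _ _ H1.
  have k0 : cuts U (nfst x) (fun p => nrm (pval (compl_gen H0) p)).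
    by move=> p r; rewrite nrm_compl.
  have k1 : cuts U (nsnd x) (fun p => nrm (pval (compl_gen H1) p)).
    by move=> p r; rewrite nrm_compl.
  have [uA uB iso] := backward k0 k1 p0 p1 ext.
  exists (nfst x, nsnd x); last exact: npairK.
  exists (compl_alg H0), (compl_alg H1), (compl_gen H0), (compl_gen H1); split=> //.
    by apply: i0 => // p; exact: nrm_compl.
  by apply: i1 => // p; exact: nrm_compl.
move=> [[e1 e2] [A [B [a [b [uA uB ia ib iso]]]]] <-].
rewrite /pair_cond -[Cantor.to_nat _]/(npair e1 e2) !npE.
have [I1 c1] := hcut _ _ _ ia; have [I2 c2] := hcut _ _ _ ib.
split=> //; split; first by split; apply: seminorm_norm_cond (calg_seminorm _); eassumption.
exact: (forward_ext c1 c2 (hp _ _ _ ia) (hp _ _ _ ib) uA iso).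
Qed.

Theorem theorem12p6 (R : realType) :
  Pi02_complete2 (UHF_isomorphism_problem (@computable_index R)) /\
  Pi02_complete2 (UHF_isomorphism_problem (@ce_index R)).
Proof.
split; split.
- apply: (UHF_membership Sig_U_comp Pi2_I_comp) => [e A a []//|e A a|e].
  + exact: comp_index_cuts.
  + exact: comp_index_complete.
- apply: UHF_hardness => [e he|e A a /comp_index_cuts[[]]//].
  exact: scalar_computable_index.
- apply: (UHF_membership Sig_U_ce Pi2_I_ce) => [e A a []//|e A a|e].
  + exact: ce_index_cuts.
  + exact: ce_index_complete.
- apply: UHF_hardness => [e he|e A a /ce_index_cuts[[]]//].
  exact: scalar_ce_index.
Qed.
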